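(* Let $H$ be an infinite-dimensional Hilbert space, let $\mathcal{L}_0^p:=\mathcal{L}_0^p(H)$ be the corresponding $p$-Schatten ideals for $1\le p\le\infty$ (with $\mathcal{L}^\infty_0$ the compact operators), and let $\mu_{p\mid 0}$ and $\mu_{p\mid 0}^*$ be the locally convex topologies induced on the algebra $\mathcal{B}(H)$ of all bounded operators regarded, respectively, as left multipliers or as bilateral multipliers on $\mathcal{L}_0^p$. (1) The topologies $\mu_{p\mid 0}$ are ordered strictly increasingly in $p\in[1,\infty]$ by strength (if $p<q$ then $\mu_{p\mid 0}$ is strictly coarser than $\mu_{q\mid 0}$); the same goes for the topologies $\mu^*_{p\mid 0}$. In fact, if $p<q$ then $\mu_{q\mid 0}\not\preceq\mu^*_{p\mid 0}$, i.e. $\mu_{q\mid 0}$ is not contained in $\mu^*_{p\mid 0}$. (2) All $\mu_{p\mid 0}$, $1\le p\le \infty$, coincide on (norm-)bounded subsets of $\mathcal{B}(H)$, as do all $\mu_{p\mid 0}^*$. (3) The topologies $\mu_{p\mid 0}$ and $\mu_{p\mid 0}^*$, $1\le p\le\infty$, all have the same bounded sets, namely the norm-bounded ones, and the same continuous linear functionals, namely the weak$^*$-continuous ones.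
   Context: $\mathcal{B}(H)$ and $\mathcal{K}(H)$ are the bounded and the compact operators on $H$. For compact $T$, $\mu_0(T)\ge\mu_1(T)\ge\cdots\ge 0$ are the eigenvalues of $|T|=(T^*T)^{1/2}$, with multiplicity for the positive ones, padded with zeros if only finitely many are positive. For $1\le p<\infty$, $\mathcal{L}^p_0(H)=\mathcal{L}^p(H)$ is the ideal of compact operators $T$ with $\|T\|_p:=\left(\sum_{n\ge0}\mu_n(T)^p\right)^{1/p}<\infty$, normed by $\|\cdot\|_p$. For $p=\infty$, $\mathcal{L}^\infty_0(H):=\mathcal{K}(H)$ with the operator norm $\|\cdot\|_\infty$. $\mu_{p\mid 0}$ is the locally convex topology on $\mathcal{B}(H)$ induced by the seminorms $x\mapsto\|xy\|_p$, $y\in\mathcal{L}_0^p$; $\mu^*_{p\mid 0}$ is the one induced by all seminorms $x\mapsto\|xy\|_p$ and $x\mapsto\|yx\|_p$, $y\in\mathcal{L}^p_0$. For topologies, $\tau\preceq\tau'$ means that $\tau$ is coarser than (or equal to) $\tau'$. A set in a locally convex space is bounded if it is absorbed by every neighborhood of the origin. The weak$^*$ topology on $\mathcal{B}(H)$ is that of the duality with the predual $\mathcal{B}(H)_*\cong\mathcal{L}^1(H)$ (trace-class operators) via $(T,X)\mapsto\mathrm{tr}(TX)$. *)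

(* Defs.v *)
From HB Require Import structures.
From mathcomp Require Import all_boot all_order all_algebra.
From mathcomp Require Import complex.
From mathcomp Require Import all_classical all_reals all_analysis.
From mathcomp Require Import showcase.summability.

Set Implicit Arguments.
Unset Strict Implicit.
Unset Printing Implicit Defensive.

Import Order.TTheory GRing.Theory Num.Theory.
Import numFieldNormedType.Exports.

Local Open Scope classical_set_scope.
Local Open Scope ring_scope.
Local Open Scope complex_scope.

(* Complex Hilbert spaces; the inner product is linear in its first argument. *)
HB.mixin Record NormedModule_isHilbert (R : realType) V
    & NormedModule R[i] V := {
  hdot : V -> V -> R[i];
  hdot_linearl : forall (a : R[i]) (x y z : V),
    hdot (a *: x + y) z = a * hdot x z + hdot y z;
  hdot_conj : forall x y : V, hdot x y = Num.conj (hdot y x);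
  hdot_norm : forall x : V, hdot x x = `|x| ^+ 2 }.

#[short(type="hilbertType")]
HB.structure Definition Hilbert (R : realType) :=
  {V of CompleteNormedModule R[i] V & NormedModule_isHilbert R V}.

(* The norm of a normedModType R[i] is valued in R[i]; this is the same number
   as an element of R. *)
Definition rnorm (R : realType) (V : normedModType R[i]) (x : V) : R :=
  complex.Re `|x|.

Section LinearAlgebra.
Context (R : realType) (V : lmodType R[i]).
Implicit Types (E : set V) (k : nat).

Definition lin_indep k (b : 'I_k -> V) : Prop :=
  forall c : 'I_k -> R[i], \sum_i c i *: b i = 0 -> forall i, c i = 0.

Definition lin_span k (b : 'I_k -> V) : set V :=
  [set x | exists c : 'I_k -> R[i], x = \sum_i c i *: b i].

Definition has_dim E k : Prop :=
  exists b : 'I_k -> V, lin_indep b /\ E = lin_span b.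

Definition infinite_dimensional : Prop := forall k, ~ has_dim [set: V] k.

End LinearAlgebra.
Arguments infinite_dimensional {R} V.

Section SeminormTopology.
Context (R : realType) (V : lmodType R[i]).
Implicit Types (P : set (V -> \bar R)) (U : set V).

(* V with the topology induced by the seminorms in P: the open sets are those
   that contain, with each point x, a finite intersection of balls
   {y | f (y - x) < e}, f in P.  Seminorms are allowed extended real values only
   because the Schatten norms below are defined on all operators. *)
Definition seminormed P : Type := V.

HB.instance Definition _ P := GRing.Lmodule.on (seminormed P).

Definition seminorm_open P : set_system V := [set U | forall x, U x ->
  exists2 F : set (V -> \bar R), finite_set F /\ F `<=` P &
  exists2 e : R, 0 < e &
    [set y | forall f, F f -> (f (y - x)%R < e%:E)%E] `<=` U].

Let seminorm_openT P : seminorm_open P setT.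
Proof.
move=> x _; exists set0; first by split; [exact: finite_set0|].
by exists 1.
Qed.

Let seminorm_openI P : setI_closed (seminorm_open P).
Proof.
move=> A B oA oB x [Ax Bx].
have [F [finF FP] [e e0 FA]] := oA _ Ax.
have [G [finG GP] [d d0 GB]] := oB _ Bx.
exists (F `|` G); first by rewrite finite_setU; split => // f [/FP|/GP].
exists (Num.min e d); first by rewrite lt_min e0.
move=> y FGy; split.
- apply: FA => f Ff; apply: (lt_le_trans (FGy f (or_introl Ff))).
  by rewrite lee_fin ge_min lexx.
- apply: GB => f Gf; apply: (lt_le_trans (FGy f (or_intror Gf))).
  by rewrite lee_fin ge_min lexx orbT.
Qed.

Let seminorm_open_bigU P (I : Type) (f : I -> set V) :
  (forall i, seminorm_open P (f i)) -> seminorm_open P (\bigcup_i f i).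
Proof.
move=> of_ x [i _ fx]; have [F FP [e e0 Fe]] := of_ i _ fx.
by exists F => //; exists e => // y /Fe fy; exists i.
Qed.

HB.instance Definition _ P := isOpenTopological.Build (seminormed P)
  (@seminorm_openT P) (@seminorm_openI P) (@seminorm_open_bigU P).

End SeminormTopology.

(* S is absorbed by every neighborhood of the origin. *)
Definition tvs_bounded (R : realType) (E : preTopologicalLmodType R[i])
    (S : set E) : Prop :=
  forall U : set E, nbhs 0 U ->
  exists2 r : R, 0 < r & forall a : R[i], r%:C <= `|a| ->
    S `<=` [set a *: x | x in U].

(* The topology induced on the subset S, as a family of subsets of S. *)
Definition trace_topology (E : topologicalType) (S : set E) : set_system E :=
  [set U `&` S | U in open].

Section BoundedOperators.
Context (R : realType) (H : hilbertType R).

Definition bounded_operator : {pred H -> H} := [pred f : H -> H |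
  `[< linear f /\ exists M : R[i], forall x, `|f x| <= M * `|x| >]].

Record bop := Bop { bop_fun :> H -> H; bop_funP : bop_fun \in bounded_operator }.

HB.instance Definition _ := [isSub for bop_fun].
HB.instance Definition _ := [Choice of bop by <:].

Lemma bounded_operatorP (f : H -> H) : reflect
  (linear f /\ exists M : R[i], forall x, `|f x| <= M * `|x|)
  (f \in bounded_operator).
Proof. exact: asboolP. Qed.

Let bounded_operator_submod : submod_closed bounded_operator.
Proof.
split.
  apply/bounded_operatorP; split; first by move=> a x y; rewrite scaler0 addr0.
  by exists 0 => x; rewrite normr0 mul0r.
move=> a f g /bounded_operatorP[lf [M fM]] /bounded_operatorP[lg [N gN]].
have fgE z : (a *: f + g) z = a *: f z + g z by [].
apply/bounded_operatorP; split.
  move=> b x y; rewrite !fgE lf lg !scalerDr !scalerA [a * b]mulrC.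
  by rewrite addrACA.
exists (`|a| * M + N) => x; rewrite fgE; apply: (le_trans (ler_normD _ _)).
by rewrite mulrDl lerD // normrZ -mulrA ler_wpM2l.
Qed.

HB.instance Definition _ := GRing.isSubmodClosed.Build _ _ bounded_operator
  bounded_operator_submod.
HB.instance Definition _ := [SubChoice_isSubLmodule of bop by <:].

Let bop_comp_subproof (f g : bop) : (f : H -> H) \o g \in bounded_operator.
Proof.
case: f g => f /= /bounded_operatorP[lf [M fM]] [g /= /bounded_operatorP[lg [N gN]]].
apply/bounded_operatorP; split; first by move=> a x y /=; rewrite lg lf.
exists (`|M| * N) => x /=; have [x0|nx0] := eqVneq x 0.
  have f0 : f 0 = 0 by have := lf (-1) 0 0; rewrite scaler0 add0r scaleN1r addNr.
  have g0 : g 0 = 0 by have := lg (-1) 0 0; rewrite scaler0 add0r scaleN1r addNr.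
  by rewrite x0 g0 f0 normr0 mulr0.
have M0 : M * `|g x| <= `|M| * `|g x|.
  have : 0 <= M * `|g x| by apply: le_trans (fM _).
  by move=> /ger0_norm <-; rewrite normrM normr_id.
apply: (le_trans (fM _)); apply: (le_trans M0).
by rewrite -mulrA ler_wpM2l.
Qed.

Definition bop_comp (f g : bop) : bop := Bop (bop_comp_subproof f g).

End BoundedOperators.

Section Operators.
Context (R : realType) (H : hilbertType R).
Implicit Types (T A : bop H) (p : \bar R).

Definition opnorm T : \bar R :=
  ereal_sup [set (rnorm (T x))%:E | x in [set x : H | `|x| <= 1]].

Definition norm_bounded (S : set (bop H)) : Prop :=
  exists M : R, forall T, S T -> (opnorm T <= M%:E)%E.

Definition compact_operator T : Prop :=
  compact (closure [set T x | x in [set x : H | `|x| <= 1]]).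

Definition adjoint T : bop H :=
  xget 0 [set A : bop H | forall x y, hdot (T x) y = hdot x (A y)].

(* In the order of R[i], 0 <= z means that z is real and nonnegative. *)
Definition positive_operator A : Prop := forall x, 0 <= hdot (A x) x.

(* |T| = (T^* T)^(1/2), the positive square root of T^* T *)
Definition absop T : bop H :=
  xget 0 [set A : bop H | positive_operator A /\ bop_comp A A = bop_comp (adjoint T) T].

Definition op_eigenspace A (l : R) : set H := [set v | A v = l%:C *: v].

(* mu lists the eigenvalues of |T| in nonincreasing order, each positive one
   occurring as often as its multiplicity.  If infinitely many are positive, then
   0 does not occur (nothing can follow it but 0); if not, mu ends in zeros. *)
Definition is_singular_values T (mu : nat -> R) : Prop :=
  [/\ forall n, 0 <= mu n,
      forall m n, (m <= n)%N -> mu n <= mu m &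
      forall l : R, 0 < l -> exists k,
        has_dim (op_eigenspace (absop T) l) k /\ ([set n | mu n = l] #= `I_k)%card].

(* meaningful for compact T *)
Definition singular_values T : nat -> R :=
  xget (fun=> 0) [set mu | is_singular_values T mu].

(* meaningful for compact T and 1 <= p *)
Definition schatten_norm p T : \bar R :=
  if p is r%:E then
    poweR (\sum_(0 <= n <oo) ((singular_values T n) `^ r)%:E)%E r^-1
  else opnorm T.

Definition schatten_ideal p : set (bop H) :=
  [set T : bop H | compact_operator T /\ (schatten_norm p T < +oo)%E].

Definition left_seminorms p : set (bop H -> \bar R) :=
  [set (fun x => schatten_norm p (bop_comp x y)) | y in schatten_ideal p].

Definition right_seminorms p : set (bop H -> \bar R) :=
  [set (fun x => schatten_norm p (bop_comp y x)) | y in schatten_ideal p].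

(* B(H) with the topology mu_(p|0) of left multipliers on L^p, and with the
   topology mu^*_(p|0) of bilateral multipliers *)
Definition mu_top p := seminormed (left_seminorms p).
Definition mu_star_top p := seminormed (left_seminorms p `|` right_seminorms p).

Definition orthonormal_set (E : set H) : Prop :=
  forall e f, E e -> E f -> hdot e f = (e == f)%:R.

Definition orthonormal_basis (E : set H) : Prop :=
  orthonormal_set E /\ forall F, orthonormal_set F -> E `<=` F -> F = E.

(* The trace, computed in one fixed orthonormal basis (of any cardinality), as
   the limit of the net of finite partial sums. *)
Definition op_trace T : R[i] :=
  let E : set H := xget set0 orthonormal_basis in
  summability.sum (R := R[i]^o) (fun e : H => if e \in E then hdot (T e) e else 0).

Definition weak_star_seminorms : set (bop H -> \bar R) :=
  [set (fun x => (complex.Re `|op_trace (bop_comp t x)|)%:E)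
     | t in schatten_ideal 1%:E].

Definition weak_star_top := seminormed weak_star_seminorms.

End Operators.

Arguments mu_top {R} H p.
Arguments mu_star_top {R} H p.
Arguments weak_star_top {R} H.

(* Main.v *)
(* Everything is read off approximation numbers: for compact T, s_n(T) <= c iff
   |T v| <= c |v| for all v orthogonal to some n vectors (singular value
   decomposition and min-max).  This gives s_(m+n)(S T) <= s_m(S) s_n(T), so no
   sharp Hoelder or triangle inequality for Schatten norms is needed.
   (1) If p < q, factor y in L^p as y = z w with z in L^q and w diagonal; then
   |x y|_p is controlled by |x z|_q.  Conversely, if mu_q were contained in
   mu^*_p, testing on rank-one operators u (x) v^*, with u nearly annihilated by
   the right multipliers, would dominate the singular numbers of every operator
   of L^q by those of finitely many operators of L^p.
   (2) On bounded sets mu_p is the strong and mu^*_p the strong-* topology.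
   (3) Boundedness follows from (2)'s seminorms by uniform boundedness.  A
   mu^*_oo-continuous functional is determined by its values on rank-one
   operators, and these define, by Riesz, a trace-class operator. *)
Require Import Defs.
From HB Require Import structures.
From mathcomp Require Import all_boot all_order all_algebra.
From mathcomp Require Import complex.
From mathcomp Require Import all_classical all_reals all_analysis.
From mathcomp Require Import ring lra zify.

Set Implicit Arguments.
Unset Strict Implicit.
Unset Printing Implicit Defensive.

Import Order.TTheory GRing.Theory Num.Theory.
Import numFieldNormedType.Exports.

Local Open Scope classical_set_scope.
Local Open Scope ring_scope.

(** * Moduli and norms as real numbers *)

(** Several notions are [xget] choices ([adjoint], [absop], [singular_values], the basis in
    [op_trace]), whose specification is available only once existence is proved; so a singular value
    decomposition is built by successive maximization before [singular_values] can be identified. As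
    [H] may be nonseparable, an orthonormal sequence need not be a basis: completeness is replaced
    by tail bounds off the first n vectors, and the trace is an unordered sum. As no triangle
    inequality for Schatten norms is at hand, their balls are not known to be open: topologies are
    compared by dominating seminorms at the origin, and sets that must be open come from the
    operator norm or the strong topologies. The exponent q = oo has its own factorization: the
    weights s_n^(p/q), which split y for finite q, become constant there, and z would not be
    compact. The test operator for strictness has entries (n+1)^(-1/p): it lies in L^q for every q >
    p, while its p-th powers form the harmonic series. *)

Section Modulus.
Context (R : realType).
Implicit Types (z w : R[i]) (a : R).

(** Norms take values in [R[i]], whose order is partial. [cabs] and [rnorm] bring them back to [R],
    where [lra] and [nra] apply. *)
Definition cabs z : R := complex.Re `|z|.

Lemma cabsE z : `|z| = (cabs z)%:C%C.
Proof. by rewrite /cabs; case: z => x y. Qed.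

Lemma cabs_ge0 z : 0 <= cabs z.
Proof. by rewrite -lecR -cabsE normr_ge0. Qed.

Lemma cabs_eq0 z : (cabs z == 0) = (z == 0).
Proof.
rewrite -(normr_eq0 z) cabsE; apply/eqP/eqP => [->//|/(congr1 (@complex.Re R))//].
Qed.

Lemma cabs0 : cabs 0 = 0. Proof. by apply/eqP; rewrite cabs_eq0. Qed.

Lemma cabs_gt0 z : (0 < cabs z) = (z != 0).
Proof. by rewrite lt_def cabs_ge0 cabs_eq0 andbT. Qed.

Lemma cabsM z w : cabs (z * w) = cabs z * cabs w.
Proof. by apply: (@complexI R); rewrite rmorphM /= -!cabsE normrM. Qed.

Lemma cabsD z w : cabs (z + w) <= cabs z + cabs w.
Proof. by rewrite -lecR rmorphD /= -!cabsE ler_normD. Qed.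

Lemma cabsN z : cabs (- z) = cabs z.
Proof. by rewrite /cabs normrN. Qed.

Lemma cabsC z w : cabs (z - w) = cabs (w - z).
Proof. by rewrite -cabsN opprB. Qed.

Lemma cabsJ z : cabs (Num.conj z) = cabs z.
Proof. by rewrite /cabs norm_conjC. Qed.

Lemma cabsR a : cabs a%:C%C = `|a|.
Proof. by rewrite /cabs normc_def /= expr0n addr0 sqrtr_sqr. Qed.

Lemma cabs1 : cabs 1 = 1.
Proof. by rewrite (_ : 1 = 1%:C%C) // cabsR normr1. Qed.

Lemma cabsV z : cabs z^-1 = (cabs z)^-1.
Proof.
have [->|z0] := eqVneq z 0; first by rewrite invr0 cabs0 invr0.
by apply: (mulfI (x := cabs z)); rewrite ?cabs_eq0// -cabsM !mulfV ?cabs1 ?cabs_eq0.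
Qed.

Lemma cabs_sum (I : Type) (r : seq I) (P : pred I) (F : I -> R[i]) :
  cabs (\sum_(i <- r | P i) F i) <= \sum_(i <- r | P i) cabs (F i).
Proof.
elim/big_rec2: _ => [|i y x _ h]; first by rewrite cabs0.
by rewrite (le_trans (cabsD _ _))// lerD2l.
Qed.

Lemma mulJ_cabs z : z * Num.conj z = (cabs z ^+ 2)%:C%C.
Proof. by rewrite -normCK cabsE rmorphXn. Qed.

Lemma cabs_small z : (forall e : R, 0 < e -> cabs z <= e) -> z = 0.
Proof.
move=> h; apply/eqP; rewrite -cabs_eq0 eq_le cabs_ge0 andbT.
by apply/ler_addgt0Pl => e /h; rewrite addr0.
Qed.

(** Rotating a value onto the nonnegative axis reduces estimates of moduli to estimates of real
    numbers. *)
Lemma phaseP z : exists w, cabs w = 1 /\ w * z = (cabs z)%:C%C.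
Proof.
have [->|z0] := eqVneq z 0; first by exists 1; rewrite cabs1 mulr0 cabs0.
exists (Num.conj z / (cabs z)%:C%C); split.
  rewrite cabsM cabsV cabsJ cabsR ger0_norm ?cabs_ge0// mulfV//.
  by rewrite cabs_eq0.
rewrite mulrAC mulrC [_ * z]mulrC mulJ_cabs expr2 rmorphM /= mulrA mulVf ?mul1r//.
by rewrite -cabsE normr_eq0.
Qed.

End Modulus.

Section RealNorm.
Context (R : realType) (V : normedModType R[i]).
Implicit Types (x y z : V) (a : R[i]).

Lemma rnormE x : `|x| = (rnorm x)%:C%C.
Proof.
have : `|x| \is Num.real by exact: normr_real.
by move=> /complex_realP[k k_]; rewrite /rnorm k_.
Qed.

Lemma rnorm_ge0 x : 0 <= rnorm x.
Proof. by rewrite -lecR -rnormE normr_ge0. Qed.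
Hint Resolve rnorm_ge0 : core.

Lemma rnorm_eq0 x : (rnorm x == 0) = (x == 0).
Proof.
rewrite -(normr_eq0 x) rnormE; apply/eqP/eqP => [->//|/(congr1 (@complex.Re R))//].
Qed.

Lemma rnorm0 : rnorm (0 : V) = 0. Proof. by apply/eqP; rewrite rnorm_eq0. Qed.

Lemma rnorm_gt0 x : (0 < rnorm x) = (x != 0).
Proof. by rewrite lt_def rnorm_ge0 rnorm_eq0 andbT. Qed.

Lemma rnormZ a x : rnorm (a *: x) = cabs a * rnorm x.
Proof. by apply: (@complexI R); rewrite rmorphM /= -!rnormE -cabsE normrZ. Qed.

Lemma rnormD x y : rnorm (x + y) <= rnorm x + rnorm y.
Proof. by rewrite -lecR rmorphD /= -!rnormE ler_normD. Qed.

Lemma rnormN x : rnorm (- x) = rnorm x.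
Proof. by rewrite /rnorm normrN. Qed.

Lemma rnormB x y : rnorm (x - y) <= rnorm x + rnorm y.
Proof. by rewrite (le_trans (rnormD _ _))// rnormN. Qed.

Lemma rnormC x y : rnorm (x - y) = rnorm (y - x).
Proof. by rewrite -rnormN opprB. Qed.

Lemma rnorm_tri y x z : rnorm (x - z) <= rnorm (x - y) + rnorm (y - z).
Proof. by rewrite (le_trans _ (rnormD _ _))// addrA subrK. Qed.

Lemma rnormBl x y : rnorm x - rnorm y <= rnorm (x - y).
Proof. by rewrite lerBlDr (le_trans _ (rnormD _ _))// subrK. Qed.

Lemma rnorm_sum (I : Type) (r : seq I) (P : pred I) (F : I -> V) :
  rnorm (\sum_(i <- r | P i) F i) <= \sum_(i <- r | P i) rnorm (F i).
Proof.
elim/big_rec2: _ => [|i y x _ h]; first by rewrite rnorm0.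
by rewrite (le_trans (rnormD _ _))// lerD2l.
Qed.

Lemma rnorm_small x : (forall e : R, 0 < e -> rnorm x <= e) -> x = 0.
Proof.
move=> h; apply/eqP; rewrite -rnorm_eq0 eq_le rnorm_ge0 andbT.
by apply/ler_addgt0Pl => e /h; rewrite addr0.
Qed.

Lemma rnorm_unit x : x != 0 -> rnorm ((rnorm x)^-1%:C%C *: x) = 1.
Proof.
by rewrite -rnorm_gt0 => x0; rewrite rnormZ cabsR ger0_norm ?invr_ge0// mulVf// gt_eqF.
Qed.

Lemma rnorm_ball (x y : V) (e : R[i]) : 0 < e -> ball x e y = (rnorm (x - y) < complex.Re e).
Proof.
move=> e0; rewrite -ball_normE /ball_ /= rnormE.
have -> : e = (complex.Re e)%:C%C by rewrite RRe_real// gtr0_real.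
by rewrite ltcR.
Qed.

Lemma rnorm_nbhs (x : V) (A : set V) :
  nbhs x A <-> exists2 e : R, 0 < e & forall y, rnorm (x - y) < e -> A y.
Proof.
split=> [/nbhs_ballP[e /= e0 eA]|[e e0 eA]].
  exists (complex.Re e); first by move: e0; rewrite ltcE /= => /andP[].
  by move=> y xy; apply: eA; rewrite rnorm_ball.
apply/nbhs_ballP; have e0' : 0 < e%:C%C by rewrite (ltcR 0).
by exists e%:C%C => //= y; rewrite rnorm_ball//=; exact: eA.
Qed.

End RealNorm.
#[global] Hint Extern 0 (is_true (0 <= rnorm _)) => solve [apply: rnorm_ge0] : core.
#[global] Hint Extern 0 (is_true (0 <= cabs _)) => solve [apply: cabs_ge0] : core.

Section Completeness.
Context (R : realType) (V : completeNormedModType R[i]).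

Lemma rnorm_cauchy (u : nat -> V) :
  (forall e : R, 0 < e -> exists N, forall n m, (N <= n)%N -> (N <= m)%N ->
     rnorm (u n - u m) < e) ->
  exists l, forall e : R, 0 < e -> exists N, forall n, (N <= n)%N -> rnorm (l - u n) < e.
Proof.
move=> cu; have : cvg (u @ \oo).
  apply: cauchy_cvg; apply: cauchy_exP => e e0.
  have e0' : 0 < complex.Re e by move: e0; rewrite ltcE /= => /andP[].
  have [N uN] := cu _ e0'; exists (u N), N => // n /= Nn.
  by rewrite rnorm_ball//; exact: uN.
move=> /cvg_ex[l ul]; exists l => e e0.
have /ul[N _ uN] : nbhs l [set y | rnorm (l - y) < e] by apply/rnorm_nbhs; exists e.
by exists N => n Nn; exact: uN.
Qed.

End Completeness.

(** * Geometry of Hilbert spaces *)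

Section InnerProduct.
Context (R : realType) (H : hilbertType R).
Implicit Types (x y z : H) (a : R[i]).

Lemma hdotDl x y z : hdot (x + y) z = hdot x z + hdot y z.
Proof. by have := hdot_linearl 1 x y z; rewrite scale1r mul1r. Qed.

Lemma hdot0l z : hdot 0 z = 0.
Proof.
have := hdotDl 0 0 z; rewrite addr0 => /eqP.
by rewrite -subr_eq0 opprD addNKr oppr_eq0 => /eqP.
Qed.

Lemma hdotZl a x z : hdot (a *: x) z = a * hdot x z.
Proof. by have := hdot_linearl a x 0 z; rewrite addr0 hdot0l addr0. Qed.

Lemma hdotNl x z : hdot (- x) z = - hdot x z.
Proof. by rewrite -scaleN1r hdotZl mulN1r. Qed.

Lemma hdotBl x y z : hdot (x - y) z = hdot x z - hdot y z.
Proof. by rewrite hdotDl hdotNl. Qed.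

Lemma hdot_suml (I : Type) (r : seq I) (P : pred I) (F : I -> H) z :
  hdot (\sum_(i <- r | P i) F i) z = \sum_(i <- r | P i) hdot (F i) z.
Proof. by apply: (big_morph (fun x => hdot x z)) => [x y|]; rewrite ?hdotDl ?hdot0l. Qed.

Lemma hdotDr x y z : hdot z (x + y) = hdot z x + hdot z y.
Proof. by rewrite hdot_conj hdotDl rmorphD /= -!(hdot_conj z). Qed.

Lemma hdot0r z : hdot z 0 = 0.
Proof. by rewrite hdot_conj hdot0l conjC0. Qed.

Lemma hdotZr a x z : hdot z (a *: x) = Num.conj a * hdot z x.
Proof. by rewrite hdot_conj hdotZl rmorphM /= -(hdot_conj z). Qed.

Lemma hdotNr x z : hdot z (- x) = - hdot z x.
Proof. by rewrite hdot_conj hdotNl rmorphN /= -(hdot_conj z). Qed.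

Lemma hdotBr x y z : hdot z (x - y) = hdot z x - hdot z y.
Proof. by rewrite hdotDr hdotNr. Qed.

Lemma hdot_sumr (I : Type) (r : seq I) (P : pred I) (F : I -> H) z :
  hdot z (\sum_(i <- r | P i) F i) = \sum_(i <- r | P i) hdot z (F i).
Proof. by apply: (big_morph (fun x => hdot z x)) => [x y|]; rewrite ?hdotDr ?hdot0r. Qed.

Lemma hdotxx x : hdot x x = (rnorm x ^+ 2)%:C%C.
Proof. by rewrite hdot_norm rnormE rmorphXn. Qed.

Lemma Re_hdotC x y : complex.Re (hdot x y) = complex.Re (hdot y x).
Proof. by rewrite hdot_conj; case: (hdot y x). Qed.

Lemma Re_hdotxx x : complex.Re (hdot x x) = rnorm x ^+ 2.
Proof. by rewrite hdotxx. Qed.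

Lemma hdot_eq0 x y : hdot x y = 0 -> hdot y x = 0.
Proof. by move=> xy; rewrite hdot_conj xy conjC0. Qed.

Lemma rnorm2D x y :
  rnorm (x + y) ^+ 2 = rnorm x ^+ 2 + rnorm y ^+ 2 + 2 * complex.Re (hdot x y).
Proof.
rewrite -!Re_hdotxx hdotDl !hdotDr !raddfD /= (Re_hdotC y x); ring.
Qed.

Lemma rnorm2B x y :
  rnorm (x - y) ^+ 2 = rnorm x ^+ 2 + rnorm y ^+ 2 - 2 * complex.Re (hdot x y).
Proof. by rewrite rnorm2D rnormN hdotNr raddfN /= mulrN. Qed.

Lemma pythagoras x y : hdot x y = 0 -> rnorm (x + y) ^+ 2 = rnorm x ^+ 2 + rnorm y ^+ 2.
Proof. by move=> xy; rewrite rnorm2D xy mulr0 addr0. Qed.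

Lemma cauchy_schwarz x y : cabs (hdot x y) <= rnorm x * rnorm y.
Proof.
have [->|y0] := eqVneq y 0; first by rewrite hdot0r cabs0 rnorm0 mulr0.
have ny : 0 < rnorm y by rewrite rnorm_gt0.
have [w [w1 wE]] := phaseP (hdot x y).
set c := cabs (hdot x y) in wE *.
have c0 : 0 <= c := cabs_ge0 _.
(* After rotation by w the pairing is the real number c, and this t minimizes |w x - t y|. *)
pose t := c / rnorm y ^+ 2.
have : 0 <= rnorm (w *: x - t%:C%C *: y) ^+ 2 by exact: sqr_ge0.
rewrite rnorm2B !rnormZ w1 mul1r cabsR exprMn real_normK ?num_real//.
rewrite hdotZl hdotZr (_ : Num.conj t%:C%C = t%:C%C); last by rewrite conj_Creal ?complex_real.
rewrite [w * _]mulrCA wE -rmorphM /= => h.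
rewrite -(@ler_pXn2r _ 2)// ?nnegrE ?mulr_ge0// ?exprMn.
have {h}: 0 <= rnorm x ^+ 2 * rnorm y ^+ 2 + (t * rnorm y ^+ 2) ^+ 2 - 2 * ((t * rnorm y ^+ 2) * c).
  apply: le_trans (mulr_ge0 h (sqr_ge0 (rnorm y))) _.
  by rewrite le_eqVlt; apply/orP; left; apply/eqP; ring.
rewrite /t divfK ?gt_eqF ?exprn_gt0// -expr2; lra.
Qed.

Lemma hdotP x : (forall y, hdot x y = 0) -> x = 0.
Proof.
by move=> /(_ x) /(congr1 (@complex.Re R)); rewrite Re_hdotxx /= => /eqP;
   rewrite expf_eq0 /= rnorm_eq0 => /eqP.
Qed.

(** Adjoints and Riesz vectors are bounded in this way: |x|^2 is estimated by a multiple of |x|, and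
    one factor cancels. *)
Lemma rnorm_le_hdot x (c : R) : 0 <= c -> cabs (hdot x x) <= c * rnorm x -> rnorm x <= c.
Proof.
move=> c0; rewrite hdotxx cabsR ger0_norm ?sqr_ge0// expr2.
by have [->|x0] := eqVneq x 0; rewrite ?rnorm0// ler_pM2r// rnorm_gt0.
Qed.

Lemma parallelogram x y :
  rnorm (x + y) ^+ 2 + rnorm (x - y) ^+ 2 = 2 * rnorm x ^+ 2 + 2 * rnorm y ^+ 2.
Proof. rewrite rnorm2D rnorm2B; ring. Qed.

End InnerProduct.

Section Orthonormal.
Context (R : realType) (H : hilbertType R).
Implicit Types (x y z v w : H) (g h : seq H).

Definition perp g x := forall w, w \in g -> hdot x w = 0.

Lemma perp_cat g h x : perp (g ++ h) x <-> perp g x /\ perp h x.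
Proof.
split=> [gh|[gx hx] w]; last by rewrite mem_cat => /orP[/gx|/hx].
by split=> w wg; apply: gh; rewrite mem_cat wg ?orbT.
Qed.

Lemma perp_cons w h x : perp (w :: h) x <-> hdot x w = 0 /\ perp h x.
Proof.
split=> [wh|[wx hx] u]; last by rewrite inE => /predU1P[->|/hx].
by split=> [|u uh]; apply: wh; rewrite inE ?eqxx// uh orbT.
Qed.

Context (I : eqType) (e : I -> H).
Implicit Types (r : seq I) (i j : I).

(** Indexing by an [eqType] lets the same lemmas serve lists of vectors, with [e := id], and finite
    pieces of sequences, with [I := nat]. *)
Definition orthonormal r := uniq r /\ {in r &, forall i j, hdot (e i) (e j) = (i == j)%:R}.

Lemma orthonormal_norm r i : orthonormal r -> i \in r -> rnorm (e i) = 1.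
Proof.
move=> [_ oe] ir; have := oe _ _ ir ir; rewrite eqxx hdotxx => /(congr1 (@complex.Re R)) /=.
by move=> /eqP; rewrite sqrf_eq1 => /orP[/eqP//|/eqP h]; have := rnorm_ge0 (e i); rewrite h; lra.
Qed.

Lemma hdot_sum_orthonormal r (c : I -> R[i]) j : orthonormal r -> j \in r ->
  hdot (\sum_(i <- r) c i *: e i) (e j) = c j.
Proof.
move=> [ur oe] jr; rewrite hdot_suml (bigD1_seq j)//= hdotZl oe// eqxx mulr1.
rewrite big_seq_cond big1 ?addr0// => i /andP[ir ij].
by rewrite hdotZl oe// (negbTE ij) mulr0.
Qed.

Lemma rnorm2_sum_orthogonal r (c : I -> R[i]) :
  uniq r -> {in r &, forall i j, i != j -> hdot (e i) (e j) = 0} ->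
  rnorm (\sum_(i <- r) c i *: e i) ^+ 2 = \sum_(i <- r) cabs (c i) ^+ 2 * rnorm (e i) ^+ 2.
Proof.
move=> ur og; apply: (@complexI R); rewrite -hdotxx rmorph_sum /= hdot_sumr.
apply: eq_big_seq => j jr; rewrite hdotZr hdot_suml (bigD1_seq j)//= hdotZl hdotxx.
rewrite big_seq_cond big1 ?addr0 => [|i /andP[ir ij]]; last by rewrite hdotZl og// mulr0.
by rewrite mulrA [_^* * _]mulrC mulJ_cabs -rmorphM.
Qed.

Lemma rnorm2_sum_orthonormal r (c : I -> R[i]) : orthonormal r ->
  rnorm (\sum_(i <- r) c i *: e i) ^+ 2 = \sum_(i <- r) cabs (c i) ^+ 2.
Proof.
move=> oe; rewrite rnorm2_sum_orthogonal ?oe.1// => [|i j ir jr /negbTE ij].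
  by apply: eq_big_seq => i ir; rewrite (orthonormal_norm oe ir) expr1n mulr1.
by rewrite oe.2// ij.
Qed.

Definition proj r x := \sum_(i <- r) hdot x (e i) *: e i.

Lemma hdot_proj r x j : orthonormal r -> j \in r -> hdot (proj r x) (e j) = hdot x (e j).
Proof. exact: hdot_sum_orthonormal. Qed.

Lemma proj_perp r x j : orthonormal r -> j \in r -> hdot (x - proj r x) (e j) = 0.
Proof. by move=> oe jr; rewrite hdotBl hdot_proj// subrr. Qed.

Lemma proj_perp_proj r x y : orthonormal r -> hdot (x - proj r x) (proj r y) = 0.
Proof.
move=> oe; rewrite hdot_sumr big_seq big1// => i ir.
by rewrite hdotZr proj_perp// mulr0.
Qed.

Lemma proj_pythagoras r x : orthonormal r ->
  rnorm x ^+ 2 = rnorm (x - proj r x) ^+ 2 + \sum_(i <- r) cabs (hdot x (e i)) ^+ 2.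
Proof.
move=> oe; rewrite -rnorm2_sum_orthonormal// -pythagoras ?subrK//.
exact: proj_perp_proj.
Qed.

Lemma bessel r x : orthonormal r ->
  \sum_(i <- r) cabs (hdot x (e i)) ^+ 2 <= rnorm x ^+ 2.
Proof. by move=> oe; rewrite (proj_pythagoras x oe) lerDr sqr_ge0. Qed.

Lemma rnorm_proj_compl r x : orthonormal r -> rnorm (x - proj r x) <= rnorm x.
Proof.
move=> oe; rewrite -(@ler_pXn2r _ 2)// ?nnegrE// (proj_pythagoras x oe).
by rewrite lerDl sumr_ge0// => i _; exact: sqr_ge0.
Qed.

Lemma rnorm_proj r x : orthonormal r -> rnorm (proj r x) <= rnorm x.
Proof.
move=> oe; rewrite -(@ler_pXn2r _ 2)// ?nnegrE// rnorm2_sum_orthonormal//.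
exact: bessel.
Qed.

Lemma hdot_projC r x y : hdot (proj r x) y = hdot x (proj r y).
Proof.
rewrite hdot_suml hdot_sumr; apply: eq_bigr => i _.
by rewrite hdotZl hdotZr mulrC -hdot_conj.
Qed.

Lemma proj_linear r : linear (proj r).
Proof.
move=> a x y; rewrite scaler_sumr -big_split /=; apply: eq_bigr => i _.
by rewrite hdot_linearl scalerDl scalerA.
Qed.

Lemma orthonormal_has_dim r (E : set H) : orthonormal r ->
  (forall v, E v <-> v = proj r v) -> has_dim E (size r).
Proof.
move=> oe Er; pose b (i : 'I_(size r)) := e (tnth (in_tuple r) i).
have bE (c : 'I_(size r) -> R[i]) (j : 'I_(size r)) : hdot (\sum_i c i *: b i) (b j) = c j.
  rewrite hdot_suml (bigD1 j)//= hdotZl oe.2 ?mem_tnth// eqxx mulr1 big1 ?addr0// => i ij.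
  have /tuple_uniqP inj : uniq (in_tuple r) by exact: oe.1.
  by rewrite hdotZl oe.2 ?mem_tnth// (inj_eq inj) (negbTE ij) mulr0.
exists b; split=> [c c0 i|]; first by rewrite -(bE c) c0 hdot0l.
apply/seteqP; split=> v.
  move=> /Er vE; exists (fun i : 'I_(size r) => hdot v (b i)).
  by rewrite {1}vE /proj big_tnth.
move=> [c vE]; apply/Er; rewrite /proj big_tnth vE.
by apply: eq_bigr => i _; rewrite bE.
Qed.

(* A homogeneous system with more unknowns than equations has a nonzero solution. *)
Lemma span_meets_perp r g : orthonormal r -> (size g < size r)%N ->
  exists c : I -> R[i], rnorm (\sum_(i <- r) c i *: e i) = 1 /\
     perp g (\sum_(i <- r) c i *: e i).
Proof.
move=> oe gr.
have [i0 i0r] : {i | i \in r} by case: r gr {oe} => // i r _; exists i; rewrite inE eqxx.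
pose M := \matrix_(k < size r, j < size g) hdot (e (nth i0 r k)) (nth 0 g j).
have : kermx M != 0.
  rewrite kermx_eq0 /row_free neq_ltn (leq_ltn_trans (rank_leq_col M))//.
move=> /rowV0Pn[u /sub_kermxP uM u0].
pose c i : R[i] := if insub (index i r) is Some k then u 0 k else 0.
have cE (k : 'I_(size r)) : c (nth i0 r k) = u 0 k.
  by rewrite /c index_uniq//; [rewrite valK|exact: (oe.1)].
pose x := \sum_(i <- r) c i *: e i.
have x0 : x != 0.
  apply: contraNneq u0 => x0; apply/eqP/rowP => k; rewrite mxE -cE.
  by rewrite -(hdot_sum_orthonormal c oe) ?mem_nth// -/x x0 hdot0l.
exists (fun i => (rnorm x)^-1%:C%C * c i).
have -> : \sum_(i <- r) ((rnorm x)^-1%:C%C * c i) *: e i = (rnorm x)^-1%:C%C *: x.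
  by rewrite scaler_sumr; apply: eq_bigr => i _; rewrite scalerA.
split; first exact: rnorm_unit.
move=> w wg; rewrite hdotZl; apply/eqP; rewrite mulf_eq0; apply/orP; right.
have jg : (index w g < size g)%N by rewrite index_mem.
have /matrixP/(_ 0 (Ordinal jg)) := uM; rewrite !mxE => <-; apply/eqP.
rewrite hdot_suml (big_nth i0) big_mkord; apply: eq_bigr => k _.
by rewrite !mxE cE hdotZl /= nth_index.
Qed.

End Orthonormal.

Section GramSchmidt.
Context (R : realType) (H : hilbertType R).
Implicit Types (x y z v w : H) (g h : seq H).

(** Of the usual equality of spans only an inclusion of orthogonal complements is kept: bounds
    assumed on [perp g] then hold on [perp h], where the projection formulas apply. *)
Lemma gram_schmidt g : exists2 h, orthonormal id h & forall v, perp h v -> perp g v.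
Proof.
elim: g => [|x g [h oh hg]]; first by exists [::].
pose x' := x - proj id h x.
have x'h : perp h x' by move=> w wh; exact: proj_perp.
have xE v : perp h v -> hdot v x' = 0 -> hdot v x = 0.
  move=> hv vx'; rewrite -[x](subrK (proj id h x)) hdotDr vx' add0r.
  rewrite hdot_sumr big_seq big1// => w wh; by rewrite hdotZr hv ?mulr0.
have [x'0|x'0] := eqVneq x' 0.
  exists h => // v hv; apply/perp_cons; split; last exact: hg.
  by apply: xE => //; rewrite x'0 hdot0r.
pose u := (rnorm x')^-1%:C%C *: x'.
have hdotu w : w \in h -> hdot u w = 0 by move=> wh; rewrite hdotZl x'h// mulr0.
exists (u :: h); last first.
  move=> v /perp_cons[vu hv]; apply/perp_cons; split; last exact: hg.
  apply: xE => //; apply/eqP; move: vu => /eqP; rewrite hdotZr mulf_eq0 => /orP[|//].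
  rewrite conjC_eq0 => /eqP/(congr1 (@complex.Re R))/eqP /=.
  by rewrite invr_eq0 rnorm_eq0 (negbTE x'0).
have uu : hdot u u = 1 by rewrite hdotxx rnorm_unit// expr1n.
have uh : u \notin h.
  by apply/negP => /hdotu; rewrite uu => /eqP; rewrite oner_eq0.
split=> /=; first by rewrite uh oh.1.
move=> v w; rewrite !inE => /predU1P[->|vh] /predU1P[->|wh].
- by rewrite eqxx.
- by rewrite hdotu//; case: eqP => // uw; move: uh; rewrite uw wh.
- by rewrite hdot_eq0 ?hdotu//; case: eqP => // uw; move: uh; rewrite -uw vh.
- exact: oh.2.
Qed.

(** Otherwise the orthonormalized list would span [H], which would then have finite dimension. *)
Lemma infdim_perp g : infinite_dimensional H -> exists v, rnorm v = 1 /\ perp g v.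
Proof.
move=> infH; apply: contrapT => nv; have [h oh hg] := gram_schmidt g.
have h0 v : perp h v -> v = 0.
  move=> hv; apply/eqP; apply/negPn/negP => v0; apply: nv.
  exists ((rnorm v)^-1%:C%C *: v); split; first exact: rnorm_unit.
  by move=> w wg; rewrite hdotZl hg// mulr0.
apply: (infH (size h)); apply: (orthonormal_has_dim oh) => v; split=> // _.
by apply/eqP; rewrite -subr_eq0; apply/eqP/h0 => w; exact: proj_perp.
Qed.

End GramSchmidt.

(** * Riesz representation and bounded operators *)

Lemma small_invS (R : realType) (e : R) : 0 < e ->
  exists N : nat, forall n, (N <= n)%N -> n.+1%:R^-1 < e.
Proof.
move=> e0; exists (Num.trunc e^-1) => n Nn.
by rewrite invf_plt ?posrE// (lt_le_trans (truncnS_gt _))// ler_nat ltnS.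
Qed.

Section Riesz.
Context (R : realType) (H : hilbertType R).

(* A maximizing sequence of the functional on the unit ball is Cauchy by the
   parallelogram law; the representing vector is a multiple of its limit. *)
Lemma riesz (phi : H -> R[i]) :
  (forall a x y, phi (a *: x + y) = a * phi x + phi y) ->
  (exists M : R, forall x, cabs (phi x) <= M * rnorm x) ->
  exists y, forall x, phi x = hdot x y.
Proof.
move=> lphi [M0 phiM0].
have [M Mp phiM] : exists2 M : R, 0 <= M & forall x, cabs (phi x) <= M * rnorm x.
  exists `|M0| => // x; apply: (le_trans (phiM0 x)).
  by rewrite ler_wpM2r// ler_norm.
have phi0 : phi 0 = 0.
  by have := lphi (-1) 0 0; rewrite scaler0 add0r mulN1r addNr.
have phiD x y : phi (x + y) = phi x + phi y.
  by have := lphi 1 x y; rewrite scale1r mul1r.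
have phiZ a x : phi (a *: x) = a * phi x.
  by have := lphi a x 0; rewrite addr0 phi0 addr0.
have phiB x y : phi (x - y) = phi x - phi y.
  by rewrite phiD -scaleN1r phiZ mulN1r.
pose A := [set cabs (phi x) | x in [set x : H | rnorm x <= 1]].
have supA : has_sup A.
  split; first by exists (cabs (phi 0)), 0 => //=; rewrite rnorm0.
  by exists M => _ [x /= x1 <-]; rewrite (le_trans (phiM x))// ler_piMr.
pose m := sup A.
have m0 : 0 <= m.
  by apply: ub_le_sup; [exact: supA.2|exists 0 => /=; rewrite ?rnorm0// phi0 cabs0].
have phim x : cabs (phi x) <= m * rnorm x.
  have [->|x0] := eqVneq x 0; first by rewrite phi0 cabs0 rnorm0 mulr0.
  have nx : 0 < rnorm x by rewrite rnorm_gt0.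
  rewrite -ler_pdivrMr//; apply: ub_le_sup; first exact: supA.2.
  exists ((rnorm x)^-1%:C%C *: x); first by rewrite /= rnorm_unit.
  by rewrite phiZ cabsM cabsR ger0_norm ?invr_ge0// mulrC.
have [m0'|mn0] := eqVneq m 0.
  exists 0 => x; rewrite hdot0r; apply/eqP; rewrite -cabs_eq0 eq_le cabs_ge0 andbT.
  by rewrite (le_trans (phim x))// m0' mul0r.
have mp : 0 < m by rewrite lt_def mn0.
have /choice[u uP] : forall n : nat, exists x, rnorm x <= 1 /\
    exists2 r : R, phi x = r%:C%C & m * (1 - n.+1%:R^-1) < r.
  move=> n; have : m * (1 - n.+1%:R^-1) < m.
    by rewrite gtr_pMr// ltrBlDr ltrDl invr_gt0.
  move=> /(sup_gt supA.1)[_ [x /= x1 <-] h]; have [w [w1 wE]] := phaseP (phi x).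
  exists (w *: x); split; first by rewrite rnormZ w1 mul1r.
  by exists (cabs (phi x)) => //; rewrite phiZ.
clearbody m.
(* With d the sum of the two inverses, phi (u_n + u_k) exceeds m (2 - d), so |u_n + u_k| >= 2 - d;
   the parallelogram law leaves |u_n - u_k|^2 <= 4 - (2 - d)^2 <= 4 d. *)
have uu n k : rnorm (u n - u k) ^+ 2 <= 4 * (n.+1%:R^-1 + k.+1%:R^-1).
  have [un [r rE rm]] := uP n; have [uk [s sE sm]] := uP k.
  have := phim (u n + u k); rewrite phiD rE sE -rmorphD /= cabsR => h.
  have {}h : m * (2 - (n.+1%:R^-1 + k.+1%:R^-1)) <= m * rnorm (u n + u k).
    by move: rm sm (ler_norm (r + s)) h; move: (n.+1%:R^-1) (k.+1%:R^-1) => a b; lra.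
  rewrite ler_pM2l// in h.
  have := parallelogram (u n) (u k).
  have un2 : rnorm (u n) ^+ 2 <= 1 by rewrite expr_le1.
  have uk2 : rnorm (u k) ^+ 2 <= 1 by rewrite expr_le1.
  have d1 : (n.+1%:R^-1 : R) <= 1 by rewrite invf_le1// ler1n.
  have d2 : (k.+1%:R^-1 : R) <= 1 by rewrite invf_le1// ler1n.
  have d3 := lerD d1 d2; set d := n.+1%:R^-1 + k.+1%:R^-1 in h d3 *.
  have : (2 - d) ^+ 2 <= rnorm (u n + u k) ^+ 2 by rewrite ler_pXn2r// nnegrE; lra.
  have : 0 <= d ^+ 2 by exact: sqr_ge0.
  nra.
have small := @small_invS R.
have [e e0|v uv] := rnorm_cauchy (u := u).
  have e20 : 0 < e ^+ 2 / 8 by rewrite divr_gt0// exprn_gt0.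
  have [N NP] := small _ e20; exists N => n k Nn Nk.
  rewrite -(@ltr_pXn2r _ 2)// ?nnegrE ?(ltW e0)// (le_lt_trans (uu n k))//.
  by move: (NP _ Nn) (NP _ Nk); move: (n.+1%:R^-1) (k.+1%:R^-1) (e ^+ 2) => a b c; lra.
have phiv : phi v = m%:C%C.
  apply/eqP; rewrite -subr_eq0; apply/eqP/cabs_small => e e0.
  have d0 : 0 < e / (M + m + 1) by rewrite divr_gt0//; lra.
  have [N1 N1P] := uv _ d0; have [N2 N2P] := small _ d0.
  pose n := maxn N1 N2.
  have := N1P n (leq_maxl _ _); have := N2P n (leq_maxr _ _) => {N1P N2P} h1 h2.
  have [un [r rE rm]] := uP n.
  have -> : phi v - m%:C%C = phi (v - u n) + (r - m)%:C%C.
    by rewrite phiB rE rmorphB /=; ring.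
  rewrite (le_trans (cabsD _ _))// cabsR.
  have rm' : r <= m.
    have := phim (u n); rewrite rE cabsR; have := ler_norm r => a b.
    by rewrite (le_trans a)// (le_trans b)// ler_piMr.
  have -> : `|r - m| = m - r by rewrite ler0_norm ?opprB// subr_le0.
  have : cabs (phi (v - u n)) <= M * (e / (M + m + 1)).
    by rewrite (le_trans (phiM _))// ler_wpM2l// ltW.
  have : m - r <= m * (e / (M + m + 1)).
    apply: (@le_trans _ _ (m * n.+1%:R^-1)).
      by move: rm; move: (n.+1%:R^-1) => a; lra.
    by rewrite ler_wpM2l// ltW.
  have : (M + m + 1) * (e / (M + m + 1)) = e by rewrite mulrC divfK// gt_eqF//; lra.
  nra.
have v1 : rnorm v <= 1.
  apply/ler_addgt0Pr => e e0; have [N /(_ N (leqnn _)) NP] := uv _ e0.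
  have [un _] := uP N; have := rnormBl v (u N); lra.
have v1' : rnorm v = 1.
  apply/eqP; rewrite eq_le v1 /= -(ler_pM2l mp) mulr1.
  by have := phim v; rewrite phiv cabsR ger0_norm.
(* First variation at the maximizer v: with r = |phi x|, the value at v + t w x is m + t r, while
   its squared norm is 1 + t^2 |x|^2. Squaring forces 2 r <= t m |x|^2 for every t > 0. *)
have phi_perp x : hdot x v = 0 -> phi x = 0.
  move=> xv; apply: cabs_small => e e0.
  have [w [w1 wE]] := phaseP (phi x); set r := cabs (phi x) in wE *.
  have r0 : 0 <= r := cabs_ge0 _.
  have key (t : R) : 0 < t -> 2 * r <= t * (m * rnorm x ^+ 2).
    move=> t0; have := phim (v + (t%:C%C * w) *: x).
    rewrite phiD phiZ phiv -mulrA wE -rmorphM -rmorphD /= cabsR.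
    rewrite ger0_norm; last by rewrite addr_ge0// mulr_ge0// ltW.
    rewrite -(@ler_pXn2r _ 2) ?nnegrE ?mulr_ge0//; last first.
      by rewrite addr_ge0// mulr_ge0// ltW.
    rewrite exprMn pythagoras; last by rewrite hdotZr (hdot_eq0 xv) mulr0.
    rewrite v1' rnormZ cabsM cabsR w1 mulr1 ger0_norm ?(ltW t0)// exprMn.
    set X := rnorm x ^+ 2 => h.
    have : t * m * (2 * r) <= t * m * (t * (m * X)).
      have : 0 <= (t * r) ^+ 2 by exact: sqr_ge0.
      have -> : t * m * (t * (m * X)) = m ^+ 2 * (t ^+ 2 * X) by ring.
      move: h; set Y := t ^+ 2 * X; rewrite expr1n; nra.
    by rewrite ler_pM2l// mulr_gt0.
  have X0 : 0 <= m * rnorm x ^+ 2 by rewrite mulr_ge0// sqr_ge0.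
  have t0 : 0 < e / (m * rnorm x ^+ 2 + 1) by rewrite divr_gt0//; lra.
  have := key _ t0.
  have : (m * rnorm x ^+ 2 + 1) * (e / (m * rnorm x ^+ 2 + 1)) = e.
    by rewrite mulrC divfK// gt_eqF//; lra.
  nra.
exists (m%:C%C *: v) => x; rewrite hdotZr conj_Creal ?complex_real//.
rewrite -[in LHS](subrK (hdot x v *: v) x) phiD phiZ phiv phi_perp ?add0r 1?mulrC//.
by rewrite hdotBl hdotZl hdotxx v1' expr1n mulr1 subrr.
Qed.

End Riesz.

Section Bop.
Context (R : realType) (H : hilbertType R).
Implicit Types (S T A : bop H) (x y v w : H) (g : seq H).

Lemma bop_linear T : linear T.
Proof. by have /bounded_operatorP[] := bop_funP T. Qed.

Lemma bop0 T : T 0 = 0.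
Proof. by have := bop_linear T (-1) 0 0; rewrite scaler0 add0r scaleN1r addNr. Qed.

Lemma bopD T x y : T (x + y) = T x + T y.
Proof. by have := bop_linear T 1 x y; rewrite !scale1r. Qed.

Lemma bopZ T a x : T (a *: x) = a *: T x.
Proof. by have := bop_linear T a x 0; rewrite !addr0 bop0 addr0. Qed.

Lemma bopN T x : T (- x) = - T x.
Proof. by rewrite -scaleN1r bopZ scaleN1r. Qed.

Lemma bopB T x y : T (x - y) = T x - T y.
Proof. by rewrite bopD bopN. Qed.

Lemma bop_sum T (I : Type) (r : seq I) (P : pred I) (F : I -> H) :
  T (\sum_(i <- r | P i) F i) = \sum_(i <- r | P i) T (F i).
Proof. by apply: (big_morph T) => [x y|]; rewrite ?bopD ?bop0. Qed.

Lemma bopP S T : (forall x, S x = T x) -> S = T.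
Proof. by move=> ST; apply: val_inj; apply/funext. Qed.

Lemma bop_addE S T x : (S + T) x = S x + T x. Proof. by []. Qed.
Lemma bop_subE S T x : (S - T) x = S x - T x. Proof. by []. Qed.
Lemma bop_scaleE (a : R[i]) S x : (a *: S) x = a *: S x. Proof. by []. Qed.
Lemma bop_compE S T x : bop_comp S T x = S (T x). Proof. by []. Qed.

Lemma bop_bounded T : exists2 M : R, 0 <= M & forall x, rnorm (T x) <= M * rnorm x.
Proof.
have /bounded_operatorP[_ [M TM]] := bop_funP T.
exists `|complex.Re M| => // x.
have := TM x; rewrite !rnormE lecE => /andP[_] /= h; apply: (le_trans h).
have -> : complex.Re (M * (rnorm x)%:C%C) = complex.Re M * rnorm x.
  by case: (M) => a b; rewrite /= mulr0 subr0.
by rewrite ler_wpM2r// ler_norm.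
Qed.

Lemma bounded_operatorI (f : H -> H) : linear f ->
  (exists M : R, forall x, rnorm (f x) <= M * rnorm x) -> f \in @bounded_operator R H.
Proof.
move=> lf [M fM]; apply/bounded_operatorP; split=> //; exists M%:C%C => x.
by rewrite !rnormE -rmorphM lecR.
Qed.

(** Real counterpart of [opnorm]; [opnormE] identifies the two. *)
Definition nop T : R := sup [set rnorm (T x) | x in [set x : H | rnorm x <= 1]].

Let nop_sup T : has_sup [set rnorm (T x) | x in [set x : H | rnorm x <= 1]].
Proof.
split; first by exists (rnorm (T 0)), 0 => //=; rewrite rnorm0.
have [M M0 TM] := bop_bounded T; exists M => _ [x /= x1 <-].
by rewrite (le_trans (TM x))// ler_piMr.
Qed.

Lemma nop_ge0 T : 0 <= nop T.
Proof.
apply: ub_le_sup; first exact: (nop_sup T).2.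
by exists 0 => /=; rewrite ?rnorm0// bop0 rnorm0.
Qed.

Lemma rnorm_bop T x : rnorm (T x) <= nop T * rnorm x.
Proof.
have [->|x0] := eqVneq x 0; first by rewrite bop0 rnorm0 mulr0.
have nx : 0 < rnorm x by rewrite rnorm_gt0.
rewrite -ler_pdivrMr//; apply: ub_le_sup; first exact: (nop_sup T).2.
exists ((rnorm x)^-1%:C%C *: x); first by rewrite /= rnorm_unit.
by rewrite bopZ rnormZ cabsR ger0_norm ?invr_ge0// mulrC.
Qed.

Lemma nop_le T M : 0 <= M -> (forall x, rnorm (T x) <= M * rnorm x) -> nop T <= M.
Proof.
move=> M0 TM; apply: ge_sup; first exact: (nop_sup T).1.
by move=> _ [x /= x1 <-]; rewrite (le_trans (TM x))// ler_piMr.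
Qed.

Lemma opnormE T : opnorm T = (nop T)%:E.
Proof.
apply/eqP; rewrite eq_le; apply/andP; split.
  apply: ge_ereal_sup => _ [x /= x1 <-]; rewrite lee_fin (le_trans (rnorm_bop T x))//.
  rewrite ler_piMr ?nop_ge0//; by rewrite rnormE (lecR _ 1) in x1.
have h : (0 <= opnorm T)%E.
  apply: ereal_sup_ubound; exists 0 => /=; first by rewrite normr0.
  by rewrite bop0 rnorm0.
move: h; case E : (opnorm T) => [r| |] // r0; last by rewrite leey.
rewrite lee_fin in r0 *.
apply: ge_sup; first exact: (nop_sup T).1.
move=> _ [y /= y1 <-]; rewrite -lee_fin -E; apply: ereal_sup_ubound.
by exists y => //=; rewrite rnormE (lecR _ 1).
Qed.

Lemma norm_boundedP (B : set (bop H)) :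
  norm_bounded B <-> exists M : R, forall T, B T -> nop T <= M.
Proof. by split=> -[M BM]; exists M => T /BM; rewrite opnormE lee_fin. Qed.

Lemma nop_comp S T : nop (bop_comp S T) <= nop S * nop T.
Proof.
apply: nop_le => [|x]; first by rewrite mulr_ge0// nop_ge0.
rewrite bop_compE (le_trans (rnorm_bop _ _))// -mulrA ler_wpM2l ?nop_ge0//.
exact: rnorm_bop.
Qed.

Lemma nopD S T : nop (S + T) <= nop S + nop T.
Proof.
apply: nop_le => [|x]; first by rewrite addr_ge0// nop_ge0.
by rewrite bop_addE (le_trans (rnormD _ _))// mulrDl lerD// rnorm_bop.
Qed.

Lemma nopZ a T : nop (a *: T) <= cabs a * nop T.
Proof.
apply: nop_le => [|x]; first by rewrite mulr_ge0// nop_ge0.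
by rewrite bop_scaleE rnormZ -mulrA ler_wpM2l// rnorm_bop.
Qed.

(** [riesz] applied to x -> <T x, y> produces the values of the adjoint. This existence is what
    gives the [xget] in [adjoint] its defining identity. *)
Lemma adjoint_ex T : exists A : bop H, forall x y, hdot (T x) y = hdot x (A y).
Proof.
have /choice[f fP] : forall y, exists z, forall x, hdot (T x) y = hdot x z.
  move=> y; apply: riesz => [a x z|]; first by rewrite bop_linear hdot_linearl.
  exists (nop T * rnorm y) => x; rewrite (le_trans (cauchy_schwarz _ _))//.
  by rewrite mulrAC ler_wpM2r// rnorm_bop.
have lf : linear f.
  move=> a x y; apply/eqP; rewrite -subr_eq0; apply/eqP/hdotP => z.
  apply: hdot_eq0; rewrite hdotBr hdotDr hdotZr -!fP hdotDr hdotZr; ring.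
have bf : exists M : R, forall x, rnorm (f x) <= M * rnorm x.
  exists (nop T) => x; apply: rnorm_le_hdot; first by rewrite mulr_ge0// nop_ge0.
  rewrite -fP (le_trans (cauchy_schwarz _ _))// [leRHS]mulrAC.
  by rewrite ler_wpM2r// rnorm_bop.
by exists (Bop (bounded_operatorI lf bf)) => x y; exact: fP.
Qed.

Lemma hdot_adjoint T x y : hdot (T x) y = hdot x (adjoint T y).
Proof.
have [A AP] := adjoint_ex T; rewrite /adjoint.
by case: xgetP => [B _ ->//|/(_ A)]; case.
Qed.

Lemma hdot_adjointl T x y : hdot (adjoint T x) y = hdot x (T y).
Proof. by rewrite hdot_conj -hdot_adjoint -hdot_conj. Qed.

Lemma adjoint_uniq T A : (forall x y, hdot (T x) y = hdot x (A y)) -> adjoint T = A.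
Proof.
move=> TA; apply: bopP => y; apply/eqP; rewrite -subr_eq0; apply/eqP/hdotP => x.
by apply: hdot_eq0; rewrite hdotBr -hdot_adjoint TA subrr.
Qed.

Lemma adjointK T : adjoint (adjoint T) = T.
Proof. by apply: adjoint_uniq => x y; rewrite hdot_adjointl. Qed.

Lemma adjoint_comp S T : adjoint (bop_comp S T) = bop_comp (adjoint T) (adjoint S).
Proof. by apply: adjoint_uniq => x y; rewrite !bop_compE !hdot_adjoint. Qed.

Lemma adjointB S T : adjoint (S - T) = adjoint S - adjoint T.
Proof.
by apply: adjoint_uniq => x y; rewrite !bop_subE hdotBl hdotBr !hdot_adjoint.
Qed.

Lemma nop_adjoint_le T : nop (adjoint T) <= nop T.
Proof.
apply: nop_le; first exact: nop_ge0.
move=> x; apply: rnorm_le_hdot; first by rewrite mulr_ge0// nop_ge0.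
rewrite -hdot_adjoint (le_trans (cauchy_schwarz _ _))// [leRHS]mulrAC.
by rewrite ler_wpM2r// rnorm_bop.
Qed.

Lemma nop_adjoint T : nop (adjoint T) = nop T.
Proof.
by apply/eqP; rewrite eq_le nop_adjoint_le -[leLHS](congr1 nop (adjointK T)) nop_adjoint_le.
Qed.

Lemma projP (I : eqType) (e : I -> H) r : orthonormal e r ->
  proj e r \in @bounded_operator R H.
Proof.
move=> oe; apply: bounded_operatorI; first exact: proj_linear.
by exists 1 => x; rewrite mul1r rnorm_proj.
Qed.

(* [rank1 u v] is the operator u (x) v^*. *)
Definition rank1_fun (u v : H) := fun x : H => hdot x v *: u.

Lemma rank1P u v : rank1_fun u v \in @bounded_operator R H.
Proof.
apply: bounded_operatorI => [a x y|].
  by rewrite /rank1_fun hdot_linearl scalerDl scalerA.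
exists (rnorm u * rnorm v) => x; rewrite rnormZ.
have := cauchy_schwarz x v; have := rnorm_ge0 u; have := rnorm_ge0 x; nra.
Qed.

Definition rank1 u v : bop H := Bop (rank1P u v).

Lemma rank1E u v x : rank1 u v x = hdot x v *: u. Proof. by []. Qed.

Lemma comp_rank1 T u v : bop_comp T (rank1 u v) = rank1 (T u) v.
Proof. by apply: bopP => x; rewrite bop_compE !rank1E bopZ. Qed.

Lemma rank1_comp T u v : bop_comp (rank1 u v) T = rank1 u (adjoint T v).
Proof. by apply: bopP => x; rewrite bop_compE !rank1E hdot_adjoint. Qed.

Lemma nop_rank1 u v : nop (rank1 u v) = rnorm u * rnorm v.
Proof.
apply/eqP; rewrite eq_le; apply/andP; split.
  apply: nop_le => [|x]; first by rewrite mulr_ge0.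
  rewrite rank1E rnormZ.
  have := cauchy_schwarz x v; have := rnorm_ge0 u; have := rnorm_ge0 x; nra.
have [->|v0] := eqVneq v 0; first by rewrite rnorm0 mulr0 nop_ge0.
have := rnorm_bop (rank1 u v) v.
rewrite rank1E rnormZ hdotxx cabsR ger0_norm ?sqr_ge0// expr2 -mulrA.
by rewrite mulrC -mulrA mulrC ler_pM2r ?rnorm_gt0// mulrC.
Qed.

End Bop.

(** * Approximation numbers and compactness *)

Section ApproximationNumbers.
Context (R : realType) (H : hilbertType R).
Implicit Types (S T A : bop H) (x y v w : H) (g h : seq H) (c d e : R) (m n : nat).

(** A bound for the n-th Gelfand number, counted from 0. Asking for [size g <= n] instead of
    equality makes the predicate monotone in n. *)
Definition approx T n c :=
  exists2 g : seq H, (size g <= n)%N & forall v, perp g v -> rnorm (T v) <= c * rnorm v.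

Lemma approxW T m n c d : (m <= n)%N -> c <= d -> approx T m c -> approx T n d.
Proof.
move=> mn cd [g gm gT]; exists g; first exact: leq_trans mn.
by move=> v /gT h; rewrite (le_trans h)// ler_wpM2r.
Qed.

Lemma approx_nop T : approx T 0 (nop T).
Proof. by exists [::] => // v _; exact: rnorm_bop. Qed.

Lemma approx_compl S T n c : approx T n c -> approx (bop_comp S T) n (nop S * c).
Proof.
move=> [g gn gT]; exists g => // v /gT h; rewrite bop_compE (le_trans (rnorm_bop _ _))//.
by rewrite -mulrA ler_wpM2l// nop_ge0.
Qed.

(** For [T v] to be orthogonal to g, it suffices that v be orthogonal to the image of g under the
    adjoint of [T]; the lists for the two factors are then concatenated. *)
Lemma approx_comp S T m n c d : 0 <= c -> approx S m c -> approx T n d ->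
  approx (bop_comp S T) (m + n) (c * d).
Proof.
move=> c0 [g gm gS] [h hn hT]; exists ([seq adjoint T w | w <- g] ++ h).
  by rewrite size_cat size_map leq_add.
move=> v /perp_cat[gv hv]; rewrite bop_compE (le_trans (gS _ _))//.
  by move=> w wg; rewrite hdot_adjoint gv// map_f.
by rewrite -mulrA ler_wpM2l// hT.
Qed.

Lemma approx_compr S T n c : 0 <= c -> approx S n c -> approx (bop_comp S T) n (c * nop T).
Proof.
by move=> c0 Sn; rewrite -[n]addn0; apply: approx_comp => //; exact: approx_nop.
Qed.

(** If v is orthogonal to T g, then u = adjoint T v is orthogonal to g, and |u|^2 = <v, T u> <= |v|
    c |u|. *)
Lemma approx_adjoint T n c : 0 <= c -> approx T n c -> approx (adjoint T) n c.
Proof.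
move=> c0 [g gn gT]; exists [seq T w | w <- g]; first by rewrite size_map.
move=> v gv; apply: rnorm_le_hdot; first exact: mulr_ge0.
rewrite hdot_adjointl (le_trans (cauchy_schwarz _ _))//.
rewrite mulrC [leRHS]mulrAC ler_wpM2r// gT// => u ug.
by rewrite hdot_adjointl gv// map_f.
Qed.

Lemma approx_rank1 u v : approx (rank1 u v) 1 0.
Proof.
exists [:: v] => // x xv; rewrite rank1E xv ?inE//.
by rewrite scale0r rnorm0 mul0r.
Qed.

Lemma approx_proj T n c : approx T n c -> exists2 h, orthonormal id h &
  forall x, rnorm (T (x - proj id h x)) <= c * rnorm (x - proj id h x).
Proof.
move=> [g _ gT]; have [h oh hg] := gram_schmidt g; exists h => // x.
by apply/gT/hg => w wh; exact: proj_perp.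
Qed.

End ApproximationNumbers.

(** * Total boundedness and compact closures *)

Section TotallyBounded.
Context (R : realType) (V : completeNormedModType R[i]).
Implicit Types (A B : set V).

Definition totally_bounded A := forall e : R, 0 < e ->
  exists s : seq V, forall x, A x -> exists2 y, y \in s & rnorm (y - x) < e.

Lemma totally_boundedD A B : totally_bounded A -> totally_bounded B ->
  totally_bounded [set x + y | x in A & y in B].
Proof.
move=> tA tB e e0; have e20 : 0 < e / 2 by rewrite divr_gt0.
have [s sA] := tA _ e20; have [t tB'] := tB _ e20.
exists [seq a + b | a <- s, b <- t] => _ [x Ax [y By <-]].
have [a as_ ax] := sA _ Ax; have [b bt by_] := tB' _ By.
exists (a + b); first by apply/allpairsP; exists (a, b).
by rewrite opprD addrACA (le_lt_trans (rnormD _ _))//; lra.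
Qed.

Lemma grid_approx (N : nat) (a : R) : `|a| <= 1 ->
  exists2 k, (k < (N.+1 * 2).+1)%N & `|k%:R / N.+1%:R - 1 - a| <= N.+1%:R^-1.
Proof.
rewrite ler_norml => /andP[a1 a2].
have N0 : 0 < N.+1%:R :> R by [].
have b0 : 0 <= (a + 1) * N.+1%:R by rewrite mulr_ge0//; lra.
exists (Num.trunc ((a + 1) * N.+1%:R)).
  rewrite ltnS -(ler_nat R) (@le_trans _ _ ((a + 1) * N.+1%:R))// ?truncn_le//.
  rewrite natrM mulrC ler_wpM2l//; lra.
have /andP[] := truncn_itv b0.
set k := Num.trunc _ => h1 h2.
have -> : k%:R / N.+1%:R - 1 - a = (k%:R - (a + 1) * N.+1%:R) / N.+1%:R.
  by rewrite mulrBl mulfK ?gt_eqF//; ring.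
rewrite normrM [X in _ * X]ger0_norm ?invr_ge0// ler_piMl ?invr_ge0//.
rewrite ler_norml; apply/andP; split; last lra.
by move: h2; rewrite -natr1; lra.
Qed.

(** Real and imaginary parts are rounded to a grid of mesh [D / N.+1]; the two coordinate errors
    explain the factor 2 in the choice of N. *)
Lemma totally_bounded_disc (u : V) (M : R) :
  totally_bounded [set c *: u | c in [set c | cabs c <= M]].
Proof.
move=> e e0.
pose D := `|M| + 1.
have D0 : 0 < D by rewrite /D; have := normr_ge0 M; lra.
have u1 : 0 < rnorm u + 1 by have := rnorm_ge0 u; lra.
have [N NP] : exists N : nat, N.+1%:R^-1 < e / (2 * D * (rnorm u + 1)).
  have [|N NP] := @small_invS R (e / (2 * D * (rnorm u + 1))).
    by rewrite divr_gt0// !mulr_gt0.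
  by exists N; exact: NP.
pose K := (N.+1 * 2).+1.
pose pt (k : nat) : R := D * (k%:R / N.+1%:R - 1).
exists [seq (Complex (pt k) (pt l)) *: u | k <- iota 0 K, l <- iota 0 K].
move=> _ [[a b] cM <-]; rewrite /= in cM.
have cD : cabs (Complex a b) <= D.
  by rewrite (le_trans cM)// /D; have := ler_norm M; lra.
have reD (z : R) : `|z| <= D -> exists2 k, (k < K)%N & `|pt k - z| <= D * N.+1%:R^-1.
  move=> zD; have zD' : `|z / D| <= 1.
    by rewrite normrM normfV (gtr0_norm D0) ler_pdivrMr// mul1r.
  have [k kK kz] := grid_approx N zD'; exists k => //.
  have -> : pt k - z = D * (k%:R / N.+1%:R - 1 - z / D).
    by rewrite [RHS]mulrBr [D * (z / D)]mulrC divfK// gt_eqF.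
  by rewrite normrM (gtr0_norm D0) ler_wpM2l// ltW.
have [|k kK ka] := reD a.
  by apply: le_trans cD; have := normc_ge_Re (Complex a b); rewrite cabsE lecR.
have [|l lK lb] := reD b.
  by apply: le_trans cD; rewrite /cabs normc_def /= -sqrtr_sqr ler_wsqrtr// lerDr sqr_ge0.
exists ((Complex (pt k) (pt l)) *: u).
  by apply: (allpairs_f (fun k l => (Complex (pt k) (pt l)) *: u)); rewrite mem_iota.
rewrite -scalerBl rnormZ.
have -> : Complex (pt k) (pt l) - Complex a b = (pt k - a)%:C%C + (Complex 0 1) * (pt l - b)%:C%C.
  by rewrite [LHS]complexE.
have cz : cabs ((pt k - a)%:C%C + (Complex 0 1) * (pt l - b)%:C%C) <= 2 * D * N.+1%:R^-1.
  rewrite (le_trans (cabsD _ _))// cabsM !cabsR.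
  have -> : cabs (Complex 0 1 : R[i]) = 1 by rewrite /cabs normc_def /= expr0n add0r expr1n sqrtr1.
  by rewrite mul1r; move: ka lb; move: (N.+1%:R^-1) (`|pt k - a|) (`|pt l - b|) => q A B; lra.
apply: (@le_lt_trans _ _ (2 * D * N.+1%:R^-1 * (rnorm u + 1))).
  by rewrite ler_pM//; have := rnorm_ge0 u; lra.
move: NP; rewrite ltr_pdivlMr ?mulr_gt0//; move: (N.+1%:R^-1) => q; nra.
Qed.

(** An ultrafilter on the closure contains one ball out of every finite cover, so it is Cauchy and
    converges by completeness. *)
Lemma totally_bounded_compact A : totally_bounded A -> compact (closure A).
Proof.
move=> tA; rewrite compact_ultra => F FU FA.
have FF : ProperFilter F by exact: ultra_proper.
have cF : cvg F.
  apply: cauchy_cvg; apply: cauchy_exP => e e0.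
  have e0' : 0 < complex.Re e by move: e0; rewrite ltcE /= => /andP[].
  have e20 : 0 < complex.Re e / 2 by rewrite divr_gt0.
  have [s sA] := tA _ e20.
  have : F (\bigcup_(y in [set` s]) ball y e).
    apply: filterS FA => x Ax.
    have /Ax[z [Az xz]] : nbhs x [set z | rnorm (x - z) < complex.Re e / 2].
      by apply/rnorm_nbhs; exists (complex.Re e / 2).
    have [y ys yz] := sA _ Az; exists y => //.
    rewrite rnorm_ball// (le_lt_trans (rnorm_tri z _ _))//.
    by rewrite (rnormC z); rewrite /= in xz; lra.
  elim: s {sA} => [|y s IH] Fs.
    by move: Fs; rewrite set_nil bigcup_set0 => /filter_ex[].
  have [Fy|Fy] := in_ultra_setVsetC (ball y e) FU; first by exists y.
  apply: IH; apply: filterS (filterI Fs Fy) => x [[z /= ]].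
  rewrite inE => /predU1P[->//|zs zx] _; by exists z.
have /cvg_ex[l Fl] := cF; exists l; split => //.
suff : closure (closure A) l by rewrite -(closure_id _).1//; exact: closed_closure.
by move=> B /Fl FB; apply: (@filter_ex _ F FF); exact: filterI.
Qed.

End TotallyBounded.

(** Dependent choice with the whole past in view. P must be satisfiable for every list, so a
    condition on the past has to enter P as a premise and be discharged afterwards. *)
Lemma history_choice (T : Type) (P : seq T -> T -> Prop) :
  (forall g, exists v, P g v) -> exists e : nat -> T, forall n, P (mkseq e n) (e n).
Proof.
move=> /choice[f fP].
pose L := fix L n := if n is m.+1 then rcons (L m) (f (L m)) else [::].
exists (fun n => f (L n)) => n; have -> : mkseq (fun n => f (L n)) n = L n.
  elim: n => // n IH; rewrite mkseqS IH //.
exact: fP.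
Qed.

Section OrthonormalSequences.
Context (R : realType) (H : hilbertType R).
Implicit Types (e : nat -> H) (x y v w : H) (r : seq nat).

Definition onseq e := forall i j : nat, hdot (e i) (e j) = (i == j)%:R.

Lemma onseq_orthonormal e r : onseq e -> uniq r -> orthonormal e r.
Proof. by move=> oe ur; split=> // i j _ _; exact: oe. Qed.

Lemma onseq_iota e n : onseq e -> orthonormal e (iota 0 n).
Proof. by move=> oe; apply: onseq_orthonormal => //; exact: iota_uniq. Qed.

Lemma onseq_norm e n : onseq e -> rnorm (e n) = 1.
Proof.
move=> oe; apply: (@orthonormal_norm _ _ _ e [:: n]); last by rewrite inE.
exact: onseq_orthonormal.
Qed.

Lemma perp_mkseq e n x : perp (mkseq e n) x <-> forall j, (j < n)%N -> hdot x (e j) = 0.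
Proof.
split=> [h j jn|h w /mapP[j]]; first by apply/h/map_f; rewrite mem_iota.
by rewrite mem_iota add0n => /andP[_ jn] ->; exact: h.
Qed.

Lemma onseqI e : (forall n, rnorm (e n) = 1 /\ perp (mkseq e n) (e n)) -> onseq e.
Proof.
move=> eP i j; case: (ltngtP i j) => [ij|ji|->].
- by apply: hdot_eq0; have [_ /perp_mkseq] := eP j; apply.
- by have [_ /perp_mkseq] := eP i; apply.
- by rewrite hdotxx (eP j).1 expr1n.
Qed.

End OrthonormalSequences.

(** * Compactness as approximability off finitely many vectors *)

Section CompactOperators.
Context (R : realType) (H : hilbertType R).
Implicit Types (S T : bop H) (x y v w : H) (g h : seq H) (c d e : R) (m n : nat).

Lemma compact_cluster T (u : nat -> H) : compact_operator T ->
  (forall n, rnorm (u n) <= 1) ->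
  exists w, forall e N, 0 < e -> exists2 n, (N <= n)%N & rnorm (T (u n) - w) < e.
Proof.
move=> cT u1.
have [|w [_ cw]] := cT ((fun n => T (u n)) @ \oo) _.
  exists 0 => // n _ /=; apply: subset_closure; exists (u n) => //=.
  by rewrite rnormE (lecR _ 1).
exists w => e N e0.
have /cw : ((fun n => T (u n)) @ \oo) [set T (u n) | n in [set n | (N <= n)%N]].
  by exists N => // n /= Nn; exists n.
have nw : nbhs w [set y | rnorm (w - y) < e] by apply/rnorm_nbhs; exists e.
by move=> /(_ _ nw)[_ [[n Nn <-] /= h]]; exists n => //; rewrite rnormC.
Qed.

(** Each new vector is orthogonal to the earlier e_j and to their images under adjoint T composed
    with T; the second condition makes the T e_j orthogonal to one another. *)
Lemma not_approx_onseq T c : (forall n, ~ approx T n c) ->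
  exists e : nat -> H, [/\ onseq e, forall i j, i != j -> hdot (T (e i)) (T (e j)) = 0 &
    forall i, c < rnorm (T (e i))].
Proof.
move=> nT.
have [g|e eP] := history_choice (P := fun g v => [/\ rnorm v = 1, perp g v,
    perp (map (bop_comp (adjoint T) T) g) v & c < rnorm (T v)]).
  apply: contrapT => hg; apply: (nT (size (g ++ map (bop_comp (adjoint T) T) g))).
  exists (g ++ map (bop_comp (adjoint T) T) g) => // v.
  move=> /perp_cat[gv hv]; rewrite leNgt; apply/negP => cv; apply: hg.
  have v0 : v != 0.
    by apply: contraTneq cv => ->; rewrite bop0 rnorm0 mulr0 ltxx.
  have nv : 0 < rnorm v by rewrite rnorm_gt0.
  exists ((rnorm v)^-1%:C%C *: v); split.
  - exact: rnorm_unit.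
  - by move=> w wg; rewrite hdotZl gv// mulr0.
  - by move=> w wg; rewrite hdotZl hv// mulr0.
  - by rewrite bopZ rnormZ cabsR ger0_norm ?invr_ge0// mulrC ltr_pdivlMr.
exists e; split.
- by apply: onseqI => n; have [] := eP n.
- have oT i j : (i < j)%N -> hdot (T (e i)) (T (e j)) = 0.
    move=> ij; apply: hdot_eq0; rewrite hdot_adjoint.
    have [_ _ h _] := eP j; apply: (h); apply/mapP; exists (e i) => //.
    by apply/map_f; rewrite mem_iota.
  by move=> i j; rewrite neq_ltn => /orP[/oT//|/oT/hdot_eq0].
- by move=> i; have [] := eP i.
Qed.

(** If approximation at level e fails, [not_approx_onseq] gives unit vectors whose images are more
    than e apart, leaving no cluster point. Conversely, on the unit ball T is within e/2 of a
    finite-rank operator, and finite-rank images of the ball are totally bounded. *)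
Lemma compact_approx T : compact_operator T <->
  forall e, 0 < e -> exists n, approx T n e.
Proof.
split=> [cT e e0|aT].
  apply: contrapT => nT.
  have [|u [ou oT uT]] := @not_approx_onseq T e.
    by move=> n an; apply: nT; exists n.
  have [|w wP] := compact_cluster cT (u := u); first by move=> n; rewrite onseq_norm.
  have e20 : 0 < e / 2 by rewrite divr_gt0.
  have [n _ n1] := wP _ 0%N e20; have [k nk k1] := wP _ n.+1 e20.
  have : rnorm (T (u n) - T (u k)) < e.
    by rewrite (le_lt_trans (rnorm_tri w _ _))// (rnormC w); lra.
  apply/negP; rewrite -leNgt -(@ler_pXn2r _ 2) ?nnegrE ?(ltW e0)//.
  rewrite -[T (u n) - T (u k)]/(T (u n) + - T (u k)) pythagoras; last first.
    by rewrite hdotNr oT ?oppr0// neq_ltn nk.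
  rewrite rnormN ler_wpDr ?sqr_ge0// ler_pXn2r// ?nnegrE ?(ltW e0)//.
  by rewrite ltW// uT.
apply: totally_bounded_compact => e e0.
have e20 : 0 < e / 2 by rewrite divr_gt0.
have [n /approx_proj[h oh hT]] := aT _ e20.
have e20' : 0 < e / 2 by [].
pose B := [set T (proj id h x) | x in [set x : H | rnorm x <= 1]].
have tB : totally_bounded B.
  suff tS (s : seq H) : uniq s -> {subset s <= h} -> totally_bounded
      [set T (\sum_(w <- s) hdot x w *: w) | x in [set x : H | rnorm x <= 1]].
    by apply: (tS h oh.1).
  elim: s => [_ _|w s IH].
    move=> d d0; exists [:: 0] => _ [x _ <-]; exists 0; first by rewrite inE.
    by rewrite big_nil bop0 subrr rnorm0.
  move=> /=/andP[ws us] wsh.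
  have tD := totally_boundedD (@totally_bounded_disc _ _ (T w) 1)
    (IH us (fun y ys => wsh y (mem_behead (s := w :: s) ys))).
  move=> d d0; have [t tP] := tD _ d0; exists t => _ [x x1 <-]; rewrite /= in x1.
  apply: tP; rewrite big_cons bopD bopZ.
  exists (hdot x w *: T w).
    exists (hdot x w) => //=; rewrite (le_trans (cauchy_schwarz _ _))//.
    by rewrite (@orthonormal_norm _ _ _ id h w oh) ?mulr1//; apply: wsh; rewrite inE eqxx.
  by exists (T (\sum_(w <- s) hdot x w *: w)) => //; exists x.
have [s sP] := tB _ e20; exists s => _ [x /= x1 <-].
rewrite rnormE (lecR _ 1) in x1.
have [|y ys yT] := sP (T (proj id h x)); first by exists x.
exists y => //; rewrite (le_lt_trans (rnorm_tri (T (proj id h x)) _ _))//.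
have : rnorm (T (proj id h x) - T x) <= e / 2; last lra.
by rewrite -bopB -rnormN -bopN opprB (le_trans (hT _))// ler_piMr ?(ltW e20)//
   (le_trans (rnorm_proj_compl _ oh)).
Qed.

End CompactOperators.

(** * Singular value decomposition *)

Section SVD.
Context (R : realType) (H : hilbertType R).
Implicit Types (S T : bop H) (x y v w : H) (g h : seq H) (c d : R) (m n : nat).

(** T attains its norm on the complement of g, and a maximizer is an eigenvector of B = adjoint T
    composed with T. The hypothesis on g makes its complement invariant under B. *)
Lemma top_vector T g : infinite_dimensional H -> compact_operator T ->
  (forall w, w \in g -> exists l, adjoint T (T w) = l *: w) ->
  exists v, [/\ rnorm v = 1, perp g v, adjoint T (T v) = (rnorm (T v) ^+ 2)%:C%C *: v &
    forall u, perp g u -> rnorm (T u) <= rnorm (T v) * rnorm u].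
Proof.
move=> infH cT gl; pose A := [set rnorm (T x) | x in [set x : H | rnorm x <= 1 /\ perp g x]].
have A0 : A !=set0.
  exists (rnorm (T 0)), 0 => //=; split; first by rewrite rnorm0.
  by move=> w _; rewrite hdot0l.
have ubA : ubound A (nop T).
  move=> _ [x [x1 _] <-]; rewrite (le_trans (rnorm_bop _ _))// ler_piMr ?nop_ge0//.
have supA : has_sup A by split=> //; exists (nop T).
have [m [m0 mT mA]] : exists m : R, [/\ 0 <= m, forall u, perp g u -> rnorm (T u) <= m * rnorm u &
    forall d : R, d < m -> exists u, [/\ rnorm u <= 1, perp g u & d < rnorm (T u)]].
  exists (sup A); split.
  - by have [a Aa] := A0; apply: le_trans (ub_le_sup supA.2 Aa); case: Aa => x _ <-.
  - move=> u gu; have [->|u0] := eqVneq u 0; first by rewrite bop0 rnorm0 mulr0.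
    have nu : 0 < rnorm u by rewrite rnorm_gt0.
    rewrite -ler_pdivrMr//; apply: ub_le_sup; first exact: supA.2.
    exists ((rnorm u)^-1%:C%C *: u).
      by split=> [|w wg]; rewrite ?rnorm_unit// hdotZl gu// mulr0.
    by rewrite bopZ rnormZ cabsR ger0_norm ?invr_ge0// mulrC.
  - move=> d /(sup_gt A0)[_ [x [x1 gx] <-] dx]; by exists x.
clear A A0 ubA supA.
(* If T vanishes on the complement of g, any unit vector there will do; infinite dimension provides
   one. *)
have [m00|mn0] := eqVneq m 0.
  have [v [v1 gv]] := infdim_perp g infH.
  have Tu0 u : perp g u -> T u = 0.
    move=> /mT; rewrite m00 mul0r => h; apply/eqP.
    by rewrite -rnorm_eq0 eq_le h /=.
  exists v; split=> //; first by rewrite Tu0// bop0 rnorm0 expr0n scale0r.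
  by move=> u gu; rewrite !Tu0// rnorm0 mul0r.
have mp : 0 < m by rewrite lt_def mn0.
pose B := bop_comp (adjoint T) T.
have gB u : perp g u -> perp g (B u).
  move=> gu w wg; rewrite /B bop_compE hdot_adjointl hdot_adjoint.
  by have [l ->] := gl _ wg; rewrite hdotZr gu// mulr0.
have Bu u : perp g u -> rnorm (B u) <= m * rnorm (T u).
  move=> gu; apply: rnorm_le_hdot; first exact: mulr_ge0.
  rewrite {1}/B bop_compE hdot_adjointl (le_trans (cauchy_schwarz _ _))//.
  rewrite mulrC [leRHS]mulrAC ler_wpM2r// mT//; exact: gB.
(* Expanding the square and using |B u| <= m |T u| shows that near-maximizers are
   near-eigenvectors. *)
have key u : perp g u -> rnorm u <= 1 ->
    rnorm (B u - (m ^+ 2)%:C%C *: u) ^+ 2 <= m ^+ 2 * (m ^+ 2 - rnorm (T u) ^+ 2).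
  move=> gu u1; rewrite rnorm2B hdotZr conj_Creal ?complex_real//.
  rewrite {2}/B bop_compE hdot_adjointl hdotxx -rmorphM /= rnormZ cabsR ger0_norm ?sqr_ge0//.
  have h1 : rnorm (B u) ^+ 2 <= m ^+ 2 * rnorm (T u) ^+ 2.
    by rewrite -exprMn ler_pXn2r ?nnegrE ?mulr_ge0// Bu.
  have h2 : (m ^+ 2 * rnorm u) ^+ 2 <= m ^+ 2 * m ^+ 2.
    rewrite exprMn [X in X * _]expr2 ler_piMr ?mulr_ge0 ?sqr_ge0//.
    by rewrite expr_le1.
  lra.
have /choice[u uP] : forall n : nat, exists u, [/\ rnorm u <= 1, perp g u &
    m * (1 - n.+1%:R^-1) < rnorm (T u)].
  by move=> n; apply: mA; rewrite gtr_pMr// ltrBlDr ltrDl invr_gt0.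
have [|w wP] := compact_cluster cT (u := u); first by move=> n; have [] := uP n.
(* The T u_n cluster at w, and m^2 u_n is close to adjoint T (T u_n), so the u_n themselves cluster
   at this vector. *)
pose v := (m ^- 2)%:C%C *: adjoint T w.
have m2 : 0 < m ^+ 2 by rewrite exprn_gt0.
have uv (e : R) N : 0 < e -> exists2 n, (N <= n)%N & rnorm (u n - v) < e.
  move=> e0.
  pose D := nop T + 1; have D0 : 0 < D by rewrite /D; have := nop_ge0 T; lra.
  pose e1 := e * m ^+ 2 / 2.
  have e10 : 0 < e1 by rewrite divr_gt0// mulr_gt0.
  have e20 : 0 < e1 / D by rewrite divr_gt0.
  have e30 : 0 < e1 ^+ 2 / (2 * m ^+ 4) by rewrite divr_gt0// ?mulr_gt0// exprn_gt0.
  have [N' NP'] := small_invS e30.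
  have [n Nn nw] := wP _ (maxn N N') e20.
  exists n; first exact: leq_trans (leq_maxl _ _) Nn.
  have [u1 gu uT] := uP n.
  have {}NP' := NP' n (leq_trans (leq_maxr _ _) Nn).
  set E := B (u n) - (m ^+ 2)%:C%C *: u n.
  set F := adjoint T (T (u n) - w).
  have -> : u n - v = (m ^- 2)%:C%C *: (F - E).
    rewrite /E /F /B bop_compE bopB opprB [X in _ *: X]addrC addrA subrK.
    by rewrite scalerBr scalerA -rmorphM mulVf ?gt_eqF// scale1r.
  have nE : rnorm E < e1.
    rewrite -(@ltr_pXn2r _ 2) ?nnegrE ?(ltW e10)// (le_lt_trans (key _ gu u1))//.
    have : (m * (1 - n.+1%:R^-1)) ^+ 2 <= rnorm (T (u n)) ^+ 2.
      rewrite ler_pXn2r ?nnegrE//; first exact: ltW.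
      by rewrite mulr_ge0// subr_ge0 invf_le1// ler1n.
    move: NP'; rewrite ltr_pdivlMr ?mulr_gt0 ?exprn_gt0//.
    have : 0 <= (n.+1%:R^-1 : R) by rewrite invr_ge0.
    move: (n.+1%:R^-1) => q; have : 0 <= m ^+ 2 by exact: sqr_ge0.
    nra.
  have nF : rnorm F <= e1.
    rewrite (le_trans (rnorm_bop _ _))// nop_adjoint.
    have : nop T * rnorm (T (u n) - w) <= D * (e1 / D).
      by rewrite ler_pM ?nop_ge0// ?ltW// /D; lra.
    by rewrite [D * _]mulrC divfK ?gt_eqF.
  rewrite rnormZ cabsR ger0_norm ?invr_ge0 ?ltW// mulrC ltr_pdivrMr//.
  rewrite (le_lt_trans (rnormB _ _))//.
  by move: nE nF; rewrite /e1; lra.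
have gv : perp g v.
  move=> w' w'g; apply: cabs_small => e e0.
  have w'0 : 0 < rnorm w' + 1 by have := rnorm_ge0 w'; lra.
  have [n _ nv] := uv (e / (rnorm w' + 1)) 0%N (divr_gt0 e0 w'0).
  have [_ gu _] := uP n; rewrite -[v](subrK (u n)) hdotDl gu// addr0.
  rewrite (le_trans (cauchy_schwarz _ _))// rnormC.
  rewrite ltr_pdivlMr// in nv.
  by have := rnorm_ge0 (u n - v); lra.
have v1 : rnorm v <= 1.
  apply/ler_addgt0Pr => e e0; have [n _ nv] := uv e 0%N e0.
  by have [u1 _ _] := uP n; have := rnormBl v (u n); rewrite rnormC; lra.
have Tv : m <= rnorm (T v).
  apply/ler_addgt0Pr => e e0.
  have T1 : 0 < nop T + 1 by have := nop_ge0 T; lra.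
  have e20 : 0 < e / 2 by rewrite divr_gt0.
  have [N NP] := small_invS (divr_gt0 e20 mp).
  have [n Nn nv] := uv (e / 2 / (nop T + 1)) N (divr_gt0 e20 T1).
  have [_ _ uT] := uP n; have := NP n Nn; rewrite ltr_pdivlMr// => h.
  have := rnormBl (T (u n)) (T v); rewrite -bopB => h2.
  have := rnorm_bop T (u n - v).
  rewrite ltr_pdivlMr// in nv.
  move: uT h h2 nv (rnorm_ge0 (u n - v)); move: (n.+1%:R^-1) => q; lra.
have v1' : rnorm v = 1.
  apply/eqP; rewrite eq_le v1 /= -(ler_pM2l mp) mulr1 (le_trans Tv)//.
  exact: mT.
have TvE : rnorm (T v) = m.
  by apply/eqP; rewrite eq_le Tv andbT (le_trans (mT _ gv))// v1' mulr1.
exists v; split=> //; last by rewrite TvE.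
rewrite TvE -[LHS]/(B v); apply/eqP; rewrite -subr_eq0 -rnorm_eq0 -sqrf_eq0.
rewrite eq_le sqr_ge0 andbT (le_trans (key _ gv v1))// TvE subrr mulr0 //.
Qed.

(** Only right singular vectors are recorded, as the left ones T e_n / s_n are undefined when s_n =
    0. The last clause replaces completeness of e. *)
Definition is_svd T (e : nat -> H) (s : nat -> R) := [/\ onseq e, forall n, 0 <= s n,
  forall m n, (m <= n)%N -> s n <= s m,
  forall n, adjoint T (T (e n)) = (s n ^+ 2)%:C%C *: e n &
  forall n v, (forall j, (j < n)%N -> hdot v (e j) = 0) -> rnorm (T v) <= s n * rnorm v].

Lemma svd_ex T : infinite_dimensional H -> compact_operator T ->
  exists e s, is_svd T e s.
Proof.
move=> infH cT.
(* That g consists of eigenvectors is a premise inside P, with the dummy value 0 when it fails;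
   [eig] then discharges it by strong induction. *)
have [g|e eP] := history_choice (P := fun g v =>
    (forall w, w \in g -> exists l, adjoint T (T w) = l *: w) ->
    [/\ rnorm v = 1, perp g v, adjoint T (T v) = (rnorm (T v) ^+ 2)%:C%C *: v &
    forall u, perp g u -> rnorm (T u) <= rnorm (T v) * rnorm u]).
  have [gl|ngl] := pselect (forall w, w \in g -> exists l, adjoint T (T w) = l *: w).
    by have [v vP] := top_vector infH cT gl; exists v.
  by exists 0 => /ngl.
have eig n : forall w, w \in mkseq e n -> exists l, adjoint T (T w) = l *: w.
  elim/ltn_ind: n => n IH w /mapP[j]; rewrite mem_iota add0n => /andP[_ jn] ->.
  by have [_ _ ee _] := eP j (IH j jn); exists (rnorm (T (e j)) ^+ 2)%:C%C.
have {}eP n := eP n (eig n).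
have oe : onseq e by apply: onseqI => n; have [] := eP n.
exists e, (fun n => rnorm (T (e n))); split=> //.
- move=> m n mn; have [_ _ _ h] := eP m.
  rewrite (le_trans (h (e n) _)) ?onseq_norm ?mulr1//; apply/perp_mkseq => j jm.
  by rewrite oe; case: eqP => // nj; move: (leq_trans jm mn); rewrite nj ltnn.
- by move=> n; have [] := eP n.
- by move=> n v /perp_mkseq; have [_ _ _] := eP n; apply.
Qed.

(** Lower half of min-max: the span of e_0, ..., e_n meets the complement of any n vectors in a unit
    vector, and orthogonality of the images makes T at least d there. *)
Lemma approx_lower T (e : nat -> H) n c d : onseq e -> 0 <= d ->
  (forall i j, i != j -> hdot (T (e i)) (T (e j)) = 0) ->
  (forall i, (i <= n)%N -> d <= rnorm (T (e i))) -> approx T n c -> d <= c.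
Proof.
move=> oe d0 Te dT [g gn gT].
have [|u [u1 gu]] := @span_meets_perp _ _ _ _ (iota 0 n.+1) g (onseq_iota n.+1 oe).
  by rewrite size_iota ltnS.
have := gT _ gu; rewrite u1 mulr1; apply: le_trans.
rewrite -(@ler_pXn2r _ 2) ?nnegrE// bop_sum.
under eq_bigr do rewrite bopZ.
rewrite rnorm2_sum_orthogonal ?iota_uniq//; last by move=> i j _ _; exact: Te.
have := rnorm2_sum_orthonormal u (onseq_iota n.+1 oe); rewrite u1 expr1n => u1'.
rewrite -[leLHS]mul1r u1' mulr_suml big_seq [leRHS]big_seq ler_sum// => i.
rewrite mem_iota add0n ltnS => /andP[_ ni]; rewrite ler_wpM2l ?sqr_ge0//.
by rewrite ler_pXn2r ?nnegrE// dT.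
Qed.

Section FixedSVD.
Context (T : bop H) (e : nat -> H) (s : nat -> R) (svdT : is_svd T e s).

Let oe : onseq e. Proof. by case: svdT. Qed.
Let s0 n : 0 <= s n. Proof. by case: svdT. Qed.

Lemma svd_hdot i j : hdot (T (e i)) (T (e j)) = (s i ^+ 2)%:C%C *+ (i == j).
Proof.
have [_ _ _ ee _] := svdT; rewrite -hdot_adjointl ee hdotZl oe.
by case: eqP; rewrite ?mulr1// mulr0.
Qed.

Lemma svd_norm n : rnorm (T (e n)) = s n.
Proof.
apply/eqP; rewrite -(@eqrXn2 _ 2)//; apply/eqP.
by rewrite -Re_hdotxx svd_hdot eqxx.
Qed.

Lemma svd_approx n : approx T n (s n).
Proof.
have [_ _ _ _ h] := svdT; exists (mkseq e n); first by rewrite size_mkseq.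
by move=> v /perp_mkseq; exact: h.
Qed.

Lemma svd_le n c : approx T n c -> s n <= c.
Proof.
apply: (approx_lower oe (s0 n)) => [i j ij|i ni].
  by rewrite svd_hdot (negbTE ij) mulr0n.
by rewrite svd_norm; case: svdT => _ _ sn _ _; exact: sn.
Qed.

Lemma svd_vanish c : compact_operator T -> 0 < c ->
  exists N, forall n, (N <= n)%N -> s n < c.
Proof.
move=> /compact_approx cT c0; have c20 : 0 < c / 2 by rewrite divr_gt0.
have [N aN] := cT _ c20; exists N => n Nn.
by apply: (@le_lt_trans _ _ (c / 2)); [apply/svd_le/(approxW Nn _ aN)|lra].
Qed.

End FixedSVD.

End SVD.

Section Limits.
Context (R : realType) (H : hilbertType R).
Implicit Types (u v : nat -> H) (x y l : H).

Definition tendsto u l :=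
  forall e : R, 0 < e -> exists N, forall n, (N <= n)%N -> rnorm (l - u n) < e.

Lemma tendsto_uniq u l l' : tendsto u l -> tendsto u l' -> l = l'.
Proof.
move=> ul ul'; apply/eqP; rewrite -subr_eq0; apply/eqP/rnorm_small => e e0.
have e20 : 0 < e / 2 by rewrite divr_gt0.
have [N NP] := ul _ e20; have [N' NP'] := ul' _ e20.
have := NP _ (leq_maxl N N'); have := NP' _ (leq_maxr N N').
move=> h1 h2; rewrite (le_trans (rnorm_tri (u (maxn N N')) _ _))// (rnormC (u _)).
lra.
Qed.

Lemma tendsto_linear a u v l l' : tendsto u l -> tendsto v l' ->
  tendsto (fun n => a *: u n + v n) (a *: l + l').
Proof.
move=> ul vl e e0; have e20 : 0 < e / 2 by rewrite divr_gt0.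
have a0 : 0 < cabs a + 1 by have := cabs_ge0 a; lra.
have [N NP] := ul _ (divr_gt0 e20 a0); have [N' NP'] := vl _ e20.
exists (maxn N N') => n; rewrite geq_max => /andP[/NP h1 /NP' h2].
rewrite opprD addrACA -scalerBr (le_lt_trans (rnormD _ _))// rnormZ.
move: h1; rewrite ltr_pdivlMr// => h1.
have := rnorm_ge0 (l - u n); nra.
Qed.

Lemma tendsto_le u l c : tendsto u l -> (forall n, rnorm (u n) <= c) -> rnorm l <= c.
Proof.
move=> ul uc; apply/ler_addgt0Pr => e e0.
have [N /(_ _ (leqnn N)) NP] := ul _ e0.
have := rnormBl l (u N); have := uc N; lra.
Qed.

Lemma tendsto_eventually u l N : (forall n, (N <= n)%N -> u n = l) -> tendsto u l.
Proof. by move=> uN e e0; exists N => n /uN ->; rewrite subrr rnorm0. Qed.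

End Limits.

Lemma nondecreasing_bounded_tail (R : realType) (a : nat -> R) (M : R) :
  {homo a : m n / (m <= n)%N >-> m <= n} -> (forall n, a n <= M) ->
  forall e, 0 < e -> exists N, forall m n, (N <= m)%N -> (m <= n)%N -> a n - a m < e.
Proof.
move=> ha aM e e0.
have supA : has_sup (range a) by split; [exists (a 0%N), 0%N|exists M => _ [n _ <-]].
have [_ [N _ <-] aN] : exists2 x, range a x & sup (range a) - e < x.
  by apply: sup_gt; [exact: supA.1|rewrite ltrBlDr ltrDl].
exists N => m n Nm mn; have := ha _ _ Nm.
have : a n <= sup (range a) by apply: ub_le_sup; [exact: supA.2|exists n].
by lra.
Qed.

(** * Operators diagonal along an orthonormal sequence *)

Section DiagonalOperators.
Context (R : realType) (H : hilbertType R).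
Implicit Types (S T W : bop H) (x y v w : H) (e : nat -> H) (m n : nat).

(** W x is the sum of the <x, e_n> g_n. The bound involves only the n at which x has a nonzero
    coefficient, so it yields both the operator norm and the decay off the first vectors. *)
Lemma diag_ex e (g : nat -> H) (M : R) : onseq e ->
  (forall i j, i != j -> hdot (g i) (g j) = 0) -> (forall n, rnorm (g n) <= M) ->
  exists W : bop H, (forall n, W (e n) = g n) /\
    forall x c, 0 <= c -> (forall n, hdot x (e n) != 0 -> rnorm (g n) <= c) ->
      rnorm (W x) <= c * rnorm x.
Proof.
move=> oe og gM; have M0 : 0 <= M by apply: le_trans (gM 0%N).
pose S x n := \sum_(i <- iota 0 n) hdot x (e i) *: g i.
have Sc x c n : 0 <= c -> (forall n, hdot x (e n) != 0 -> rnorm (g n) <= c) ->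
    rnorm (S x n) <= c * rnorm x.
  move=> c0 gc; rewrite -(@ler_pXn2r _ 2) ?nnegrE ?mulr_ge0//.
  rewrite rnorm2_sum_orthogonal ?iota_uniq// => [|i j _ _]; last exact: og.
  rewrite exprMn (le_trans _ (ler_wpM2l (sqr_ge0 c) (bessel x (onseq_iota n oe))))//.
  rewrite mulr_sumr ler_sum// => i _; rewrite [leRHS]mulrC.
  have [->|/gc xg] := eqVneq (hdot x (e i)) 0; first by rewrite cabs0 expr0n !mul0r.
  by rewrite ler_wpM2l ?sqr_ge0// ler_pXn2r ?nnegrE.
have /choice[W0 WP] x : exists l, tendsto (S x) l.
  apply: rnorm_cauchy => d d0.
  pose a n := \sum_(i <- iota 0 n) cabs (hdot x (e i)) ^+ 2.
  have aE m n : (m <= n)%N -> a n = a m + \sum_(i <- iota m (n - m)) cabs (hdot x (e i)) ^+ 2.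
    by move=> mn; rewrite /a -{1}(subnKC mn) iotaD big_cat.
  have [] := @nondecreasing_bounded_tail _ a (rnorm x ^+ 2) _ _ (d ^+ 2 / (M ^+ 2 + 1)).
  - by move=> m n mn; rewrite (aE _ _ mn) lerDl sumr_ge0// => i _; exact: sqr_ge0.
  - by move=> n; exact: bessel (onseq_iota n oe).
  - by rewrite divr_gt0 ?exprn_gt0//; have := sqr_ge0 M; lra.
  move=> N NP; exists N.
  have key m n : (N <= m)%N -> (m <= n)%N -> rnorm (S x n - S x m) < d.
    move=> Nm mn; rewrite /S -{1}(subnKC mn) iotaD big_cat /= add0n [X in X - _]addrC addrK.
    rewrite -(@ltr_pXn2r _ 2) ?nnegrE ?(ltW d0)//.
    rewrite rnorm2_sum_orthogonal ?iota_uniq// => [|i j _ _]; last exact: og.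
    have := NP _ _ Nm mn; rewrite (aE _ _ mn) [X in X - _]addrC addrK.
    rewrite ltr_pdivlMr; last by have := sqr_ge0 M; lra.
    apply: le_lt_trans; rewrite mulr_suml ler_sum// => i _.
    rewrite ler_wpM2l ?sqr_ge0//.
    have : rnorm (g i) ^+ 2 <= M ^+ 2 by rewrite ler_pXn2r ?nnegrE.
    lra.
  move=> n m Nn Nm; case: (leqP m n) => mn; first exact: key.
  by rewrite rnormC; apply: key => //; exact: ltnW.
have lW : linear W0.
  move=> a x y; apply: (tendsto_uniq (WP _)).
  suff -> : S (a *: x + y) = (fun n => a *: S x n + S y n) by exact: tendsto_linear.
  apply/funext => n; rewrite /S scaler_sumr -big_split /=; apply: eq_bigr => i _.
  by rewrite hdot_linearl scalerDl scalerA.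
have Wc x c : 0 <= c -> (forall n, hdot x (e n) != 0 -> rnorm (g n) <= c) ->
    rnorm (W0 x) <= c * rnorm x.
  by move=> c0 gc; apply: (tendsto_le (WP x)) => n; exact: Sc.
have bW : exists M : R, forall x, rnorm (W0 x) <= M * rnorm x.
  by exists M => x; apply: Wc => // n _.
exists (Bop (bounded_operatorI lW bW)); split=> // n /=.
apply: (tendsto_uniq (WP _)); apply: (@tendsto_eventually _ _ _ _ n.+1) => k nk.
rewrite /S (bigD1_seq n) ?iota_uniq ?mem_iota//= oe eqxx scale1r big1 ?addr0// => i ni.
by rewrite oe eq_sym (negbTE ni) scale0r.
Qed.

(** It says that S is the norm limit of its compositions with the projections on e_0, ..., e_(N-1).
    Hence S kills the complement of all the e_n, is compact, and is determined by the S e_n. *)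
Definition vanishing e S := forall d : R, 0 < d ->
  exists N, forall v, (forall j, (j < N)%N -> hdot v (e j) = 0) -> rnorm (S v) <= d * rnorm v.

Lemma vanishing_eq e S T : onseq e -> vanishing e S -> vanishing e T ->
  (forall n, S (e n) = T (e n)) -> S = T.
Proof.
move=> oe vS vT ST; apply: bopP => x; apply/eqP; rewrite -subr_eq0.
apply/eqP/rnorm_small => d d0.
have x0 : 0 < rnorm x + 1 by have := rnorm_ge0 x; lra.
have d20 : 0 < d / 2 / (rnorm x + 1) by rewrite !divr_gt0.
have [N NP] := vS _ d20; have [N' NP'] := vT _ d20.
pose r := iota 0 (maxn N N'); pose y := x - proj e r x.
have yj j : (j < maxn N N')%N -> hdot y (e j) = 0.
  by move=> jN; apply: proj_perp; [exact: onseq_iota|rewrite mem_iota].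
have -> : S x - T x = S y - T y.
  have Sp : S (proj e r x) = T (proj e r x).
    by rewrite !bop_sum; apply: eq_bigr => i _; rewrite !bopZ ST.
  by rewrite /y !bopB Sp opprB addrA subrK.
rewrite (le_trans (rnormB _ _))//.
have h1 : rnorm (S y) <= d / 2 / (rnorm x + 1) * rnorm y.
  by apply: NP => j jN; apply/yj/(leq_trans jN)/leq_maxl.
have h2 : rnorm (T y) <= d / 2 / (rnorm x + 1) * rnorm y.
  by apply: NP' => j jN; apply/yj/(leq_trans jN)/leq_maxr.
have yx : rnorm y <= rnorm x by exact/rnorm_proj_compl/onseq_iota.
have h3 : d / 2 / (rnorm x + 1) * rnorm y <= d / 2.
  rewrite -mulrA ler_piMr ?divr_ge0 ?(ltW d0)// mulrC ler_pdivrMr//; lra.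
lra.
Qed.

Lemma vanishing_compl e S T : vanishing e T -> vanishing e (bop_comp S T).
Proof.
move=> vT d d0; have S0 : 0 < nop S + 1 by have := nop_ge0 S; lra.
have [N NP] := vT _ (divr_gt0 d0 S0); exists N => v /NP h.
rewrite bop_compE (le_trans (rnorm_bop _ _))//.
move: h; rewrite mulrAC ler_pdivlMr// => h.
have := rnorm_ge0 (T v); nra.
Qed.

Lemma vanishing_compact e S : vanishing e S -> compact_operator S.
Proof.
move=> vS; apply/compact_approx => d d0; have [N NP] := vS _ d0.
exists N, (mkseq e N); first by rewrite size_mkseq.
by move=> v /perp_mkseq; exact: NP.
Qed.

Lemma svd_vanishing T e s : compact_operator T -> is_svd T e s -> vanishing e T.
Proof.
move=> cT sT d d0; have [N NP] := svd_vanish sT cT d0; exists N => v vN.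
have [_ _ _ _ h] := sT; rewrite (le_trans (h _ _ vN))// ler_wpM2r//.
exact/ltW/NP.
Qed.

Lemma diag_vanishing e (g : nat -> H) : onseq e ->
  (forall i j, i != j -> hdot (g i) (g j) = 0) ->
  (forall d, 0 < d -> exists N, forall n, (N <= n)%N -> rnorm (g n) <= d) ->
  exists W : bop H, [/\ forall n, W (e n) = g n, vanishing e W &
    forall x c, 0 <= c -> (forall n, hdot x (e n) != 0 -> rnorm (g n) <= c) ->
      rnorm (W x) <= c * rnorm x].
Proof.
move=> oe og gv; have [N NP] := gv 1 ltr01.
have gM n : rnorm (g n) <= 1 + \sum_(i < N) rnorm (g i).
  case: (ltnP n N) => nN; last by rewrite (le_trans (NP _ nN))// lerDl sumr_ge0.
  rewrite ler_wpDl// (bigD1 (Ordinal nN))//= lerDl sumr_ge0 //.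
have [W [We Wc]] := diag_ex oe og gM; exists W; split=> // d d0.
have [K KP] := gv _ d0; exists K => v vK; apply: Wc; first exact: ltW.
by move=> n vn; apply: KP; rewrite leqNgt; apply: contra vn => /vK ->.
Qed.

End DiagonalOperators.

(** * Dimension and sequences determined by multiplicities *)

Section Dimension.
Context (R : realType) (V : lmodType R[i]).

Lemma lin_span_le k l (b : 'I_k -> V) (b' : 'I_l -> V) :
  lin_indep b -> (forall i, lin_span b' (b i)) -> (k <= l)%N.
Proof.
move=> ib /choice[M bM]; rewrite leqNgt; apply/negP => lk.
pose N := \matrix_(i < k, j < l) M i j.
have : kermx N != 0.
  by rewrite kermx_eq0 /row_free neq_ltn (leq_ltn_trans (rank_leq_col N)).
move=> /rowV0Pn[u /sub_kermxP uN u0]; case/negP: u0; apply/eqP/rowP => i; rewrite mxE.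
apply: (ib (fun i => u 0 i)) => {i}.
under eq_bigr do rewrite bM scaler_sumr.
rewrite exchange_big big1//= => j _.
under eq_bigr do rewrite scalerA.
rewrite -scaler_suml [X in X *: _](_ : _ = 0) ?scale0r//.
have /matrixP/(_ 0 j) := uN; rewrite !mxE => h; rewrite -[RHS]h.
by apply: eq_bigr => i _; rewrite mxE.
Qed.

Lemma has_dim_uniq (E : set V) k l : has_dim E k -> has_dim E l -> k = l.
Proof.
have mem m (b : 'I_m -> V) i : lin_span b (b i).
  exists (fun j => (j == i)%:R); rewrite (bigD1 i)//= eqxx scale1r big1 ?addr0// => j.
  by move=> /negbTE ->; rewrite scale0r.
move=> [b [ib Eb]] [b' [ib' Eb']]; apply/eqP; rewrite eqn_leq; apply/andP; split.
  by apply: (lin_span_le (b' := b') ib) => i; have := mem k b i; rewrite -Eb Eb'.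
by apply: (lin_span_le (b' := b) ib') => i; have := mem l b' i; rewrite -Eb' Eb.
Qed.

End Dimension.

Lemma card_uniq_seq (s : seq nat) : uniq s -> ([set` s] #= `I_(size s))%card.
Proof.
move=> us; apply/card_esym/card_set_bijP; exists (nth 0%N s); split.
- by move=> i /= si; rewrite mem_nth.
- by move=> i j; rewrite !inE /= => si sj /eqP; rewrite nth_uniq// => /eqP.
- by move=> j /= js; exists (index j s) => /=; rewrite ?index_mem// nth_index.
Qed.

(** At the first difference, say a_n < b_n, the fiber of a over b_n lies in the common part below n,
    while that of b contains the same indices and n as well, so the finite cardinalities differ. *)
Lemma fiber_eq_noninc (R : realType) (s t : nat -> R) :
  (forall n, 0 <= s n) -> (forall n, 0 <= t n) ->
  (forall m n, (m <= n)%N -> s n <= s m) -> (forall m n, (m <= n)%N -> t n <= t m) ->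
  (forall l, 0 < l -> exists k, ([set n | s n = l] #= `I_k)%card /\
     ([set n | t n = l] #= `I_k)%card) -> s = t.
Proof.
move=> s0 t0 hs ht st; apply/funext => n; elim/ltn_ind: n => n IH.
suff half (a b : nat -> R) : (forall n, 0 <= a n) -> (forall m n, (m <= n)%N -> a n <= a m) ->
    (forall m, (m < n)%N -> a m = b m) ->
    (forall l, 0 < l -> exists k, ([set n | a n = l] #= `I_k)%card /\
     ([set n | b n = l] #= `I_k)%card) -> ~ a n < b n.
  case: (ltgtP (s n) (t n)) => // h; exfalso; first exact: (half s t) h.
  apply: (half t s) h => // [m /IH ->//|l /st[k [h1 h2]]]; by exists k.
move=> a0 ha ab fib abn; have [|k [ak bk]] := fib (b n); first exact: le_lt_trans abn.
pose F := [seq j <- iota 0 n | b j == b n].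
have aF : [set j | a j = b n] = [set` F].
  apply/seteqP; split => j /=.
    rewrite mem_filter mem_iota add0n => ajn.
    have jn : (j < n)%N by rewrite ltnNge; apply/negP => /ha; rewrite ajn leNgt abn.
    by rewrite jn -ajn ab// eqxx.
  by rewrite mem_filter mem_iota add0n => /andP[/eqP <- /andP[_ jn]]; rewrite ab.
have kF : k = size F.
  apply/card_eq_II; apply: card_eq_trans (card_esym ak) _.
  by rewrite aF; apply: card_uniq_seq; rewrite filter_uniq// iota_uniq.
have uF : uniq (n :: F).
  by rewrite /= filter_uniq ?iota_uniq// mem_filter mem_iota add0n ltnn !andbF.
have : (`I_(size F).+1 #<= `I_k)%card.
  rewrite -(card_le_eqr bk) -(card_le_eql (card_uniq_seq uF)).
  apply: subset_card_le => j /=; rewrite inE => /predU1P[->//|].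
  by rewrite mem_filter => /andP[/eqP].
by rewrite card_le_II kF ltnn.
Qed.

(** * Identification of the singular values *)

Section SingularValues.
Context (R : realType) (H : hilbertType R).
Implicit Types (S T W A : bop H) (x y v w : H) (e : nat -> H) (s : nat -> R) (m n : nat).

Lemma ge0_closed (z : R[i]) :
  (forall d : R, 0 < d -> exists2 w, 0 <= w & cabs (z - w) <= d) -> 0 <= z.
Proof.
move=> h.
have im (w : R[i]) : `|complex.Im w| <= cabs w.
  by rewrite /cabs normc_def /= -sqrtr_sqr ler_wsqrtr// lerDr sqr_ge0.
rewrite lecE /=; apply/andP; split.
  rewrite -normr_le0; apply/ler_addgt0Pr => d /h[w w0]; rewrite add0r; apply: le_trans.
  by apply: le_trans (im _); rewrite raddfB /= (ger0_Im w0) subr0.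
apply/ler_addgt0Pr => d /h[w]; rewrite lecE => /andP[_ /= w0] zw.
have : - complex.Re (z - w) <= d.
  apply: le_trans zw; have := normc_ge_Re (z - w); rewrite cabsE lecR; apply: le_trans.
  by rewrite -normrN ler_norm.
rewrite raddfB /=; lra.
Qed.

(** The root is diagonal, with entries s_n along the right singular vectors. Its square agrees with
    adjoint T composed with T on each e_n, and [vanishing_eq] extends the equality; positivity
    passes to the limit from finite sums. *)
Lemma absop_ex T : infinite_dimensional H -> compact_operator T ->
  exists A : bop H, positive_operator A /\ bop_comp A A = bop_comp (adjoint T) T.
Proof.
move=> infH cT; have [e [s sT]] := svd_ex infH cT.
have [oe s0 sn ee _] := sT.
have [||A [Ae vA _]] := @diag_vanishing _ _ e (fun n => (s n)%:C%C *: e n) oe.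
- by move=> i j /negbTE ij; rewrite hdotZl hdotZr oe ij !mulr0.
- move=> d d0; have [N NP] := svd_vanish sT cT d0; exists N => n /NP h.
  by rewrite rnormZ onseq_norm// mulr1 cabsR ger0_norm// ltW.
exists A; split; last first.
  apply: (vanishing_eq oe); [exact: vanishing_compl| |].
    by apply: vanishing_compl; exact: svd_vanishing sT.
  by move=> n; rewrite !bop_compE Ae bopZ Ae scalerA -rmorphM ee expr2.
move=> x; apply: ge0_closed => d d0.
have x0 : 0 < rnorm x ^+ 2 + 1 by have := sqr_ge0 (rnorm x); lra.
have [N NP] := vA _ (divr_gt0 d0 x0).
pose y := proj e (iota 0 N) x.
exists (hdot (A y) x).
  rewrite /y bop_sum hdot_suml; apply: sumr_ge0 => i _.
  rewrite bopZ Ae !hdotZl [hdot (e i) x]hdot_conj mulrCA mulJ_cabs -rmorphM /= ler0c.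
  by rewrite mulr_ge0// sqr_ge0.
rewrite -hdotBl -bopB (le_trans (cauchy_schwarz _ _))//.
have h1 : rnorm (A (x - y)) <= d / (rnorm x ^+ 2 + 1) * rnorm (x - y).
  apply: NP => j jN; apply: proj_perp; first exact: onseq_iota.
  by rewrite mem_iota.
have h2 : rnorm (x - y) <= rnorm x by exact/rnorm_proj_compl/onseq_iota.
have h3 : d / (rnorm x ^+ 2 + 1) * (rnorm x ^+ 2) <= d.
  by rewrite mulrAC ler_pdivrMr//; lra.
apply: le_trans h3; rewrite expr2 mulrA ler_wpM2r// (le_trans h1)// ler_wpM2l//.
by rewrite divr_ge0 ?ltW.
Qed.

Lemma absopP T : infinite_dimensional H -> compact_operator T ->
  positive_operator (absop T) /\ bop_comp (absop T) (absop T) = bop_comp (adjoint T) T.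
Proof.
move=> infH cT; have [A AP] := absop_ex infH cT; rewrite /absop.
by case: xgetP => [B _ //|/(_ A)].
Qed.

(** Let A be whichever positive root [xget] has chosen. If A^2 v = l^2 v, then w = A v - l v
    satisfies A w = - l w, and positivity of A forces w = 0. *)
Lemma absop_eigenspace T l : infinite_dimensional H -> compact_operator T -> 0 < l ->
  op_eigenspace (absop T) l = [set v | adjoint T (T v) = (l ^+ 2)%:C%C *: v].
Proof.
move=> infH cT l0; have [pA AA] := absopP infH cT; set A := absop T in pA AA *.
have AE v : adjoint T (T v) = A (A v) by rewrite -[RHS]/(bop_comp A A v) AA.
apply/seteqP; split => v /= Av; first by rewrite AE Av bopZ Av scalerA -rmorphM expr2.
pose w := A v - l%:C%C *: v.
have Aw : A w = - (l%:C%C *: w).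
  rewrite /w bopB -AE Av bopZ scalerBr opprB scalerA -rmorphM -expr2 //.
have := pA w; rewrite Aw hdotNl hdotZl hdotxx -rmorphM -rmorphN ler0c => h.
have : w = 0.
  apply/eqP; rewrite -rnorm_eq0 -sqrf_eq0 eq_le sqr_ge0 andbT.
  by rewrite -(ler_pM2l l0) mulr0 -oppr_ge0.
by move=> /eqP; rewrite subr_eq0 => /eqP.
Qed.

(** The e_j with s_j = l span the eigenspace: the remaining part y of an eigenvector is orthogonal
    to every e_j, the tail bounds give T y = 0, and then l^2 y = 0. *)
Lemma svd_eigenspace T e s l : infinite_dimensional H -> compact_operator T ->
  is_svd T e s -> 0 < l -> exists k,
    has_dim (op_eigenspace (absop T) l) k /\ ([set n | s n = l] #= `I_k)%card.
Proof.
move=> infH cT sT l0; have [oe s0 sn ee _] := sT.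
have [N NP] := svd_vanish sT cT l0.
pose ks := [seq j <- iota 0 N | s j == l].
have uks : uniq ks by rewrite filter_uniq// iota_uniq.
have ksE j : (j \in ks) = (s j == l).
  rewrite mem_filter mem_iota add0n /= andbC; case: eqP => [sj|]; rewrite ?andbF// andbT.
  by rewrite ltnNge; apply/negP => /NP; rewrite sj ltxx.
exists (size ks); split; last first.
  rewrite (_ : [set n | s n = l] = [set` ks]); first exact: card_uniq_seq.
  by apply/seteqP; split=> j /=; rewrite ksE => /eqP.
have oks := onseq_orthonormal oe uks.
rewrite absop_eigenspace//; apply: (orthonormal_has_dim oks) => v; split=> /= [vl|->]; last first.
  rewrite !bop_sum scaler_sumr; apply: eq_big_seq => i; rewrite ksE => /eqP si.
  by rewrite !bopZ ee si scalerA mulrC -scalerA.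
pose y := v - proj e ks v.
suff y0 : y = 0 by apply/eqP; rewrite -subr_eq0 -/y y0.
have eigy : adjoint T (T y) = (l ^+ 2)%:C%C *: y.
  rewrite /y !bopB vl scalerBr; congr (_ - _); rewrite !bop_sum scaler_sumr.
  apply: eq_big_seq => i; rewrite ksE => /eqP si.
  by rewrite !bopZ ee si scalerA mulrC -scalerA.
have yj j : hdot y (e j) = 0.
  have [jks|jks] := boolP (j \in ks); first exact: proj_perp.
  have : hdot (adjoint T (T y)) (e j) = hdot y (adjoint T (T (e j))).
    by rewrite hdot_adjointl hdot_adjoint.
  rewrite eigy ee hdotZl hdotZr conj_Creal ?complex_real// => /eqP.
  rewrite -subr_eq0 -mulrBl mulf_eq0 => /orP[|/eqP//].
  rewrite -rmorphB /= => /eqP/(congr1 (@complex.Re R))/eqP /=.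
  rewrite subr_eq0 eqrXn2// ?(ltW l0)// => /eqP ls.
  by move: jks; rewrite ksE ls eqxx.
have Ty : T y = 0.
  apply: rnorm_small => d d0; have y0 : 0 < rnorm y + 1 by have := rnorm_ge0 y; lra.
  have [M MP] := svd_vanishing cT sT (divr_gt0 d0 y0).
  have h := MP y (fun j _ => yj j).
  rewrite (le_trans h)// mulrAC ler_pdivrMr//; have := rnorm_ge0 y; nra.
move: eigy; rewrite Ty bop0 => /esym/eqP; rewrite scaler_eq0 => /orP[|/eqP//].
move=> /eqP/(congr1 (@complex.Re R))/eqP /=.
by rewrite sqrf_eq0 (gt_eqF l0).
Qed.

(** Both s and the sequence chosen by [xget] have fibers over l > 0 counted by the dimension of the
    same eigenspace. *)
Lemma svd_singular_values T e s : infinite_dimensional H -> compact_operator T ->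
  is_svd T e s -> singular_values T = s.
Proof.
move=> infH cT sT; have [_ s0 sn _ _] := sT.
have isT : is_singular_values T s by split=> // l; exact: (svd_eigenspace infH cT sT).
rewrite /singular_values; case: xgetP => [t _ [t0 tn tl]|/(_ s)//].
apply: fiber_eq_noninc => // l l0.
have [k [dk tk]] := tl l l0; have [_ _ /(_ l l0)[k' [dk' sk']]] := isT.
by exists k; split=> //; rewrite (has_dim_uniq dk dk').
Qed.

Lemma singular_valuesP T : infinite_dimensional H -> compact_operator T ->
  exists e, is_svd T e (singular_values T).
Proof.
move=> infH cT; have [e [s sT]] := svd_ex infH cT.
by exists e; rewrite (svd_singular_values infH cT sT).
Qed.

End SingularValues.

(** * Schatten norms *)

Section CompactClosure.
Context (R : realType) (H : hilbertType R).
Implicit Types (S T : bop H).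

Lemma compact_compl S T : compact_operator T -> compact_operator (bop_comp S T).
Proof.
move=> /compact_approx cT; apply/compact_approx => d d0.
have S0 : 0 < nop S + 1 by have := nop_ge0 S; lra.
have [n aT] := cT _ (divr_gt0 d0 S0); exists n.
apply: approxW (leqnn n) _ (approx_compl S aT).
rewrite mulrCA ler_piMr ?(ltW d0)// ler_pdivrMr//; lra.
Qed.

Lemma compact_adjoint T : compact_operator T -> compact_operator (adjoint T).
Proof.
move=> /compact_approx cT; apply/compact_approx => d d0; have [n aT] := cT _ d0.
by exists n; apply: approx_adjoint => //; exact: ltW.
Qed.

Lemma compact_compr S T : compact_operator S -> compact_operator (bop_comp S T).
Proof.
move=> cS; rewrite -[bop_comp S T]adjointK adjoint_comp.
by apply/compact_adjoint/compact_compl/compact_adjoint.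
Qed.

Lemma compact_rank1 (u v : H) : compact_operator (rank1 u v).
Proof.
apply/compact_approx => d d0; exists 1%N.
exact: approxW (leqnn _) (ltW d0) (approx_rank1 u v).
Qed.

End CompactClosure.

Section SingularValueInequalities.
Context (R : realType) (H : hilbertType R) (infH : infinite_dimensional H).
Implicit Types (S T : bop H) (n m : nat) (c d : R).

Local Notation sv := singular_values.

Lemma sv_ge0 T n : compact_operator T -> 0 <= sv T n.
Proof. by move=> /(singular_valuesP infH)[e []]. Qed.

Lemma sv_noninc T m n : compact_operator T -> (m <= n)%N -> sv T n <= sv T m.
Proof. by move=> /(singular_valuesP infH)[e [_ _ h _ _]]; exact: h. Qed.

Lemma sv_approx T n : compact_operator T -> approx T n (sv T n).
Proof. by move=> /(singular_valuesP infH)[e sT]; exact: svd_approx sT n. Qed.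

Lemma sv_le T n c : compact_operator T -> approx T n c -> sv T n <= c.
Proof. by move=> /(singular_valuesP infH)[e sT] a; exact: (svd_le sT a). Qed.

Lemma sv_vanish T c : compact_operator T -> 0 < c ->
  exists N, forall n, (N <= n)%N -> sv T n < c.
Proof.
by move=> cT c0; have [e sT] := singular_valuesP infH cT; exact: (svd_vanish sT cT c0).
Qed.

Lemma sv_compl S T n : compact_operator T -> sv (bop_comp S T) n <= nop S * sv T n.
Proof.
by move=> cT; apply: sv_le; [exact: compact_compl|exact/approx_compl/sv_approx].
Qed.

Lemma sv_comp S T m n : compact_operator S -> compact_operator T ->
  sv (bop_comp S T) (m + n)%N <= sv S m * sv T n.
Proof.
move=> cS cT; apply: sv_le; first exact: compact_compl.
by apply: approx_comp; [exact: sv_ge0|exact: sv_approx|exact: sv_approx].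
Qed.

Lemma sv_adjoint T : compact_operator T -> sv (adjoint T) = sv T.
Proof.
move=> cT; apply/funext => n; apply/eqP; rewrite eq_le.
have half S : compact_operator S -> sv (adjoint S) n <= sv S n.
  move=> cS; apply: sv_le; first exact: compact_adjoint.
  by apply: approx_adjoint; [exact: sv_ge0|exact: sv_approx].
rewrite half//= -{1}(adjointK T); apply: half; exact: compact_adjoint.
Qed.

Lemma sv_nop T : compact_operator T -> sv T 0 = nop T.
Proof.
move=> cT; apply/eqP; rewrite eq_le; apply/andP; split.
  by apply: sv_le => //; exact: approx_nop.
apply: nop_le => [|x]; first exact: sv_ge0.
have [g] := sv_approx 0 cT; rewrite leqn0 => /nilP -> h; exact: h.
Qed.

Lemma sv_le_nop T n : compact_operator T -> sv T n <= nop T.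
Proof. by move=> cT; rewrite -sv_nop//; exact: sv_noninc. Qed.

Lemma sv_rank1 (u v : H) n : sv (rank1 u v) n.+1 = 0.
Proof.
have c1 : compact_operator (rank1 u v) by exact: compact_rank1.
apply/eqP; rewrite eq_le sv_ge0// andbT.
apply: sv_le => //; exact: approxW (approx_rank1 u v).
Qed.

End SingularValueInequalities.

Section Schatten.
Context (R : realType) (H : hilbertType R) (infH : infinite_dimensional H).
Implicit Types (S T : bop H) (n m : nat) (c d r : R) (p : \bar R).

Local Notation sv := singular_values.

(** The working form of the finite Schatten norms: extended series and roots are traded for bounds
    on real partial sums. *)
Lemma schatten_leP r T c : 1 <= r -> 0 <= c ->
  (schatten_norm r%:E T <= c%:E)%E <-> (forall n, \sum_(k < n) (sv T k) `^ r <= c `^ r).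
Proof.
move=> r1 c0; have r0 : 0 < r by lra.
have f0 k : (0 <= ((sv T k) `^ r)%:E)%E by rewrite lee_fin powR_ge0.
have s0 : (0 <= \sum_(0 <= n <oo) ((sv T n) `^ r)%:E)%E by apply: nneseries_ge0.
have cr : (c%:E = poweR (c `^ r)%:E r^-1)%E.
  by rewrite poweR_EFin -powRrM mulfV ?gt_eqF// powRr1.
have itv (x : \bar R) : (0 <= x)%E -> x \in `[0%E, +oo%E] by rewrite in_itv /= leey andbT.
rewrite /= cr; apply: (iff_trans (B := (\sum_(0 <= n <oo) ((sv T n) `^ r)%:E <= (c `^ r)%:E)%E)).
  split; last first.
    apply: gt0_ler_poweR; rewrite ?invr_ge0 ?(ltW r0)//; apply: itv => //.
    by rewrite lee_fin powR_ge0.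
  move=> h; have : (poweR (poweR (\sum_(0 <= n <oo) ((sv T n) `^ r)%:E) r^-1) r
      <= poweR (poweR (c `^ r)%:E r^-1) r)%E.
    by apply: gt0_ler_poweR; rewrite ?(ltW r0)//; apply: itv; rewrite poweR_ge0.
  rewrite -!poweRrM mulVf ?gt_eqF// !poweRe1//.
  by rewrite lee_fin powR_ge0.
split=> [h n|h].
  rewrite -lee_fin -sumEFin (le_trans _ h)// -(big_mkord xpredT (fun k => ((sv T k) `^ r)%:E)).
  exact: nneseries_lim_ge.
apply: lime_le; first exact: is_cvg_nneseries.
by apply: nearW => n; rewrite big_mkord sumEFin lee_fin; exact: h.
Qed.

Lemma schatten_pinfty T : schatten_norm +oo%E T = (nop T)%:E.
Proof. exact: opnormE. Qed.

Lemma schatten_ge0 p T : (0 <= schatten_norm p T)%E.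
Proof.
by case: p => [r| |]; rewrite /schatten_norm ?poweR_ge0// opnormE lee_fin nop_ge0.
Qed.

Lemma schatten_idealP p T : schatten_ideal p T <->
  compact_operator T /\ exists2 c, 0 <= c & (schatten_norm p T <= c%:E)%E.
Proof.
split=> [[cT pT]|[cT [c c0 pT]]]; split=> //; last exact: le_lt_trans (ltry c).
exists (fine (schatten_norm p T)); first exact/fine_ge0/schatten_ge0.
by rewrite fineK// ge0_fin_numE// schatten_ge0.
Qed.

Lemma schatten_cases p : (1 <= p)%E -> p = +oo%E \/ exists2 r : R, 1 <= r & p = r%:E.
Proof. by case: p => [r| |] // p1; [right; exists r|left]. Qed.

Lemma schatten_scale p S T (M c : R) : (1 <= p)%E -> compact_operator S ->
  compact_operator T -> 0 <= M -> 0 <= c -> (forall n, sv S n <= M * sv T n) ->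
  (schatten_norm p T <= c%:E)%E -> (schatten_norm p S <= (M * c)%:E)%E.
Proof.
move=> /schatten_cases[->|[r r1 ->]] cS cT M0 c0 ST.
  rewrite !schatten_pinfty !lee_fin -!sv_nop// => Tc.
  by rewrite (le_trans (ST _))// ler_wpM2l.
move=> /(schatten_leP _ r1 c0) h; apply/(schatten_leP _ r1 (mulr_ge0 M0 c0)) => n.
rewrite (powRM _ M0 c0); apply: (le_trans _ (ler_wpM2l (powR_ge0 _ _) (h n))).
rewrite mulr_sumr; apply: ler_sum => k _.
rewrite -powRM// ?sv_ge0// ge0_ler_powR ?nnegrE ?mulr_ge0 ?sv_ge0//; lra.
Qed.

Lemma schatten_compl p S T c : (1 <= p)%E -> compact_operator T -> 0 <= c ->
  (schatten_norm p T <= c%:E)%E -> (schatten_norm p (bop_comp S T) <= (nop S * c)%:E)%E.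
Proof.
move=> p1 cT c0; apply: schatten_scale => //; [exact: compact_compl|exact: nop_ge0|].
by move=> n; exact: sv_compl.
Qed.

Lemma schatten_adjoint p T : compact_operator T ->
  schatten_norm p (adjoint T) = schatten_norm p T.
Proof.
move=> cT; case: p => [r| |].
- by rewrite /schatten_norm (sv_adjoint infH cT).
- by rewrite /schatten_norm !opnormE nop_adjoint.
- by rewrite /schatten_norm !opnormE nop_adjoint.
Qed.

Lemma schatten_compr p S T c : (1 <= p)%E -> compact_operator S -> 0 <= c ->
  (schatten_norm p S <= c%:E)%E -> (schatten_norm p (bop_comp S T) <= (nop T * c)%:E)%E.
Proof.
move=> p1 cS c0 Sc; rewrite -schatten_adjoint; last exact: compact_compr.
rewrite adjoint_comp -nop_adjoint; apply: schatten_compl => //.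
  exact: compact_adjoint.
by rewrite schatten_adjoint.
Qed.

Lemma nop_le_schatten p T c : (1 <= p)%E -> compact_operator T -> 0 <= c ->
  (schatten_norm p T <= c%:E)%E -> nop T <= c.
Proof.
move=> /schatten_cases[->|[r r1 ->]] cT c0; first by rewrite schatten_pinfty lee_fin.
have r0 : 0 < r by lra.
move=> /(schatten_leP _ r1 c0)/(_ 1%N); rewrite big_ord1 sv_nop// => h.
rewrite leNgt; apply/negP => cn; move: h; rewrite leNgt; apply/negP/negPn.
by rewrite gt0_ltr_powR// nnegrE ?nop_ge0.
Qed.

Lemma schatten_rank1 p (u v : H) : (1 <= p)%E ->
  (schatten_norm p (rank1 u v) <= (rnorm u * rnorm v)%:E)%E.
Proof.
move=> /schatten_cases[->|[r r1 ->]]; first by rewrite schatten_pinfty nop_rank1.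
have r0 : 0 < r by lra.
apply/schatten_leP; rewrite ?mulr_ge0// => -[|n]; first by rewrite big_ord0 powR_ge0.
rewrite big_ord_recl big1 ?addr0 => [|i _]; last by rewrite /= sv_rank1// powR0// gt_eqF.
by rewrite sv_nop ?nop_rank1//; exact: compact_rank1.
Qed.

Lemma schatten_ideal_rank1 p (u v : H) : (1 <= p)%E -> schatten_ideal p (rank1 u v).
Proof.
move=> p1; apply/schatten_idealP; split; first exact: compact_rank1.
by exists (rnorm u * rnorm v); [rewrite mulr_ge0|exact: schatten_rank1].
Qed.

Lemma schatten_ideal_adjoint p T : schatten_ideal p T -> schatten_ideal p (adjoint T).
Proof.
by move=> [cT Tp]; split; [exact: compact_adjoint|rewrite schatten_adjoint].
Qed.

End Schatten.

(** * Domination of the seminorms for different exponents *)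

Section RealSequences.
Context (R : realType).
Implicit Types (f d s : nat -> R).

(** [sv_comp] with m = n controls the even indices only; monotonicity recovers the odd ones at the
    cost of the factor 2. *)
Lemma sum_even_double f N : (forall n, 0 <= f n) -> (forall m n, (m <= n)%N -> f n <= f m) ->
  \sum_(k < N) f k <= 2 * \sum_(n < N) f (n + n)%N.
Proof.
move=> f0 fn; apply: (@le_trans _ _ (\sum_(k < N + N) f k)).
  by rewrite big_split_ord /= lerDl sumr_ge0.
elim: N => [|N IH]; first by rewrite !big_ord0 mulr0.
rewrite addnS addSn !big_ord_recr /= mulrDr.
have := fn (N + N)%N (N + N).+1 (leqnSn _); lra.
Qed.

Lemma seq_argmax d (l : seq nat) k0 :
  exists2 k, k \in k0 :: l & forall j, j \in k0 :: l -> d j <= d k.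
Proof.
elim: l k0 => [|a l IH] k0; first by exists k0 => [|j]; rewrite inE // => /eqP ->.
have [k kl kP] := IH a; have [kk0|k0k] := leP (d k) (d k0).
  exists k0; rewrite ?inE ?eqxx// => j; rewrite inE => /predU1P[->//|/kP h].
  exact: le_trans h kk0.
exists k; first by rewrite inE kl orbT.
by move=> j; rewrite inE => /predU1P[->|/kP//]; exact: ltW.
Qed.

(** If some value outside l is positive, only finitely many indices can exceed it; otherwise all of
    them are 0 and any fresh index works. *)
Lemma vanishing_argmax d (l : seq nat) : (forall n, 0 <= d n) ->
  (forall c, 0 < c -> exists N, forall n, (N <= n)%N -> d n <= c) ->
  exists2 k, k \notin l & forall j, j \notin l -> d j <= d k.
Proof.
move=> d0 dv.
have [h|/existsNP[k0 /not_implyP[k0l /negP k0P]]] := pselect (forall j, j \notin l -> d j <= 0).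
  exists (\max_(i <- l) i).+1 => [|j /h dj]; last exact: le_trans (d0 _).
  apply/negP => /(@leq_bigmax_seq _ l xpredT id) -/(_ isT).
  by rewrite ltnn.
rewrite -ltNge in k0P; have [N NP] := dv _ k0P.
have [k kl kP] := seq_argmax d [seq j <- iota 0 N | j \notin l] k0.
exists k; first by move: kl; rewrite inE mem_filter => /predU1P[->//|/andP[]].
move=> j jl; case: (ltnP j N) => jN.
  by apply: kP; rewrite inE mem_filter mem_iota jl jN orbT.
by rewrite (le_trans (NP _ jN))// kP// inE eqxx.
Qed.

(* With t_n the tail sums of b, take c_n = sqrt t_n: then
   b_n / c_n <= 2 (sqrt t_n - sqrt t_(n+1)) telescopes. *)
Lemma summable_factor (b : nat -> R) (M : R) : (forall n, 0 <= b n) ->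
  (forall n, \sum_(k < n) b k <= M) ->
  exists c : nat -> R, [/\ forall n, 0 <= c n, forall n, c n = 0 -> b n = 0,
    forall e, 0 < e -> exists N, forall n, (N <= n)%N -> c n <= e &
    exists M', forall n, \sum_(k < n) b k / c k <= M'].
Proof.
move=> b0 bM; pose a n := \sum_(k < n) b k.
have aS n : a n.+1 = a n + b n by rewrite /a big_ord_recr.
have ha : {homo a : m n / (m <= n)%N >-> m <= n}.
  by apply: homo_leq => [//|m n p|n]; [exact: le_trans|rewrite aS lerDl].
have supA : has_sup (range a) by split; [exists (a 0%N), 0%N|exists M => _ [n _ <-]; exact: bM].
pose S := sup (range a); pose t n := S - a n.
have t0 n : 0 <= t n by rewrite subr_ge0; apply: ub_le_sup; [exact: supA.2|exists n].
have tS n : t n - t n.+1 = b n by rewrite /t aS; ring.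
have tn n : t n.+1 <= t n by rewrite -subr_ge0 tS.
have bt n : b n <= t n by rewrite -tS lerBlDr lerDl.
exists (fun n => Num.sqrt (t n)); split.
- by move=> n; exact: sqrtr_ge0.
- move=> n /eqP; rewrite sqrtr_eq0 => h; apply/eqP; rewrite eq_le b0 andbT.
  exact: le_trans (bt n) h.
- move=> e e0; have e20 : 0 < e ^+ 2 by rewrite exprn_gt0.
  have [_ [N _ <-] aN] : exists2 x, range a x & S - e ^+ 2 < x.
    by apply: sup_gt; [exact: supA.1|rewrite ltrBlDr ltrDl].
  exists N => n /ha Nn; rewrite -[leRHS]ger0_norm ?(ltW e0)// -sqrtr_sqr ler_wsqrtr//.
  by rewrite /t lerBlDr -lerBlDl (le_trans (ltW aN)).
exists (2 * Num.sqrt (t 0%N)) => n.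
suff : \sum_(k < n) b k / Num.sqrt (t k) <= 2 * (Num.sqrt (t 0%N) - Num.sqrt (t n)).
  by have := sqrtr_ge0 (t n); lra.
elim: n => [|n IH]; first by rewrite big_ord0 subrr mulr0.
rewrite big_ord_recr /=.
suff : b n / Num.sqrt (t n) <= 2 * (Num.sqrt (t n) - Num.sqrt (t n.+1)).
  by move: IH; move: (_ / _) (\sum_(k < n) _) => x y; lra.
have := sqr_sqrtr (t0 n); have := sqr_sqrtr (t0 n.+1).
have := ler_wsqrtr (tn n); have := sqrtr_ge0 (t n); have := sqrtr_ge0 (t n.+1).
rewrite -tS; move: (Num.sqrt (t n)) (Num.sqrt (t n.+1)) => x y y0 x0 yx <- <-.
have [xz|xn0] := eqVneq x 0; first by rewrite xz in yx *; rewrite invr0 mulr0; lra.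
by rewrite ler_pdivrMr ?lt_def ?xn0//; nra.
Qed.

End RealSequences.

(** * Singular values and factorization by diagonal weights *)

Section DiagonalSingularValues.
Context (R : realType) (H : hilbertType R) (infH : infinite_dimensional H).
Implicit Types (S T W : bop H) (e : nat -> H) (n m : nat) (c d r : R).
Local Notation sv := singular_values.

(** Only the upper bound of a diagonal operator is retained, so d may exceed the true entries;
    [svd_factor] uses this for Z. *)
Definition diagonal e W (d : nat -> R) := forall x c, 0 <= c ->
  (forall n, hdot x (e n) != 0 -> d n <= c) -> rnorm (W x) <= c * rnorm x.

Lemma sv_diagonal e W (d : nat -> R) n : compact_operator W -> diagonal e W d ->
  (forall n, 0 <= d n) -> (forall m n, (m <= n)%N -> d n <= d m) -> sv W n <= d n.
Proof.
move=> cW dW d0 dn; apply: (sv_le infH cW).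
exists (mkseq e n); first by rewrite size_mkseq.
move=> v /perp_mkseq vn; apply: dW => // k vk; apply: dn.
by rewrite leqNgt; apply: contra vk => /vn ->.
Qed.

(** As d need not be monotone, indices are picked greedily, each time one with the largest remaining
    d_k; off the e_j already picked, W is bounded by that d_k. *)
Lemma sum_sv_diagonal e W (d : nat -> R) r M : compact_operator W -> diagonal e W d ->
  (forall n, 0 <= d n) ->
  (forall c, 0 < c -> exists N, forall n, (N <= n)%N -> d n <= c) ->
  0 <= r -> (forall n, \sum_(k < n) d k `^ r <= M) ->
  forall n, \sum_(k < n) sv W k `^ r <= M.
Proof.
move=> cW dW d0 dv r0 dM n.
have [ks [uks sks ksP]] : exists ks : seq nat, [/\ uniq ks, size ks = n &
    \sum_(k < n) sv W k `^ r <= \sum_(k <- ks) d k `^ r].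
  elim: n => [|n [ks [uks sks ksP]]]; first by exists [::]; rewrite big_ord0 big_nil.
  have [k kks kP] := vanishing_argmax ks d0 dv.
  exists (k :: ks); split; rewrite /= ?kks ?sks//.
  rewrite big_ord_recr big_cons /= addrC lerD// ge0_ler_powR ?nnegrE ?d0 ?sv_ge0//.
  apply: (sv_le infH cW); exists (map e ks); first by rewrite size_map sks.
  move=> v vks; apply: dW => // j vj; apply: kP; apply: contra vj => jks.
  by rewrite vks// map_f.
apply: (le_trans ksP); pose N := (\max_(i <- ks) i).+1; apply: le_trans (dM N).
rewrite -(big_mkord xpredT (fun k => d k `^ r)) /=.
rewrite [leRHS](bigID (fun k => k \in ks)) /= [X in _ <= X + _](_ : _ = \sum_(k <- ks) d k `^ r).
  by rewrite lerDl sumr_ge0// => i _; exact: powR_ge0.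
rewrite -big_filter; apply: perm_big; apply: uniq_perm => //.
  by rewrite filter_uniq// iota_uniq.
move=> k; rewrite mem_filter mem_index_iota /=; case kks: (k \in ks) => //=.
by rewrite ltnS; apply: (@leq_bigmax_seq _ ks xpredT id).
Qed.

(** W multiplies e_n by d_n, and Z sends e_n to c_n T e_n / s_n, of norm c_n. If s_n = 0 then T e_n
    = 0, and the convention 0^-1 = 0 gives Z e_n = 0. *)
Lemma svd_factor T e (s c d : nat -> R) : compact_operator T -> is_svd T e s ->
  (forall n, 0 <= c n) -> (forall n, 0 <= d n) -> (forall n, c n * d n = s n) ->
  (forall t, 0 < t -> exists N, forall n, (N <= n)%N -> c n <= t) ->
  (forall t, 0 < t -> exists N, forall n, (N <= n)%N -> d n <= t) ->
  exists Z W, [/\ T = bop_comp Z W, compact_operator Z, compact_operator W,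
    diagonal e Z c & diagonal e W d].
Proof.
move=> cT sT c0 d0 cd cv dv; have oe : onseq e by case: sT.
pose g n := (c n / s n)%:C%C *: T (e n).
have ng n : rnorm (g n) <= c n.
  have s0 : 0 <= s n by case: sT.
  rewrite rnormZ (svd_norm sT) cabsR ger0_norm ?divr_ge0//.
  have [sn0|sn0] := eqVneq (s n) 0; first by rewrite sn0 mulr0.
  by rewrite divfK.
have nde n : rnorm ((d n)%:C%C *: e n) = d n.
  by rewrite rnormZ onseq_norm// mulr1 cabsR ger0_norm.
have [||Z [Ze vZ dZ]] := @diag_vanishing _ _ e g oe.
- move=> i j /negbTE ij; rewrite hdotZl hdotZr (svd_hdot sT) ij mulr0n !mulr0 //.
- by move=> t /cv[N NP]; exists N => n /NP; exact: le_trans (ng n).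
have [||W [We vW dW]] := @diag_vanishing _ _ e (fun n => (d n)%:C%C *: e n) oe.
- by move=> i j /negbTE ij; rewrite hdotZl hdotZr oe ij !mulr0.
- by move=> t /dv[N NP]; exists N => n; rewrite nde; exact: NP.
exists Z, W; split.
- apply: (vanishing_eq oe); [exact: svd_vanishing sT|exact: vanishing_compl|].
  move=> n; rewrite bop_compE We bopZ Ze /g scalerA -rmorphM /= mulrA [d n * _]mulrC cd.
  have [sn0|sn0] := eqVneq (s n) 0; last by rewrite divff// scale1r.
  rewrite sn0 mul0r scale0r; apply/eqP.
  by rewrite -rnorm_eq0 (svd_norm sT) sn0.
- exact: vanishing_compact vZ.
- exact: vanishing_compact vW.
- by move=> x t t0 h; apply: dZ => // n /h; exact: le_trans (ng n).
- by move=> x t t0 h; apply: dW => // n /h; rewrite nde.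
Qed.

End DiagonalSingularValues.

(** * Multipliers of one ideal dominated by multipliers of a larger one *)

Section Domination.
Context (R : realType) (H : hilbertType R) (infH : infinite_dimensional H).
Implicit Types (x y z : bop H) (n m : nat) (p q : \bar R).
Local Notation sv := singular_values.

Lemma powR_vanishing (a : nat -> R) (s : R) : 0 < s -> (forall n, 0 <= a n) ->
  (forall t, 0 < t -> exists N, forall n, (N <= n)%N -> a n < t) ->
  forall t, 0 < t -> exists N, forall n, (N <= n)%N -> a n `^ s <= t.
Proof.
move=> s0 a0 av t t0; have [N NP] := av _ (powR_gt0 s^-1 t0).
exists N => n /NP an; rewrite -[leRHS]powRr1 ?(ltW t0)// -(mulVf (lt0r_neq0 s0)) powRrM.
by rewrite ge0_ler_powR ?nnegrE ?powR_ge0 ?(ltW s0) ?(ltW an).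
Qed.

Lemma powRVK (s a : R) : 0 < s -> 0 <= a -> (a `^ s^-1) `^ s = a.
Proof. by move=> s0 a0; rewrite -powRrM mulVf ?powRr1// gt_eqF. Qed.

Lemma powR_split (s a : R) : 0 <= a -> a `^ s * a `^ (1 - s) = a.
Proof.
move=> a0; have s1 : s + (1 - s) = 1 by ring.
by rewrite -powRD s1 ?powRr1// oner_eq0.
Qed.

(* Either [u <= h c], or [c < u / h] and [d] is a power of [c]. *)
Lemma powR_two_scale (r q a u h : R) : 0 < r -> r < q -> 0 <= a -> 0 <= u -> 0 < h ->
  (u * a `^ (1 - r / q)) `^ r <= h `^ r * a `^ r + (h `^ (q - r))^-1 * u `^ q.
Proof.
move=> r0 rq a0 u0 h0; have q0 : 0 < q by lra.
have [uc|cu] := leP u (h * a `^ (r / q)).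
  apply: (@le_trans _ _ (h `^ r * a `^ r)); last first.
    by rewrite lerDl mulr_ge0 ?invr_ge0 ?powR_ge0.
  rewrite -powRM ?(ltW h0)// ge0_ler_powR ?nnegrE ?mulr_ge0 ?powR_ge0 ?(ltW r0) ?(ltW h0)//.
  by rewrite -[in leRHS](powR_split (r / q) a0) mulrA ler_wpM2r ?powR_ge0.
apply: (@le_trans _ _ ((h `^ (q - r))^-1 * u `^ q)); last first.
  by rewrite lerDr mulr_ge0 ?powR_ge0.
(* Here c is a^(r/q) and d is a^(1 - r/q): their product is a, and d^r = c^(q - r). *)
have E : (a `^ (1 - r / q)) `^ r = (a `^ (r / q)) `^ (q - r).
  rewrite -!powRrM; congr (_ `^ _).
  have -> : r / q * (q - r) = r / q * q - r / q * r by ring.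
  rewrite divfK ?gt_eqF//; ring.
rewrite (powRM _ u0 (powR_ge0 _ _)) E.
have u_gt0 : 0 < u by apply: le_lt_trans cu; rewrite mulr_ge0 ?powR_ge0 ?(ltW h0).
have -> : u `^ q = u `^ r * u `^ (q - r).
  rewrite -powRD; last by rewrite (gt_eqF u_gt0) implybT.
  by congr (_ `^ _); ring.
move: (a `^ (r / q)) (powR_ge0 a (r / q)) cu => c c0 cu.
rewrite mulrCA; apply: ler_wpM2l; first exact: powR_ge0.
rewrite [leRHS]mulrC ler_pdivlMr; last exact: powR_gt0.
rewrite -(powRM _ c0 (ltW h0)); apply: ge0_ler_powR.
- by rewrite subr_ge0 ltW.
- rewrite nnegrE; exact: (mulr_ge0 c0 (ltW h0)).
- rewrite nnegrE; exact: ltW.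
- rewrite mulrC; exact: ltW.
Qed.

(** Write y = Z W with weights a^(r/q) and a^(1 - r/q), where a lists the singular values of y; then
    Z is in L^q because a is r-summable. The n + n-th singular value of x y is at most that of x Z
    at n times a_n^(1 - r/q), and [powR_two_scale] does the work of the Hoelder inequality. *)
Lemma left_dominated_fin (r q : R) y (e : R) : 1 <= r -> r < q ->
  schatten_ideal r%:E y -> 0 < e ->
  exists2 z, schatten_ideal q%:E z & exists2 d : R, 0 < d & forall x,
    (schatten_norm q%:E (bop_comp x z) <= d%:E)%E ->
    (schatten_norm r%:E (bop_comp x y) <= e%:E)%E.
Proof.
move=> r1 rq /(schatten_idealP)[cy [C C0 yC]] e0.
have r0 : 0 < r by lra. have q0 : 0 < q by lra. have q1 : 1 <= q by lra.
have [f sy] := singular_valuesP infH cy; pose a := sv y.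
have a0 n : 0 <= a n by exact: sv_ge0.
have an m n : (m <= n)%N -> a n <= a m by exact: sv_noninc.
have av t : 0 < t -> exists N, forall n, (N <= n)%N -> a n < t by exact: sv_vanish.
have rq0 : 0 < r / q by rewrite divr_gt0.
have rq1 : 0 < 1 - r / q by rewrite subr_gt0 ltr_pdivrMr// mul1r.
have aC := (schatten_leP y r1 C0).1 yC.
have [|||||Z [W [yE cZ cW dZ dW]]] := @svd_factor _ _ y f a
  (fun n => a n `^ (r / q)) (fun n => a n `^ (1 - r / q)) cy sy.
- by move=> n; exact: powR_ge0.
- by move=> n; exact: powR_ge0.
- by move=> n; exact: powR_split.
- exact: powR_vanishing.
- exact: powR_vanishing.
have Zn n : sv Z n <= a n `^ (r / q).
  apply: (@sv_diagonal _ _ infH f Z (fun n => a n `^ (r / q)) n cZ dZ) => [k|k l kl].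
    exact: powR_ge0.
  by apply: ge0_ler_powR; rewrite ?nnegrE ?an ?(ltW rq0).
have Wn n : sv W n <= a n `^ (1 - r / q).
  apply: (@sv_diagonal _ _ infH f W (fun n => a n `^ (1 - r / q)) n cW dW) => [k|k l kl].
    exact: powR_ge0.
  by apply: ge0_ler_powR; rewrite ?nnegrE ?an ?(ltW rq1).
have Cr0 : 0 <= C `^ r by exact: powR_ge0.
exists Z.
  apply/schatten_idealP; split => //; exists ((C `^ r) `^ q^-1); first exact: powR_ge0.
  apply/(schatten_leP _ q1 (powR_ge0 _ _)) => n.
  rewrite (powRVK q0 Cr0); apply: le_trans (aC n).
  apply: ler_sum => k _; rewrite -[in leRHS](divfK (lt0r_neq0 q0) r) powRrM.
  apply: ge0_ler_powR; [exact: ltW|rewrite nnegrE; exact: sv_ge0| |exact: Zn].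
  by rewrite nnegrE; exact: powR_ge0.
have er0 : 0 < e `^ r by exact: powR_gt0.
(* Small h brings the part h^r C^r below e^r / 4; then d is chosen so that the part d^q / h^(q - r)
   equals e^r / 4. The factor 2 from [sum_even_double] brings the total to at most e^r. *)
pose h := (e `^ r / (4 * (C `^ r + 1))) `^ r^-1.
have D0 : 0 < 4 * (C `^ r + 1) by rewrite mulr_gt0//; lra.
have h0 : 0 < h by rewrite powR_gt0// divr_gt0.
have hr : h `^ r = e `^ r / (4 * (C `^ r + 1)).
  by rewrite powRVK// divr_ge0 ?ltW.
have hqr : 0 < h `^ (q - r) by exact: powR_gt0.
pose d := (h `^ (q - r) * (e `^ r / 4)) `^ q^-1.
have d0 : 0 < d by rewrite powR_gt0// mulr_gt0// divr_gt0.
have dq : d `^ q = h `^ (q - r) * (e `^ r / 4).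
  by rewrite powRVK// mulr_ge0 ?divr_ge0 ?ltW.
exists d => // x /(schatten_leP _ q1 (ltW d0)) xZ.
have cxy : compact_operator (bop_comp x y) by exact: compact_compl.
have cxZ : compact_operator (bop_comp x Z) by exact: compact_compl.
apply/(schatten_leP _ r1 (ltW e0)) => N.
apply: (@le_trans _ _ (2 * \sum_(n < N) sv (bop_comp x y) (n + n)%N `^ r)).
  apply: (@sum_even_double _ (fun k => sv (bop_comp x y) k `^ r)) => [n|m n mn].
    exact: powR_ge0.
  apply: ge0_ler_powR; [exact: ltW|rewrite nnegrE; exact: sv_ge0|rewrite nnegrE; exact: sv_ge0|].
  exact: sv_noninc.
have term n : sv (bop_comp x y) (n + n)%N `^ r <=
    h `^ r * a n `^ r + (h `^ (q - r))^-1 * sv (bop_comp x Z) n `^ q.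
  apply: le_trans (powR_two_scale r0 rq (a0 n) (sv_ge0 infH n cxZ) h0).
  apply: ge0_ler_powR; [exact: ltW|rewrite nnegrE; exact: sv_ge0| |].
    by rewrite nnegrE; apply: mulr_ge0; [exact: sv_ge0|exact: powR_ge0].
  have -> : bop_comp x y = bop_comp (bop_comp x Z) W by rewrite yE; apply: bopP.
  apply: (le_trans (sv_comp infH n n cxZ cW)).
  by apply: ler_wpM2l; [exact: sv_ge0|exact: Wn].
apply: (@le_trans _ _ (2 * (h `^ r * C `^ r + (h `^ (q - r))^-1 * d `^ q))).
  rewrite ler_pM2l//; apply: (@le_trans _ _ (\sum_(n < N) (h `^ r * a n `^ r +
      (h `^ (q - r))^-1 * sv (bop_comp x Z) n `^ q))).
    by apply: ler_sum => n _; exact: term.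
  rewrite big_split /=.
  apply: lerD.
    rewrite -mulr_sumr.
    exact: ler_wpM2l (powR_ge0 _ _) _ _ (aC N).
  rewrite -mulr_sumr.
  apply: ler_wpM2l (xZ N).
  by rewrite invr_ge0 ltW.
rewrite dq (mulKf (lt0r_neq0 hqr)) hr.
move: er0 Cr0 D0; clear; move: (e `^ r) (C `^ r) => E K E0 K0 D0.
have : E / (4 * (K + 1)) * K <= E / 4 by rewrite mulrAC ler_pdivrMr//; nra.
move: (E / (4 * (K + 1)) * K) => X; lra.
Qed.

(** Here Z must vanish at infinity while W stays in L^r. [summable_factor] gives c tending to 0 with
    a^r / c still summable; the weights are c^(1/r) for Z and the quotient for W, so |x y|_r <= |x
    Z| |W|_r. *)
Lemma left_dominated_infty (r : R) y (e : R) : 1 <= r ->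
  schatten_ideal r%:E y -> 0 < e ->
  exists2 z, compact_operator z & exists2 d : R, 0 < d & forall x,
    nop (bop_comp x z) <= d -> (schatten_norm r%:E (bop_comp x y) <= e%:E)%E.
Proof.
move=> r1 /(schatten_idealP)[cy [C C0 yC]] e0.
have r0 : 0 < r by lra.
have [f sy] := singular_valuesP infH cy; pose a := sv y.
have a0 n : 0 <= a n by exact: sv_ge0.
have aC := (schatten_leP y r1 C0).1 yC.
have [c [c0 ca cv [M cM]]] := summable_factor (fun n => powR_ge0 (a n) r) aC.
have a_eq0 n : c n = 0 -> a n = 0.
  by move=> /ca/eqP; rewrite powR_eq0 => /andP[/eqP].
pose c' n := c n `^ r^-1; pose d n := a n / c' n.
have c'0 n : 0 <= c' n by exact: powR_ge0.
have d0 n : 0 <= d n by rewrite divr_ge0.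
have c'r n : c' n `^ r = c n by rewrite -powRrM mulVf ?gt_eqF// powRr1.
have dr n : d n `^ r = a n `^ r / c n.
  by rewrite powRM ?invr_ge0// -powR_inv1// -powRrM mulN1r powRN c'r.
have c'v t : 0 < t -> exists N, forall n, (N <= n)%N -> c' n <= t.
  apply: powR_vanishing => //; first by rewrite invr_gt0.
  move=> s s0; have s20 : 0 < s / 2 by rewrite divr_gt0.
  by have [N NP] := cv _ s20; exists N => n /NP; lra.
have dv t : 0 < t -> exists N, forall n, (N <= n)%N -> d n <= t.
  move=> t0; have dM' n : \sum_(k < n) d k `^ r <= M.
    by apply: le_trans (cM n); apply: ler_sum => k _; rewrite dr.
  have [|N NP] := nondecreasing_bounded_tail _ dM' (powR_gt0 r t0).
    by apply: homo_leq => [//|k m n|n]; [exact: le_trans|rewrite big_ord_recr lerDl powR_ge0].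
  exists N => n Nn; have := NP n n.+1 Nn (leqnSn _).
  rewrite big_ord_recr /= [X in X - _]addrC addrK => h; rewrite leNgt; apply/negP => td.
  by move: h; apply/negP; rewrite -leNgt ge0_ler_powR ?nnegrE ?(ltW r0) ?(ltW t0) ?(ltW td).
have [|Z [W [yE cZ cW dZ dW]]] := @svd_factor _ _ y f a c' d cy sy c'0 d0 _ c'v dv.
  move=> n; rewrite /d mulrC; have [cn0|cn0] := eqVneq (c' n) 0; last by rewrite divfK.
  rewrite cn0 mulr0 a_eq0//; apply/eqP; move/eqP: cn0.
  by rewrite /c' powR_eq0 => /andP[].
have M0 : 0 <= M by have := cM 0%N; rewrite big_ord0.
have M1 : 0 < M `^ r^-1 + 1 by have := powR_ge0 M r^-1; lra.
exists Z => //; exists (e / (M `^ r^-1 + 1)); first exact: divr_gt0.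
move=> x xZ.
have WM : (schatten_norm r%:E W <= (M `^ r^-1)%:E)%E.
  apply/(schatten_leP _ r1 (powR_ge0 _ _)).
  rewrite (powRVK r0 M0).
  apply: (sum_sv_diagonal infH cW dW) => // [|n]; first exact: ltW.
  by apply: le_trans (cM n); apply: ler_sum => k _; rewrite dr.
have -> : bop_comp x y = bop_comp (bop_comp x Z) W by rewrite yE; apply: bopP.
apply: (le_trans (schatten_compl infH (bop_comp x Z) _ cW (powR_ge0 _ _) WM)) => //.
rewrite lee_fin; apply: (@le_trans _ _ (e / (M `^ r^-1 + 1) * M `^ r^-1)).
  by rewrite ler_wpM2r ?powR_ge0.
rewrite mulrAC ler_pdivrMr//; nra.
Qed.

Lemma left_dominated p q y (e : R) : (1 <= p)%E -> (p <= q)%E -> schatten_ideal p y -> 0 < e ->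
  exists2 z, schatten_ideal q z & exists2 d : R, 0 < d & forall x,
    (schatten_norm q (bop_comp x z) < d%:E)%E -> (schatten_norm p (bop_comp x y) < e%:E)%E.
Proof.
move=> p1; rewrite le_eqVlt => /predU1P[<- yp e0|pq yp e0]; first by exists y => //; exists e.
have e20 : 0 < e / 2 by rewrite divr_gt0.
have lte : ((e / 2)%:E < e%:E)%E by rewrite lte_fin; lra.
have q1 := le_trans p1 (ltW pq).
have [p_infty|[r r1 pr]] := schatten_cases p1; first by rewrite p_infty ltNge leey in pq.
rewrite pr in pq yp *.
have [q_infty|[s s1 qs]] := schatten_cases q1.
  have [z cz [d d0 zd]] := left_dominated_infty r1 yp e20.
  rewrite q_infty; exists z; first by split=> //; rewrite schatten_pinfty ltry.
  exists d => // x; rewrite schatten_pinfty lte_fin => /ltW /zd h.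
  exact: le_lt_trans h lte.
rewrite qs lte_fin in pq *.
have [z sz [d d0 zd]] := left_dominated_fin r1 pq yp e20; exists z => //; exists d => // x.
by move=> /ltW /zd h; exact: le_lt_trans h lte.
Qed.

Lemma right_dominated p q y (e : R) : (1 <= p)%E -> (p <= q)%E -> schatten_ideal p y -> 0 < e ->
  exists2 z, schatten_ideal q z & exists2 d : R, 0 < d & forall x,
    (schatten_norm q (bop_comp z x) < d%:E)%E -> (schatten_norm p (bop_comp y x) < e%:E)%E.
Proof.
move=> p1 pq yp e0; have [z zq [d d0 zd]] :=
  left_dominated p1 pq (schatten_ideal_adjoint infH yp) e0.
exists (adjoint z); first exact: schatten_ideal_adjoint.
exists d => // x; have cz : compact_operator z := zq.1; have cy : compact_operator y := yp.1.
rewrite -(schatten_adjoint infH q (@compact_compr _ _ _ x (compact_adjoint cz))).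
rewrite adjoint_comp adjointK.
by move=> /zd; rewrite -(schatten_adjoint infH p (@compact_compr _ _ _ x cy)) adjoint_comp.
Qed.

End Domination.

(** * Comparison of the topologies *)

Section SeminormTopologies.
Context (R : realType) (V : lmodType R[i]).
Implicit Types (P Q F G : set (V -> \bar R)) (U : set V).

Lemma seminormed_openP P U : @open (seminormed P) U <-> forall x, U x ->
  exists2 F : set (V -> \bar R), finite_set F /\ F `<=` P &
  exists2 e : R, 0 < e & [set y | forall f, F f -> (f (y - x)%R < e%:E)%E] `<=` U.
Proof. by []. Qed.

Lemma nbhs0_seminormed P U : nbhs (0 : seminormed P) U ->
  exists2 F : set (V -> \bar R), finite_set F /\ F `<=` P &
  exists2 e : R, 0 < e & [set y | forall f, F f -> (f y < e%:E)%E] `<=` U.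
Proof.
rewrite nbhsE => -[B [/seminormed_openP oB B0] BU].
have [F FP [e e0 FB]] := oB _ B0; exists F => //; exists e => // y yF.
by apply/BU/FB => f Ff; rewrite subr0; exact: yF.
Qed.

Lemma seminormed_mono P Q : P `<=` Q -> @open (seminormed P) `<=` @open (seminormed Q).
Proof.
move=> PQ U /seminormed_openP oU; apply/seminormed_openP => x /oU[F [finF FP] eF].
by exists F => //; split=> // f /FP/PQ.
Qed.

Definition dominated P Q := forall f, P f -> forall e : R, 0 < e ->
  exists2 G, finite_set G /\ G `<=` Q & exists2 d : R, 0 < d &
    forall y, (forall g, G g -> (g y < d%:E)%E) -> (f y < e%:E)%E.

Lemma dominated_finite P Q F (e : R) : dominated P Q -> finite_set F -> F `<=` P -> 0 < e ->
  exists2 G, finite_set G /\ G `<=` Q & exists2 d : R, 0 < d &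
    forall y, (forall g, G g -> (g y < d%:E)%E) -> forall f, F f -> (f y < e%:E)%E.
Proof.
move=> PQ /finite_seqP[s ->] + e0; elim: s => [_|f s IH fsP].
  by exists set0; [split; [exact: finite_set0|]|exists 1].
have [|G [finG GQ] [d d0 Gd]] := IH; first by move=> g gs; apply: fsP; rewrite /= inE gs orbT.
have [|G' [finG' GQ'] [d' d'0 Gd']] := PQ f _ e e0; first by apply: fsP; rewrite /= inE eqxx.
exists (G `|` G'); first by split; [rewrite finite_setU|move=> g [/GQ|/GQ']].
exists (Num.min d d'); first by rewrite lt_min d0.
move=> y yG g /=; rewrite inE => /predU1P[->|gs].
  apply: Gd' => h Gh; apply: lt_le_trans (yG h (or_intror Gh)) _.
  by rewrite lee_fin ge_min lexx orbT.
apply: Gd gs => h Gh; apply: lt_le_trans (yG h (or_introl Gh)) _.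
by rewrite lee_fin ge_min lexx.
Qed.

(** Open sets are defined by balls about each of their points, so domination at the origin transfers
    to every point by translation. *)
Lemma dominated_open P Q : dominated P Q -> @open (seminormed P) `<=` @open (seminormed Q).
Proof.
move=> PQ U /seminormed_openP oU; apply/seminormed_openP => x /oU[F [finF FP] [e e0 FU]].
have [G GQ [d d0 Gd]] := dominated_finite PQ finF FP e0.
exists G => //; exists d => // y yG; apply: FU => f Ff.
exact: Gd yG f Ff.
Qed.

End SeminormTopologies.

Section Inclusions.
Context (R : realType) (H : hilbertType R) (infH : infinite_dimensional H).
Implicit Types (p q : \bar R).

Lemma mu_top_le p q : (1 <= p)%E -> (p <= q)%E ->
  @open (mu_top H p) `<=` @open (mu_top H q).
Proof.
move=> p1 pq; apply: dominated_open => _ [y yp <-] e e0.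
have [z zq [d d0 zd]] := left_dominated infH p1 pq yp e0.
exists [set (fun x => schatten_norm q (bop_comp x z))].
  by split; [exact: finite_set1|move=> _ ->; exists z].
by exists d => // x xz; apply: zd; exact: (xz _ (erefl _)).
Qed.

Lemma mu_star_top_le p q : (1 <= p)%E -> (p <= q)%E ->
  @open (mu_star_top H p) `<=` @open (mu_star_top H q).
Proof.
move=> p1 pq; apply: dominated_open => _ [[y yp <-]|[y yp <-]] e e0.
  have [z zq [d d0 zd]] := left_dominated infH p1 pq yp e0.
  exists [set (fun x => schatten_norm q (bop_comp x z))].
    by split; [exact: finite_set1|move=> _ ->; left; exists z].
  by exists d => // x xz; apply: zd; exact: (xz _ (erefl _)).
have [z zq [d d0 zd]] := right_dominated infH p1 pq yp e0.
exists [set (fun x => schatten_norm q (bop_comp z x))].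
  by split; [exact: finite_set1|move=> _ ->; right; exists z].
by exists d => // x xz; apply: zd; exact: (xz _ (erefl _)).
Qed.

Lemma mu_top_le_star p : @open (mu_top H p) `<=` @open (mu_star_top H p).
Proof. by apply: seminormed_mono => f; left. Qed.

End Inclusions.

Section Series.
Context (R : realType).

Lemma harmonic_unbounded (M : R) : ~ (forall n, \sum_(k < n) k.+1%:R^-1 <= M).
Proof.
move=> hM; apply: (@dvg_harmonic R).
apply: nondecreasing_is_cvgn.
  apply/nondecreasing_seqP => n; rewrite /series /= !big_mkord big_ord_recr /= lerDl.
  by rewrite invr_ge0.
by exists M => _ [n _ <-]; rewrite /series /= big_mkord; exact: hM.
Qed.

(* S(n) <= S(2n+1) <= 1 + 2^(1-s) S(n), by pairing 2k with 2k+1. *)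
Lemma powR_series_bounded (s : R) : 1 < s ->
  exists M, forall n, \sum_(k < n) k.+1%:R `^ (- s) <= M.
Proof.
move=> s1; pose f (k : nat) := (k%:R : R) `^ (- s).
have f0 k : 0 <= f k := powR_ge0 _ _.
have s0 : 0 < s by lra.
have fn m n : (0 < m)%N -> (m <= n)%N -> f n <= f m.
  move=> m0 mn; rewrite /f !powRN lef_pV2 ?posrE ?powR_gt0 ?ltr0n// ?(leq_trans m0)//.
  by apply: ge0_ler_powR; rewrite ?nnegrE ?ler0n ?ler_nat// ltW.
pose b : R := 2 `^ (- s).
have f2 k : f (k.+1 * 2)%N = b * f k.+1 by rewrite /f natrM powRM ?ler0n// mulrC.
have b0 : 0 < b by exact: powR_gt0.
have b1 : 2 * b < 1.
  have -> : b = (2 `^ s)^-1 by rewrite /b powRN.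
  rewrite ltr_pdivrMr ?powR_gt0// mul1r -[X in X < _](powRr1 (ler0n R 2)).
  rewrite -(ltr_ln) ?posrE ?powR_gt0// !ln_powR ltr_pM2r//.
  by rewrite ln_gt0// ltr1n.
exists (1 - 2 * b)^-1 => n; set S := \sum_(k < n) _.
have : S <= 1 + 2 * b * S.
  apply: (@le_trans _ _ (\sum_(k < (n + n).+1) f k.+1)).
    have nn : (n <= (n + n).+1)%N by rewrite -addnS leq_addr.
    rewrite -(subnKC nn) big_split_ord /= lerDl; apply: sumr_ge0 => i _; exact: f0.
  rewrite big_ord_recl lerD//; first by rewrite /f powR1.
  rewrite /S -mulrA mulr_sumr mulr_sumr.
  elim: n {S} => [|n IH]; first by rewrite !big_ord0.
  rewrite addnS addSn big_ord_recr big_ord_recr [leRHS]big_ord_recr /= -addrA lerD//.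
  rewrite /bump /= !add1n -/(f n.+1) -f2.
  have h1 : f (n + n).+2 <= f (n.+1 * 2)%N by apply: fn => //; rewrite muln2 -addnn addSn addnS.
  have h2 : f (n + n).+3 <= f (n.+1 * 2)%N.
    by apply: fn => //; rewrite muln2 -addnn addSn addnS; exact: leqnSn.
  by move: h1 h2; move: (f _) (f _) (f _) => x y z; lra.
move=> h; rewrite -[leRHS]mul1r ler_pdivlMr; lra.
Qed.

End Series.

Lemma finite_subset_image (T : eqType) (I : choiceType) (phi : I -> T) (A : set I) (F : set T) :
  finite_set F -> F `<=` [set phi i | i in A] ->
  exists s : seq I, (forall i, i \in s -> A i) /\ forall f, F f -> exists2 i, i \in s & f = phi i.
Proof.
move=> /finite_seqP[s ->]; elim: s => [_|f s IH fsA]; first by exists [::].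
have [|t [tA tP]] := IH; first by move=> g gs; apply: fsA; rewrite /= inE gs orbT.
have [|i Ai fi] := fsA f; first by rewrite /= inE eqxx.
exists (i :: t); split=> [j|g /=]; first by rewrite inE => /predU1P[->//|/tA].
rewrite inE => /predU1P[->|/tP[j jt gj]]; first by exists i; rewrite ?inE ?eqxx.
by exists j; rewrite ?inE ?jt ?orbT.
Qed.

(** * Strictness of the inclusions *)

Section Strictness.
Context (R : realType) (H : hilbertType R) (infH : infinite_dimensional H).
Implicit Types (x y z T A : bop H) (p q : \bar R) (n m : nat).
Local Notation sv := singular_values.

Lemma finite_bilateral p F : finite_set F -> F `<=` @left_seminorms R H p `|` right_seminorms p ->
  exists ys zs : seq (bop H), [/\ forall y, y \in ys -> schatten_ideal p y,
    forall z, z \in zs -> schatten_ideal p z & forall f, F f ->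
      (exists2 y, y \in ys & f = fun x => schatten_norm p (bop_comp x y)) \/
      (exists2 z, z \in zs & f = fun x => schatten_norm p (bop_comp z x))].
Proof.
move=> finF FLR.
have [ys [ysP ysF]] := @finite_subset_image _ _ (fun y x => schatten_norm p (bop_comp x y))
  (schatten_ideal p) (F `&` left_seminorms p) (finite_setIl _ finF) (fun f Ff => Ff.2).
have [zs [zsP zsF]] := @finite_subset_image _ _ (fun z x => schatten_norm p (bop_comp z x))
  (schatten_ideal p) (F `&` right_seminorms p) (finite_setIl _ finF) (fun f Ff => Ff.2).
exists ys, zs; split=> // f Ff; case: (FLR f Ff) => h; [left|right].
  by have [y yys ->] := ysF f (conj Ff h); exists y.
by have [z zzs ->] := zsF f (conj Ff h); exists z.
Qed.

Lemma nop_lt_schatten p T (e : R) : (1 <= p)%E -> compact_operator T ->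
  (schatten_norm p T < e%:E)%E -> nop T < e.
Proof.
move=> p1 cT Te; have finT : schatten_norm p T \is a fin_num.
  by rewrite ge0_fin_numE ?schatten_ge0//; apply: lt_trans Te (ltry _).
rewrite -(fineK finT) lte_fin in Te; apply: le_lt_trans Te.
apply: (nop_le_schatten infH p1 cT); first exact/fine_ge0/schatten_ge0.
by rewrite fineK.
Qed.

Lemma onseq_ex : exists e : nat -> H, onseq e.
Proof.
have [e eP] := @history_choice H (fun g v => rnorm v = 1 /\ perp g v) (fun g => infdim_perp g infH).
by exists e; exact: onseqI.
Qed.

Lemma small_perp (zs : seq (bop H)) (c : R) : 0 < c ->
  (forall z, z \in zs -> compact_operator z) ->
  exists g : seq H, forall v, perp g v -> forall z, z \in zs -> rnorm (z v) <= c * rnorm v.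
Proof.
move=> c0; elim: zs => [_|z zs IH zsP]; first by exists [::].
have [|g gP] := IH; first by move=> y yzs; apply: zsP; rewrite inE yzs orbT.
have /compact_approx/(_ _ c0)[n [h _ hP]] := zsP z (mem_head _ _).
exists (g ++ h) => v /perp_cat[gv hv] y; rewrite inE => /predU1P[->|]; first exact: hP.
exact: gP.
Qed.

(** One control sequence serves all of ys: the maximum of their singular values, whose r-th powers
    stay summable. Collecting n vectors per operator gives [size ys * n]. *)
Lemma common_approx (r : R) (ys : seq (bop H)) : 1 <= r ->
  (forall y, y \in ys -> schatten_ideal r%:E y) ->
  exists (s : nat -> R) (M : R), [/\ forall n, 0 <= s n, forall n, \sum_(k < n) s k `^ r <= M &
    forall n, exists2 g : seq H, (size g <= size ys * n)%N &
      forall v, perp g v -> forall y, y \in ys -> rnorm (adjoint y v) <= s n * rnorm v].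
Proof.
move=> r1; have r0 : 0 < r by lra.
elim: ys => [_|y ys IH ysP].
  exists (fun=> 0), 0; split=> // n; last by exists [::].
  by rewrite big1// => i _; rewrite powR0// gt_eqF.
have [|s [M [s0 sM sP]]] := IH; first by move=> z zys; apply: ysP; rewrite inE zys orbT.
have /schatten_idealP[cy [C C0 yC]] := ysP y (mem_head _ _).
exists (fun n => Num.max (s n) (sv y n)), (M + C `^ r); split=> n.
- by rewrite le_max s0.
- apply: (@le_trans _ _ (\sum_(k < n) (s k `^ r + sv y k `^ r))).
    apply: ler_sum => k _; rewrite /Num.max; case: ifP => _.
      by rewrite lerDr; exact: powR_ge0.
    by rewrite lerDl; exact: powR_ge0.
  by rewrite big_split /=; apply: lerD; [exact: sM|exact: (schatten_leP y r1 C0).1].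
have [g gn gP] := sP n.
have [h hn hP] := approx_adjoint (sv_ge0 infH n cy) (sv_approx infH n cy).
exists (h ++ g); first by rewrite size_cat mulSn leq_add.
move=> v /perp_cat[hv gv] z; rewrite inE => /predU1P[->|zys].
  by apply: (le_trans (hP v hv)); rewrite ler_wpM2r// le_max lexx orbT.
by apply: (le_trans (gP v gv z zys)); rewrite ler_wpM2r// le_max lexx.
Qed.

(** The diagonal operator with entries (n+1)^(-1/r). For finite q the q-th powers form a series of
    exponent q/r > 1; [approx_lower] shows that the entries also bound its approximation numbers
    from below. *)
Lemma power_diagonal (r : R) (q : \bar R) : 1 <= r -> (r%:E < q)%E ->
  exists2 A : bop H, schatten_ideal q A & forall n c, approx A n c -> n.+1%:R `^ (- r^-1) <= c.
Proof.
move=> r1 rq; have r0 : 0 < r by lra.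
pose a n : R := n.+1%:R `^ (- r^-1).
have [e oe] := onseq_ex.
have aE n : a n = n.+1%:R^-1 `^ (r^-1).
  by rewrite -powR_inv1 ?ler0n// -powRrM mulN1r.
have a0 n : 0 <= a n by exact: powR_ge0.
have an m n : (m <= n)%N -> a n <= a m.
  move=> mn; rewrite !aE; apply: ge0_ler_powR; rewrite ?nnegrE ?invr_ge0 ?ler0n ?(ltW r0)//.
  by rewrite lef_pV2 ?posrE ?ltr0n// ler_nat.
have av t : 0 < t -> exists N, forall n, (N <= n)%N -> a n <= t.
  move=> t0; have [||N NP] := powR_vanishing _ _ (@small_invS R) t0 (s := r^-1).
  - by rewrite invr_gt0.
  - by move=> n; rewrite invr_ge0.
  by exists N => n /NP; rewrite aE.
have nae n : rnorm ((a n)%:C%C *: e n) = a n.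
  by rewrite rnormZ onseq_norm// mulr1 cabsR ger0_norm.
have [||A [Ae vA dA]] := @diag_vanishing _ _ e (fun n => (a n)%:C%C *: e n) oe.
- by move=> i j /negbTE ij; rewrite hdotZl hdotZr oe ij !mulr0.
- by move=> t /av[N NP]; exists N => n; rewrite nae; exact: NP.
have cA : compact_operator A by exact: vanishing_compact vA.
have diagA : diagonal e A a by move=> x c c0 h; apply: dA => // n /h; rewrite nae.
exists A; last first.
  move=> n c; apply: (approx_lower oe (a0 n)) => [i j /negbTE ij|i ni].
    by rewrite !Ae hdotZl hdotZr oe ij !mulr0.
  by rewrite Ae nae an.
have q1 : (1 <= q)%E by apply: le_trans (ltW rq); rewrite lee_fin.
have [q_infty|[s s1 qs]] := schatten_cases q1.
  by rewrite q_infty; split=> //; rewrite schatten_pinfty ltry.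
rewrite qs lte_fin in rq *; have s0 : 0 < s by lra.
have sr1 : 1 < s / r by rewrite ltr_pdivlMr// mul1r.
have [M MP] := powR_series_bounded sr1.
have M0 : 0 <= M by have := MP 0%N; rewrite big_ord0.
apply/schatten_idealP; split=> //; exists (M `^ s^-1); first exact: powR_ge0.
apply/(schatten_leP _ s1 (powR_ge0 _ _)) => n; rewrite (powRVK s0 M0).
apply: le_trans (MP n); apply: ler_sum => k _.
have -> : (k.+1%:R : R) `^ (- (s / r)) = a k `^ s.
  by rewrite -powRrM mulNr [_ * s]mulrC.
apply: ge0_ler_powR; [exact: ltW|rewrite nnegrE; exact: sv_ge0|by rewrite nnegrE|].
exact: sv_diagonal diagA a0 an.
Qed.

Lemma mu_top_not_le_star p q : (1 <= p)%E -> (p < q)%E ->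
  ~ (@open (mu_top H q) `<=` @open (mu_star_top H p)).
Proof.
move=> p1 pq qp; have q1 := le_trans p1 (ltW pq).
have [p_infty|[r r1 pr]] := schatten_cases p1; first by rewrite p_infty ltNge leey in pq.
subst p; have r0 : 0 < r by lra.
have [A Aq Aa] := power_diagonal r1 pq; have cA : compact_operator A := Aq.1.
(* A ball for the operator norm of x A, not its Schatten norm: the triangle inequality of [nop]
   makes it open, and Schatten norms dominate [nop]. *)
pose U : set (bop H) := [set x | nop (bop_comp x A) < 1].
have oU : @open (mu_top H q) U.
  apply/seminormed_openP => x Ux.
  exists [set (fun x => schatten_norm q (bop_comp x A))].
    by split; [exact: finite_set1|move=> _ ->; exists A].
  exists (1 - nop (bop_comp x A)); first by rewrite subr_gt0.
  move=> y /(_ _ (erefl _)) yx.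
  have {}yx := nop_lt_schatten q1 (@compact_compl _ _ (y - x) _ cA) yx.
  have yE : bop_comp y A = bop_comp x A + bop_comp (y - x) A.
    by apply: bopP => v; rewrite bop_addE !bop_compE bop_subE addrC subrK.
  rewrite /U /= yE; apply: le_lt_trans (nopD _ _) _.
  by rewrite addrC -ltrBrDr.
have U0 : U 0.
  rewrite /U /= (_ : bop_comp 0 A = 0); last exact: bopP.
  apply: le_lt_trans ltr01; apply: nop_le => // x.
  by rewrite (_ : (0 : bop H) x = 0)// rnorm0 mul0r.
have [F [finF FP] [e e0 FU]] := (seminormed_openP _ _).1 (qp _ oU) _ U0.
have [ys [zs [ysP zsP Fyz]]] := finite_bilateral finF FP.
(* Test on x = [rank1 f v] with f a unit vector: left seminorms see only |adjoint y v|, while right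
   seminorms see |z f| |v|, which is made small by the choice of f. *)
have key v : (forall y, y \in ys -> rnorm (adjoint y v) < e) -> rnorm (adjoint A v) < 1.
  move=> vy; have v1 : 0 < rnorm v + 1 by have := rnorm_ge0 v; lra.
  have c0 : 0 < e / (rnorm v + 1) / 2 by rewrite !divr_gt0.
  have [g gP] := small_perp c0 (fun z zzs => (zsP z zzs).1).
  have [f [f1 gf]] := infdim_perp g infH.
  suff : U (rank1 f v) by rewrite /U /= rank1_comp nop_rank1 f1 mul1r.
  apply: FU => h /Fyz[[y yys ->]|[z zzs ->]]; rewrite subr0.
    rewrite rank1_comp; apply: (le_lt_trans (schatten_rank1 infH f (adjoint y v) p1)).
    by rewrite lte_fin f1 mul1r vy.
  rewrite comp_rank1; apply: (le_lt_trans (schatten_rank1 infH (z f) v p1)).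
  rewrite lte_fin; have := gP f gf z zzs; rewrite f1 mulr1 => h1.
  apply: (@le_lt_trans _ _ (e / (rnorm v + 1) / 2 * rnorm v)); first by rewrite ler_wpM2r.
  have h2 : e / (rnorm v + 1) * rnorm v <= e by rewrite mulrAC ler_pdivrMr//; nra.
  by rewrite mulrAC; lra.
have [s [M [s0 sM sP]]] := common_approx r1 ysP.
(* Scaling v so that |adjoint A v| = 1 turns [key] into a bound of |adjoint A v| by 1/e times the
   largest |adjoint y v|, which is at most s_n |v| off the vectors of g. *)
have As n : approx A (size ys * n) (s n / e).
  have [g gn gP] := sP n; have se0 : 0 <= s n / e by rewrite divr_ge0// ltW.
  rewrite -[A]adjointK; apply: approx_adjoint => //; exists g => // v /gP vs.
  rewrite leNgt; apply/negP => h.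
  have X0 : 0 < rnorm (adjoint A v) by apply: le_lt_trans h; rewrite mulr_ge0.
  have nX (x : bop H) : rnorm (x ((rnorm (adjoint A v))^-1%:C%C *: v)) =
      rnorm (x v) / rnorm (adjoint A v).
    by rewrite bopZ rnormZ cabsR ger0_norm ?invr_ge0// mulrC.
  have : rnorm (adjoint A ((rnorm (adjoint A v))^-1%:C%C *: v)) < 1.
    apply: key => y yys; rewrite nX ltr_pdivrMr//.
    apply: le_lt_trans (vs y yys) _.
    by move: h; rewrite mulrAC ltr_pdivrMr// [_ * e]mulrC.
  by rewrite nX divff ?gt_eqF// ltxx.
have er0 : 0 < e `^ r by exact: powR_gt0.
pose k := size ys.
have term n : (k * n).+1%:R^-1 <= s n `^ r / e `^ r.
  have h := Aa _ _ (As n).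
  have : (((k * n).+1%:R : R) `^ (- r^-1)) `^ r <= (s n / e) `^ r.
    by apply: ge0_ler_powR h; rewrite ?nnegrE ?powR_ge0 ?divr_ge0 ?(ltW e0)// ltW.
  rewrite -powRrM mulNr mulVf ?gt_eqF// powR_inv1 ?ler0n//.
  by rewrite powRM ?invr_ge0 ?(ltW e0)// -[e^-1]powR_inv1 ?(ltW e0)// powRAC powR_inv1 ?(ltW er0).
(* Only the indices k n of A are controlled; the inequality k n + 1 <= (k + 1) (n + 1) compares
   their bounds with the full harmonic series. *)
apply: (@harmonic_unbounded R (k.+1%:R * (M / e `^ r))) => N.
apply: (@le_trans _ _ (k.+1%:R * \sum_(n < N) (s n `^ r / e `^ r))).
  rewrite mulr_sumr; apply: ler_sum => n _.
  apply: le_trans (ler_wpM2l (ler0n _ _) (term n)).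
  rewrite ler_pdivlMr ?ltr0n// mulrC ler_pdivrMr ?ltr0n// -natrM ler_nat.
  by rewrite mulSn mulnS addSn ltnS; lia.
rewrite ler_wpM2l ?ler0n// -mulr_suml ler_wpM2r ?invr_ge0 ?(ltW er0)//.
Qed.

End Strictness.

(** * Bounded sets *)

Section UniformBoundedness.
Context (R : realType) (H : hilbertType R).
Implicit Types (T : bop H) (v w : H).

Lemma nop_half T : exists2 u, rnorm u <= 1 & nop T / 2 <= rnorm (T u).
Proof.
apply: contrapT => h; have T0 := nop_ge0 T.
have Tu u : rnorm (T u) <= nop T / 2 * rnorm u.
  have [->|u0] := eqVneq u 0; first by rewrite bop0 rnorm0 mulr0.
  have nu : 0 < rnorm u by rewrite rnorm_gt0.
  rewrite leNgt; apply/negP => Tu; apply: h.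
  exists ((rnorm u)^-1%:C%C *: u); first by rewrite rnorm_unit.
  rewrite bopZ rnormZ cabsR ger0_norm ?invr_ge0// [leRHS]mulrC ler_pdivlMr//; exact: ltW.
have nT0 : nop T = 0.
  have h2 : 0 <= nop T / 2 by rewrite divr_ge0.
  by have := nop_le h2 Tu; lra.
by apply: h; exists 0; rewrite ?rnorm0// bop0 rnorm0 nT0 mul0r.
Qed.

(** One of v + w and v - w qualifies, because 2 T w = T (v + w) - T (v - w). *)
Lemma nop_half_ball T v (rho : R) : 0 <= rho ->
  exists2 w, rnorm w <= rho & rho * nop T / 2 <= rnorm (T (v + w)).
Proof.
move=> rho0; have [u u1 Tu] := nop_half T; pose w := rho%:C%C *: u.
have nw : rnorm w <= rho by rewrite rnormZ cabsR ger0_norm// ler_piMr.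
have Tw : rho * nop T / 2 <= rnorm (T w).
  by rewrite bopZ rnormZ cabsR ger0_norm// -mulrA ler_wpM2l.
have : 2 * rnorm (T w) <= rnorm (T (v + w)) + rnorm (T (v - w)).
  rewrite -(gtr0_norm (ltr0n R 2)) -cabsR -rnormZ -bopZ.
  have -> : 2%:R%:C%C *: w = (v + w) - (v - w).
    by rewrite opprB [v + w]addrC addrACA subrr addr0 mulr2n rmorphD rmorph1 scalerDl scale1r.
  by rewrite bopB rnormB.
have [h1 _|h1 h2] := leP (rho * nop T / 2) (rnorm (T (v + w))); first by exists w.
exists (- w); first by rewrite rnormN.
by rewrite leNgt; apply/negP => h3; lra.
Qed.

(* Gliding hump (Sokal's proof): perturbing v_n by at most 4^-n makes
   |T_n v_(n+1)| large, and the later perturbations cannot undo it. *)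
Lemma uniform_boundedness (B : set (bop H)) :
  (forall v, exists C : R, forall T, B T -> rnorm (T v) <= C) ->
  exists M : R, forall T, B T -> nop T <= M.
Proof.
move=> Bv; apply: contrapT => nB.
have {}nB (M : R) : exists2 T, B T & M < nop T.
  apply: contrapT => h; apply: nB; exists M => T BT.
  by rewrite leNgt; apply/negP => MT; apply: h; exists T.
pose rad (n : nat) : R := (4 ^+ n)^-1.
have rad0 n : 0 < rad n by rewrite invr_gt0 exprn_gt0.
have radS n : rad n.+1 = rad n / 4 by rewrite /rad exprS invfM mulrC.
have [g|e eP] := @history_choice (bop H * H)%type (fun g Tw => [/\ B Tw.1,
  rnorm Tw.2 <= rad (size g) &
  (size g)%:R <= rnorm (Tw.1 (\sum_(x <- g) x.2 + Tw.2)) - rad (size g) / 3 * nop Tw.1]).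
  (* The 6 comes from 1/2 - 1/3 = 1/6: [nop_half_ball] yields half of rad n times the norm, and all
     later perturbations, at most 4/3 rad (n+1) = rad n / 3 together, can take away a third. *)
  have [T BT hT] := nB (6 * (size g)%:R / rad (size g)).
  have [w wr wT] := nop_half_ball T (\sum_(x <- g) x.2) (ltW (rad0 (size g))).
  exists (T, w); split=> //=; move: hT; rewrite ltr_pdivrMr// => hT.
  by move: wT hT; move: (rad _) (nop _) (rnorm (T _)) ((size g)%:R) => a b c d; lra.
pose u n := \sum_(x <- mkseq e n) x.2.
have uS n : u n.+1 = u n + (e n).2 by rewrite /u mkseqS -cats1 big_cat big_seq1.
have u_tail m n : (m <= n)%N -> rnorm (u n - u m) <= 4 / 3 * (rad m - rad n).
  elim: n => [|n IH]; first by rewrite leqn0 => /eqP ->; rewrite !subrr rnorm0 mulr0.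
  rewrite leq_eqVlt => /predU1P[->|]; first by rewrite !subrr rnorm0 mulr0.
  rewrite ltnS => /IH h; rewrite uS addrAC.
  have [_ er _] := eP n; rewrite size_mkseq in er.
  apply: (le_trans (rnormD _ _)); rewrite radS.
  by move: h er; move: (rnorm (u n - u m)) (rnorm (e n).2) (rad m) (rad n) => a b c d; lra.
have rad_le n : rad n <= n.+1%:R^-1.
  rewrite /rad lef_pV2 ?posrE ?exprn_gt0 ?ltr0n//.
  by rewrite -natrX ler_nat ltn_expl.
have [d d0|v uv] := rnorm_cauchy (u := u).
  have d20 : 0 < d / 4 by rewrite divr_gt0.
  have [N NP] := small_invS d20; exists N => n m Nn Nm.
  have := u_tail _ _ Nn; have := u_tail _ _ Nm; have := rnorm_tri (u N) (u n) (u m).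
  rewrite (rnormC (u N)); have := NP N (leqnn N); have := rad_le N.
  have := rad0 n; have := rad0 m.
  move: (rad n) (rad m) (rad N) (N.+1%:R^-1) => a b c f.
  move: (rnorm (u n - u N)) (rnorm (u m - u N)) (rnorm (u n - u m)) => A B' C; lra.
have v_tail n : rnorm (v - u n) <= 4 / 3 * rad n.
  apply/ler_addgt0Pr => d d0; have [N NP] := uv _ d0.
  have := NP _ (leq_maxl N n); have := u_tail _ _ (leq_maxr N n).
  have := rnorm_tri (u (maxn N n)) v (u n); have := rad0 (maxn N n).
  move: (rad (maxn N n)) (rad n) (rnorm (v - u n)) => a b c.
  move: (rnorm (u (maxn N n) - u n)) (rnorm (v - u (maxn N n))) => A B'; lra.
have [C CP] := Bv v.
have [BT _ hn] := eP (Num.trunc C).+1; rewrite size_mkseq -/(u _) -uS in hn.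
set n := (Num.trunc C).+1 in hn BT *.
have := CP _ BT; apply/negP; rewrite -ltNge.
apply: lt_le_trans (truncnS_gt C) _; apply: (le_trans hn).
have h1 := rnorm_bop (e n).1 (v - u n.+1); have h2 := v_tail n.+1.
have h3 : nop (e n).1 * rnorm (v - u n.+1) <= nop (e n).1 * (4 / 3 * rad n.+1).
  by rewrite ler_wpM2l ?nop_ge0.
have := rnormBl ((e n).1 (u n.+1)) ((e n).1 v).
rewrite rnormC -bopB; rewrite radS in h3.
move: h1 h3; move: (rnorm ((e n).1 (v - u n.+1))) (rnorm ((e n).1 (u n.+1))) (rnorm ((e n).1 v)).
move: (nop (e n).1) (rad n) (nop (e n).1 * rnorm _) => a b c x y z; lra.
Qed.

End UniformBoundedness.

(** * Topologies induced on bounded subsets *)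

Section TraceTopologies.
Context (R : realType) (V : lmodType R[i]) (I : Type) (N : I -> V -> R).
Hypothesis N_tri : forall i x y z, N i (x - z) <= N i (x - y) + N i (y - z).
Hypothesis N_refl : forall i, N i 0 = 0.

Let P : set (V -> \bar R) := range (fun i x => (N i x)%:E).

Lemma open_seminorm_ball (s : list I) (x : V) (d : R) :
  @open (seminormed P) [set y | forall i, List.In i s -> N i (y - x) < d].
Proof.
elim: s => [|i s IH].
  rewrite (_ : [set y | _] = setT); first exact: openT.
  by apply/seteqP; split=> // y _ i [].
rewrite (_ : [set y | _] = [set y | N i (y - x) < d] `&`
    [set y | forall i, List.In i s -> N i (y - x) < d]).
  apply: openI IH; apply/seminormed_openP => y /= yx.
  exists [set (fun x => (N i x)%:E)].
    by split; [exact: finite_set1|move=> _ ->; exists i].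
  exists (d - N i (y - x)); first by rewrite subr_gt0.
  move=> z /(_ _ (erefl _)); rewrite lte_fin => zy /=.
  by apply: le_lt_trans (N_tri i z y x) _; rewrite -ltrBrDr.
apply/seteqP; split => y /= h; first by split=> [|j js]; apply: h; [left|right].
by move=> j [<-|]; [exact: h.1|exact: h.2].
Qed.

(** On S every Q-seminorm of a difference is controlled by finitely many N_i. Balls of the N_i are
    open by the triangle inequality, so the largest P-open set whose trace lies in U recovers the
    trace of U. *)
Lemma trace_topology_seminormed (Q : set (V -> \bar R)) (S : set V) :
  @open (seminormed P) `<=` @open (seminormed Q) ->
  (forall f, Q f -> forall e : R, 0 < e -> exists s : list I, exists2 d : R, 0 < d &
    forall x y, S x -> S y -> (forall i, List.In i s -> N i (y - x) < d) ->
      (f (y - x)%R < e%:E)%E) ->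
  @trace_topology (seminormed P) S = @trace_topology (seminormed Q) S.
Proof.
move=> PQ QP; apply/seteqP; split=> _ [U oU <-].
  by exists U => //; exact: PQ.
pose W := \bigcup_(A in [set A | @open (seminormed P) A /\ A `&` S `<=` U]) A.
exists W.
  by apply: bigcup_open => A [].
apply/seteqP; split=> x [].
  by move=> [A [_ AU] Ax] Sx; split=> //; apply: AU.
move=> Ux Sx; split=> //.
have [F [/finite_seqP[l ->] lQ] [e e0 FU]] := (seminormed_openP _ _).1 oU _ Ux.
have [s [d d0 sP]] : exists s : list I, exists2 d : R, 0 < d & forall y, S y ->
    (forall i, List.In i s -> N i (y - x) < d) -> forall f, f \in l -> (f (y - x)%R < e%:E)%E.
  elim: l lQ {FU} => [_|f l IH flQ]; first by exists nil, 1.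
  have [|s [d d0 sP]] := IH; first by move=> g gl; apply: flQ; rewrite /= inE gl orbT.
  have [|t [c c0 tP]] := QP f _ e e0; first by apply: flQ; rewrite /= inE eqxx.
  exists (s ++ t), (Num.min d c); first by rewrite lt_min d0.
  move=> y Sy yst g; rewrite inE => /predU1P[->|].
    apply: tP => // i it; have := yst i; rewrite List.in_app_iff => /(_ (or_intror it)).
    by rewrite lt_min => /andP[].
  apply: sP => // i is_; have := yst i; rewrite List.in_app_iff => /(_ (or_introl is_)).
  by rewrite lt_min => /andP[].
exists [set y | forall i, List.In i s -> N i (y - x) < d].
  split; first exact: open_seminorm_ball.
  by move=> y [ys Sy]; apply: FU => f; exact: sP.
by move=> i _; rewrite /= subrr N_refl.
Qed.

End TraceTopologies.

Section BoundedSubsets.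
Context (R : realType) (H : hilbertType R) (infH : infinite_dimensional H).
Implicit Types (x y z T : bop H) (p q : \bar R) (n m : nat).
Local Notation sv := singular_values.

(** Split y into P y and (1 - P) y with P a finite-rank projection: the second part is small in
    norm, and x P y is governed by the values of x on the vectors spanning the range of P. *)
Lemma nop_small_on_vectors y (M e : R) : compact_operator y -> 0 <= M -> 0 < e ->
  exists (s : seq H), exists2 d : R, 0 < d & forall x, nop x <= M ->
    (forall v, v \in s -> rnorm (x v) < d) -> nop (bop_comp x y) <= e.
Proof.
move=> cy M0 e0; pose c := e / 2 / (M + 1).
have M1 : 0 < M + 1 by lra.
have c0 : 0 < c by rewrite !divr_gt0.
(* The adjoint of y is used because (1 - P) y has the same norm as adjoint y composed with 1 - P. *)
have [n /approx_proj[h oh hy]] := (compact_approx _).1 (compact_adjoint cy) _ c0.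
pose K := (size h)%:R * nop y.
have K0 : 0 <= K by rewrite mulr_ge0 ?nop_ge0.
have K1 : 0 < K + 1 by lra.
exists h, (e / 2 / (K + 1)); first by rewrite !divr_gt0.
move=> x xM xh; apply: nop_le; first exact: ltW.
move=> w; pose z := y w - proj id h (y w).
have nz : rnorm z <= c * rnorm w.
  apply: rnorm_le_hdot; first by rewrite mulr_ge0// ltW.
  have -> : hdot z z = hdot w (adjoint y (z - proj id h z)).
    by rewrite {1}/z -hdot_adjoint hdotBr hdotBl hdot_projC.
  apply: (le_trans (cauchy_schwarz _ _)).
  have -> : c * rnorm w * rnorm z = rnorm w * (c * rnorm z) by ring.
  apply: ler_wpM2l => //; apply: (le_trans (hy z)); apply: ler_wpM2l; first exact: ltW.
  exact: rnorm_proj_compl.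
have np : rnorm (x (proj id h (y w))) <= K * (e / 2 / (K + 1)) * rnorm w.
  rewrite bop_sum; apply: (le_trans (rnorm_sum _ _ _)).
  have -> : K * (e / 2 / (K + 1)) * rnorm w =
      \sum_(u <- h) nop y * rnorm w * (e / 2 / (K + 1)).
    rewrite big_const_seq count_predT iter_addr_0 -mulr_natl /K; ring.
  rewrite big_seq [leRHS]big_seq; apply: ler_sum => u uh; rewrite bopZ rnormZ.
  apply: ler_pM => //; last exact/ltW/xh.
  apply: (le_trans (cauchy_schwarz _ _)).
  by rewrite (@orthonormal_norm _ _ _ id h u oh uh) mulr1 rnorm_bop.
rewrite bop_compE -[y w](subrK (proj id h (y w))) -/z bopD.
apply: (le_trans (rnormD _ _)).
have h1 : rnorm (x z) <= M * (c * rnorm w).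
  by apply: (le_trans (rnorm_bop _ _)); apply: ler_pM; rewrite ?nop_ge0.
have h2 : M * (c * rnorm w) <= e / 2 * rnorm w.
  rewrite mulrA; apply: ler_wpM2r => //; rewrite /c mulrA ler_pdivrMr// mulrC.
  by apply: ler_wpM2l; [rewrite divr_ge0// ltW|lra].
have h3 : K * (e / 2 / (K + 1)) * rnorm w <= e / 2 * rnorm w.
  apply: ler_wpM2r => //; rewrite mulrA ler_pdivrMr// mulrC.
  by apply: ler_wpM2l; [rewrite divr_ge0// ltW|lra].
by move: np h1 h2 h3; clear; move: (K * _ * _) (M * _) => a b; lra.
Qed.

(** Dominated convergence: beyond N the singular values of x y are at most M times those of y, a
    small tail; the first N are at most the operator norm of x y, made small by
    [nop_small_on_vectors]. *)
Lemma schatten_small_on_vectors p y (M e : R) : (1 <= p)%E -> schatten_ideal p y ->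
  0 <= M -> 0 < e -> exists (s : seq H), exists2 d : R, 0 < d & forall x, nop x <= M ->
    (forall v, v \in s -> rnorm (x v) < d) -> (schatten_norm p (bop_comp x y) < e%:E)%E.
Proof.
move=> p1 yp M0 e0; have cy : compact_operator y := yp.1.
have e20 : 0 < e / 2 by rewrite divr_gt0.
have lte : ((e / 2)%:E < e%:E)%E by rewrite lte_fin; lra.
have [p_infty|[r r1 pr]] := schatten_cases p1.
  have [s [d d0 sP]] := nop_small_on_vectors cy M0 e20.
  exists s, d => // x xM xs; rewrite p_infty schatten_pinfty lte_fin.
  by apply: le_lt_trans (sP x xM xs) _; lra.
subst p; have r0 : 0 < r by lra.
have /schatten_idealP[_ [C C0 yC]] := yp.
have yC' := (schatten_leP y r1 C0).1 yC.
have [||N NP] := nondecreasing_bounded_tail (a := fun n => \sum_(k < n) sv y k `^ r) _ yC'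
  (e := (e / 2) `^ r / (2 * (M `^ r + 1))) _.
- by apply: homo_leq => [//|k m n|n]; [exact: le_trans|rewrite big_ord_recr lerDl powR_ge0].
- by rewrite divr_gt0 ?powR_gt0// mulr_gt0// ltr_wpDl ?powR_ge0.
pose E := (e / 2) `^ r; have E0 : 0 < E by exact: powR_gt0.
pose eta := (E / (2 * (N%:R + 1))) `^ r^-1.
have N0 : 0 < 2 * (N%:R + 1) :> R by rewrite mulr_gt0// ltr_wpDl.
have eta0 : 0 < eta by rewrite powR_gt0// divr_gt0.
have etar : eta `^ r = E / (2 * (N%:R + 1)) by rewrite powRVK// divr_ge0// ltW.
have [s [d d0 sP]] := nop_small_on_vectors cy M0 eta0.
exists s, d => // x xM xs; apply: le_lt_trans lte.
have cxy : compact_operator (bop_comp x y) by exact: compact_compl.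
have nxy := sP x xM xs.
apply/(schatten_leP _ r1 (ltW e20)) => n; rewrite -/E.
pose b k := sv (bop_comp x y) k `^ r.
have b0 k : 0 <= b k by exact: powR_ge0.
have bN k : b k <= eta `^ r.
  apply: ge0_ler_powR; [exact: ltW|rewrite nnegrE; exact: sv_ge0|rewrite nnegrE; exact: ltW|].
  by apply: le_trans nxy; exact: sv_le_nop.
have bM k : b k <= M `^ r * sv y k `^ r.
  rewrite -powRM ?sv_ge0//; apply: ge0_ler_powR.
  - exact: ltW.
  - rewrite nnegrE; exact: sv_ge0.
  - by rewrite nnegrE; apply: mulr_ge0 => //; exact: sv_ge0.
  - apply: le_trans (sv_compl infH _ _ cy) _; apply: ler_wpM2r => //; exact: sv_ge0.
apply: (@le_trans _ _ (\sum_(k < N + n) b k)).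
  by rewrite addnC big_split_ord /= lerDl sumr_ge0.
rewrite big_split_ord /=.
have h1 : \sum_(i < N) b i <= E / 2.
  apply: (@le_trans _ _ (\sum_(i < N) eta `^ r)); first by apply: ler_sum => i _; exact: bN.
  rewrite sumr_const card_ord -[leLHS]mulr_natl etar [leLHS]mulrA ler_pdivrMr//.
  have : 0 <= N%:R :> R by exact: ler0n.
  by move: (N%:R) E0; clear => t E0 t0; nra.
have h2 : \sum_(i < n) b (N + i)%N <= E / 2.
  apply: (@le_trans _ _ (M `^ r * \sum_(i < n) sv y (N + i)%N `^ r)).
    by rewrite mulr_sumr; apply: ler_sum => i _; exact: bM.
  have := NP N (N + n)%N (leqnn _) (leq_addr _ _).
  rewrite big_split_ord /= [X in X - _]addrC addrK -/E => /ltW h.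
  have Mr0 : 0 <= M `^ r by exact: powR_ge0.
  apply: (le_trans (ler_wpM2l Mr0 h)); move: (M `^ r) Mr0 E0; clear => m m0 E0.
  rewrite mulrA ler_pdivrMr; last lra.
  nra.
by move: h1 h2; move: (\sum_(i < N) _) (\sum_(i < n) _) => t u; lra.
Qed.

End BoundedSubsets.

Lemma mem_List_In (T : eqType) (x : T) (s : seq T) : x \in s -> List.In x s.
Proof.
elim: s => // y s IH; rewrite inE => /predU1P[->|/IH]; [by left|by right].
Qed.

Section StrongOperatorTopologies.
Context (R : realType) (H : hilbertType R) (infH : infinite_dimensional H).
Implicit Types (x y z T : bop H) (u v : H) (p q : \bar R).

Lemma nopB x y : nop (x - y) <= nop x + nop y.
Proof.
apply: (le_trans (nopD _ _)); rewrite lerD2l -scaleN1r.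
by apply: (le_trans (nopZ _ _)); rewrite cabsN cabs1 mul1r.
Qed.

Definition sot_norm v x : R := rnorm (x v).

Definition sot_star_norm (i : H + H) x : R :=
  match i with inl v => rnorm (x v) | inr v => rnorm (adjoint x v) end.

Definition sot : set (bop H -> \bar R) := range (fun v x => (sot_norm v x)%:E).

Definition sot_star : set (bop H -> \bar R) := range (fun i x => (sot_star_norm i x)%:E).

Lemma sot_tri v x y z : sot_norm v (x - z) <= sot_norm v (x - y) + sot_norm v (y - z).
Proof. by rewrite /sot_norm !bop_subE rnorm_tri. Qed.

Lemma sot_star_tri i x y z :
  sot_star_norm i (x - z) <= sot_star_norm i (x - y) + sot_star_norm i (y - z).
Proof. by case: i => v; rewrite /sot_star_norm ?adjointB !bop_subE rnorm_tri. Qed.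

Lemma sot_norm0 v : sot_norm v 0 = 0.
Proof. exact: rnorm0. Qed.

Lemma adjoint0 : adjoint (0 : bop H) = 0.
Proof. by rewrite -[X in adjoint X](subrr 0) adjointB subrr. Qed.

Lemma sot_star_norm0 i : sot_star_norm i 0 = 0.
Proof. by case: i => v; rewrite /sot_star_norm ?adjoint0; exact: rnorm0. Qed.

Lemma unit_vector_ex : exists u : H, rnorm u = 1.
Proof. by have [u [u1 _]] := infdim_perp [::] infH; exists u. Qed.

(** The multiplier is [rank1 v u] with u a unit vector: its product with x has operator norm |x
    v|. *)
Lemma sot_dominated p v (e : R) : (1 <= p)%E ->
  exists2 f, left_seminorms p f & forall x, (f x < e%:E)%E -> rnorm (x v) < e.
Proof.
move=> p1; have [u u1] := unit_vector_ex.
exists (fun x => schatten_norm p (bop_comp x (rank1 v u))).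
  by exists (rank1 v u) => //; exact: schatten_ideal_rank1.
move=> x; rewrite comp_rank1 => /(nop_lt_schatten infH p1 (@compact_rank1 _ _ _ _)).
by rewrite nop_rank1 u1 mulr1.
Qed.

Lemma sot_adjoint_dominated p v (e : R) : (1 <= p)%E ->
  exists2 f, right_seminorms p f & forall x, (f x < e%:E)%E -> rnorm (adjoint x v) < e.
Proof.
move=> p1; have [u u1] := unit_vector_ex.
exists (fun x => schatten_norm p (bop_comp (rank1 u v) x)).
  by exists (rank1 u v) => //; exact: schatten_ideal_rank1.
move=> x; rewrite rank1_comp => /(nop_lt_schatten infH p1 (@compact_rank1 _ _ _ _)).
by rewrite nop_rank1 u1 mul1r.
Qed.

Lemma sot_le_mu p : (1 <= p)%E -> @open (seminormed sot) `<=` @open (mu_top H p).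
Proof.
move=> p1; apply: dominated_open => _ [v _ <-] e e0.
have [f fp fP] := sot_dominated v e p1.
exists [set f]; first by split; [exact: finite_set1|move=> _ ->].
by exists e => // x /(_ _ (erefl _))/fP; rewrite lte_fin.
Qed.

Lemma sot_star_le_mu_star p : (1 <= p)%E ->
  @open (seminormed sot_star) `<=` @open (mu_star_top H p).
Proof.
move=> p1; apply: dominated_open => _ [[v|v] _ <-] e e0.
  have [f fp fP] := sot_dominated v e p1.
  exists [set f]; first by split; [exact: finite_set1|move=> _ ->; left].
  by exists e => // x /(_ _ (erefl _))/fP; rewrite lte_fin.
have [f fp fP] := sot_adjoint_dominated v e p1.
exists [set f]; first by split; [exact: finite_set1|move=> _ ->; right].
by exists e => // x /(_ _ (erefl _))/fP; rewrite lte_fin.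
Qed.

Lemma norm_bounded_diff (S : set (bop H)) : norm_bounded S -> exists2 M : R, 0 <= M &
  forall x y, S x -> S y -> nop (y - x) <= M.
Proof.
move=> /norm_boundedP[M SM]; exists (`|M| + `|M|); first by rewrite addr_ge0.
move=> x y /SM xM /SM yM; apply: (le_trans (nopB _ _)).
by apply: lerD; [apply: (le_trans yM)|apply: (le_trans xM)]; exact: ler_norm.
Qed.

Lemma trace_mu_sot p (S : set (bop H)) : (1 <= p)%E -> norm_bounded S ->
  @trace_topology (seminormed sot) S = @trace_topology (mu_top H p) S.
Proof.
move=> p1 /norm_bounded_diff[M M0 SM].
apply: (trace_topology_seminormed sot_tri sot_norm0); first exact: sot_le_mu.
move=> _ [y yp <-] e e0.
have [s [d d0 sP]] := schatten_small_on_vectors infH p1 yp M0 e0.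
exists s, d => // a b Sa Sb h; apply: sP; first exact: SM.
by move=> v /mem_List_In; exact: h.
Qed.

Lemma trace_mu_star_sot_star p (S : set (bop H)) : (1 <= p)%E -> norm_bounded S ->
  @trace_topology (seminormed sot_star) S = @trace_topology (mu_star_top H p) S.
Proof.
move=> p1 /norm_bounded_diff[M M0 SM].
apply: (trace_topology_seminormed sot_star_tri sot_star_norm0); first exact: sot_star_le_mu_star.
move=> _ [[y yp <-]|[y yp <-]] e e0.
  have [s [d d0 sP]] := schatten_small_on_vectors infH p1 yp M0 e0.
  exists (map inl s), d => // a b Sa Sb h; apply: sP; first exact: SM.
  by move=> v /mem_List_In vs; apply: (h (inl v)); exact: List.in_map.
have [s [d d0 sP]] := schatten_small_on_vectors infH p1 (schatten_ideal_adjoint infH yp) M0 e0.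
exists (map inr s), d => // a b Sa Sb h.
have cy : compact_operator y := yp.1.
rewrite -(schatten_adjoint infH p (@compact_compr _ _ _ (b - a) cy)) adjoint_comp.
apply: sP; first by rewrite nop_adjoint; exact: SM.
by move=> v /mem_List_In vs; apply: (h (inr v)); exact: List.in_map.
Qed.

End StrongOperatorTopologies.

Section BoundedSets.
Context (R : realType) (H : hilbertType R) (infH : infinite_dimensional H).
Implicit Types (x y z T : bop H) (u v : H) (p q : \bar R).

Lemma schatten_common_bound p (ys : seq (bop H)) :
  (forall y, y \in ys -> schatten_ideal p y) ->
  exists2 C : R, 0 <= C & forall y, y \in ys -> (schatten_norm p y <= C%:E)%E.
Proof.
elim: ys => [_|y ys IH ysP]; first by exists 0.
have [|C C0 CP] := IH; first by move=> z zys; apply: ysP; rewrite inE zys orbT.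
have /schatten_idealP[_ [D D0 yD]] := ysP y (mem_head _ _).
exists (C + D); first exact: addr_ge0.
move=> z; rewrite inE => /predU1P[->|/CP zC].
  by apply: (le_trans yD); rewrite lee_fin lerDr.
by apply: (le_trans zC); rewrite lee_fin lerDl.
Qed.

Lemma norm_bounded_tvs_bounded p (Q : set (bop H -> \bar R)) (S : set (bop H)) : (1 <= p)%E ->
  Q `<=` left_seminorms p `|` right_seminorms p -> norm_bounded S ->
  @tvs_bounded R (seminormed Q) S.
Proof.
move=> p1 QP /norm_boundedP[M0 SM0] U /nbhs0_seminormed[F [finF FQ] [e e0 FU]].
have [M M_ge0 SM] : exists2 M : R, 0 <= M & forall x, S x -> nop x <= M.
  by exists `|M0| => // x /SM0 h; exact: le_trans (ler_norm _).
have [ys [zs [ysP zsP Fyz]]] := finite_bilateral finF (subset_trans FQ QP).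
have [C C0 CP] := schatten_common_bound ysP.
have [D D0 DP] := schatten_common_bound zsP.
pose K := M * (C + D) + 1.
have CD0 : 0 <= M * (C + D) by rewrite mulr_ge0 ?addr_ge0.
have K0 : 0 < K by rewrite /K; lra.
exists (K / e); first exact: divr_gt0.
move=> a; rewrite cabsE lecR => Ka x Sx.
have a0 : 0 < cabs a by apply: lt_le_trans Ka; exact: divr_gt0.
have an0 : a != 0 by rewrite -cabs_gt0.
exists (a^-1 *: x); last by rewrite scalerA mulfV// scale1r.
apply: FU => f Ff.
have nx : nop (a^-1 *: x) <= M / cabs a.
  apply: (le_trans (nopZ _ _)); rewrite cabsV mulrC.
  by apply: ler_wpM2r; [rewrite invr_ge0|exact: SM].
have fin (c : R) : 0 <= c -> c <= C + D -> nop (a^-1 *: x) * c < e.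
  move=> c0 cCD; apply: (@le_lt_trans _ _ (M / cabs a * (C + D))).
    by apply: ler_pM; rewrite ?nop_ge0.
  rewrite mulrAC ltr_pdivrMr//; apply: (@lt_le_trans _ _ K); first by rewrite /K; lra.
  by move: Ka; rewrite ler_pdivrMr// mulrC.
case: (Fyz f Ff) => [[y yys ->]|[z zzs ->]].
  apply: le_lt_trans (schatten_compl infH (a^-1 *: x) p1 (ysP y yys).1 C0 (CP y yys)) _.
  by rewrite lte_fin fin// lerDl.
apply: le_lt_trans (schatten_compr infH (a^-1 *: x) p1 (zsP z zzs).1 D0 (DP z zzs)) _.
by rewrite lte_fin fin// lerDr.
Qed.

Lemma tvs_bounded_norm_bounded (Q : set (bop H -> \bar R)) (S : set (bop H)) :
  @open (seminormed (@sot R H)) `<=` @open (seminormed Q) ->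
  @tvs_bounded R (seminormed Q) S -> norm_bounded S.
Proof.
move=> sotQ bS; apply/norm_boundedP/uniform_boundedness => v.
pose U : set (bop H) := [set x | forall i, List.In i [:: v] -> sot_norm i (x - 0) < 1].
have oU : @open (seminormed Q) U.
  by apply: sotQ; apply: (open_seminorm_ball (@sot_tri R H)).
have [|r r0 rS] := bS U.
  apply: open_nbhs_nbhs; split=> // i _.
  by rewrite subr0 sot_norm0.
exists r => T ST.
have [|x Ux <-] := rS r%:C%C _ T ST.
  by rewrite ger0_norm// ler0c ltW.
rewrite bop_scaleE rnormZ cabsR ger0_norm ?(ltW r0)//.
have := Ux v (or_introl (erefl _)); rewrite /sot_norm subr0 => xv.
by rewrite ler_piMr ?ltW.
Qed.

Lemma tvs_boundedP p (S : set (bop H)) : (1 <= p)%E ->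
  (@tvs_bounded R (mu_top H p) S <-> norm_bounded S) /\
  (@tvs_bounded R (mu_star_top H p) S <-> norm_bounded S).
Proof.
move=> p1; split; split.
- by apply: tvs_bounded_norm_bounded; exact: sot_le_mu.
- by apply: (norm_bounded_tvs_bounded (p := p)) => // f; left.
- apply: tvs_bounded_norm_bounded; apply: subset_trans (@mu_top_le_star R H p).
  exact: sot_le_mu.
- exact: (norm_bounded_tvs_bounded (p := p)).
Qed.

End BoundedSets.

(** * Traces and continuous functionals *)

From mathcomp Require Import finmap showcase.summability.

Section OrthonormalBases.
Context (R : realType) (H : hilbertType R).
Implicit Types (E F : set H) (J A : seq H) (a b v w : H).

Lemma orthonormal_basis_ex : exists E : set H, orthonormal_basis E.
Proof.
have [F FP tF|E [oE maxE]] := @Zorn_bigcup H (@orthonormal_set R H).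
  move=> e f [X FX Xe] [Y FY Yf].
  have [XY|YX] := tF _ _ FX FY; first exact: (FP _ FY) (XY _ Xe) Yf.
  exact: (FP _ FX) Xe (YX _ Yf).
exists E; split=> // F oF EF; apply/seteqP; split=> //.
by apply: contrapT => FE; apply: (maxE F) => //; split.
Qed.

Definition subset_list E J := uniq J /\ forall e, e \in J -> E e.

Lemma subset_list_orthonormal E J : orthonormal_set E -> subset_list E J -> orthonormal id J.
Proof. by move=> oE [uJ JE]; split=> // e f /JE Ee /JE Ef; exact: oE. Qed.

Lemma subset_listU E J A : subset_list E J -> subset_list E A -> subset_list E (undup (J ++ A)).
Proof.
move=> [uJ JE] [uA AE]; split; first exact: undup_uniq.
by move=> e; rewrite mem_undup mem_cat => /orP[/JE|/AE].
Qed.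

Lemma basis_perp E v : orthonormal_basis E -> (forall e, E e -> hdot v e = 0) -> v = 0.
Proof.
move=> [oE maxE] vE; apply/eqP/negPn/negP => v0.
pose u := (rnorm v)^-1%:C%C *: v.
have nu : hdot u u = 1 by rewrite hdotxx rnorm_unit// expr1n.
have uE e : E e -> hdot u e = 0 by move=> /vE h; rewrite hdotZl h mulr0.
have Eu : ~ E u by move=> /uE; rewrite nu => /eqP; rewrite oner_eq0.
apply: Eu; rewrite -(maxE (E `|` [set u])); [by right| |by left].
have eu e : E e -> (e == u) = false.
  by move=> Ee; apply/eqP => eu; have := uE _ Ee; rewrite eu nu => /eqP; rewrite oner_eq0.
move=> e f [Ee|->] [Ef|->].
- exact: oE.
- by rewrite (hdot_eq0 (uE _ Ee)) eu.
- by rewrite uE// eq_sym eu.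
- by rewrite eqxx.
Qed.

(** Choose finite subsets of E with nearly maximal Bessel sums. For J containing such a subset, the
    squared distance of the two projections is the difference of the sums, so the projections are
    Cauchy; the limit b is a, as a - b is orthogonal to E. *)
Lemma basis_complete E a (d : R) : orthonormal_basis E -> 0 < d ->
  exists2 A, subset_list E A & forall J, subset_list E J -> {subset A <= J} ->
    rnorm (a - proj id J a) < d.
Proof.
move=> bE d0; have [oE _] := bE.
pose S J := \sum_(e <- J) cabs (hdot a e) ^+ 2.
pose X := [set S J | J in subset_list E].
have supX : has_sup X.
  split; first by exists (S [::]), [::].
  exists (rnorm a ^+ 2) => _ [J EJ <-].
  exact: (bessel a (subset_list_orthonormal oE EJ)).
have Ssup J : subset_list E J -> S J <= sup X.
  by move=> EJ; apply: ub_le_sup; [exact: supX.2|exists J].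
have SU J A : subset_list E J -> subset_list E A -> {subset A <= J} ->
    rnorm (proj id J a - proj id A a) ^+ 2 = S J - S A.
  move=> EJ EA AJ; have oJ := subset_list_orthonormal oE EJ.
  have oA := subset_list_orthonormal oE EA.
  have pJ := proj_pythagoras a oJ; have pA := proj_pythagoras a oA.
  have : hdot (a - proj id J a) (proj id J a - proj id A a) = 0.
    rewrite hdotBr (proj_perp_proj _ _ oJ) hdot_sumr big_seq big1 ?subrr// => e /AJ eJ.
    by rewrite hdotZr (proj_perp _ oJ eJ) mulr0.
  move=> /pythagoras; rewrite addrA subrK; rewrite -/(S J) -/(S A) in pJ pA.
  move: pJ pA; clear.
  by move: (rnorm _ ^+ 2) (rnorm _ ^+ 2) (rnorm _ ^+ 2) (rnorm _ ^+ 2) => x y z t; lra.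
have /choice[Js JsP] : forall n : nat, exists J, subset_list E J /\ sup X - n.+1%:R^-1 < S J.
  move=> n; have : sup X - n.+1%:R^-1 < sup X by rewrite ltrBlDr ltrDl invr_gt0.
  by move=> /(sup_gt supX.1)[_ [J EJ <-] h]; exists J.
pose u n := proj id (Js n) a.
have near J n : subset_list E J -> {subset Js n <= J} ->
    rnorm (proj id J a - u n) ^+ 2 <= n.+1%:R^-1.
  move=> EJ nJ; have [En hn] := JsP n; rewrite (SU J _ EJ En nJ).
  have := Ssup J EJ; move: hn; move: (n.+1%:R^-1) => x; lra.
have small (c : R) : 0 < c -> exists N : nat, forall J n, (N <= n)%N -> subset_list E J ->
    {subset Js n <= J} -> rnorm (proj id J a - u n) < c.
  move=> c0; have c20 : 0 < c ^+ 2 by rewrite exprn_gt0.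
  have [N NP] := small_invS c20; exists N => J n Nn EJ nJ.
  rewrite -(@ltr_pXn2r _ 2) ?nnegrE ?(ltW c0)//.
  exact: le_lt_trans (near _ _ EJ nJ) (NP n Nn).
have [c c0|b ub] := rnorm_cauchy (u := u).
  have c20 : 0 < c / 2 by rewrite divr_gt0.
  have [N NP] := small _ c20; exists N => n m Nn Nm.
  have EU := subset_listU (JsP n).1 (JsP m).1.
  have h1 : rnorm (proj id (undup (Js n ++ Js m)) a - u n) < c / 2.
    by apply: NP => // e eJ; rewrite mem_undup mem_cat eJ.
  have h2 : rnorm (proj id (undup (Js n ++ Js m)) a - u m) < c / 2.
    by apply: NP => // e eJ; rewrite mem_undup mem_cat eJ orbT.
  rewrite (le_lt_trans (rnorm_tri (proj id (undup (Js n ++ Js m)) a) _ _))//.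
  by rewrite (rnormC (u n)); lra.
have ab : a = b.
  apply/eqP; rewrite -subr_eq0; apply/eqP/(basis_perp bE) => e Ee.
  apply: cabs_small => c c0; have c20 : 0 < c / 2 by rewrite divr_gt0.
  have [N NP] := small _ c20; have [N' NP'] := ub _ c20.
  pose n := maxn N N'; pose J := undup (Js n ++ [:: e]).
  have EJ : subset_list E J.
    by apply: subset_listU (JsP n).1 _; split=> // f; rewrite inE => /eqP ->.
  have eJ : e \in J by rewrite mem_undup mem_cat inE eqxx orbT.
  have h1 : rnorm (proj id J a - u n) < c / 2.
    by apply: NP; rewrite ?leq_maxl// => f fJ; rewrite mem_undup mem_cat fJ.
  have h2 := NP' n (leq_maxr _ _).
  have -> : hdot (a - b) e = hdot (proj id J a - b) e.
    have := proj_perp a (subset_list_orthonormal oE EJ) eJ.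
    rewrite !hdotBl => /eqP; rewrite subr_eq0 => /eqP -> //.
  rewrite (le_trans (cauchy_schwarz _ _))// (@orthonormal_norm _ _ _ id J e) ?mulr1//.
    rewrite (le_trans (rnorm_tri (u n) _ _))// (rnormC (u n)); lra.
  exact: subset_list_orthonormal EJ.
have d20 : 0 < d / 2 by rewrite divr_gt0.
have [N NP] := small _ d20; have [N' NP'] := ub _ d20.
pose n := maxn N N'; exists (Js n); first exact: (JsP n).1.
move=> J EJ nJ; have h1 := NP J n (leq_maxl _ _) EJ nJ.
have h2 := NP' n (leq_maxr _ _); rewrite {1}ab.
rewrite (le_lt_trans (rnorm_tri (u n) _ _))// (rnormC (u n)); lra.
Qed.

End OrthonormalBases.

Section Trace.
Context (R : realType) (H : hilbertType R).
Implicit Types (T : bop H) (J A : seq H) (u v : H) (l : R[i]).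

Definition trace_basis : set H := xget set0 (@orthonormal_basis R H).

Lemma trace_basisP : orthonormal_basis trace_basis.
Proof.
have [E EP] := @orthonormal_basis_ex R H; rewrite /trace_basis.
by case: xgetP => [//|/(_ E)].
Qed.

(** Unordered convergence of the diagonal sums, with lists for finite subsets of the basis;
    [op_traceE] reads off [op_trace] from it. *)
Definition has_trace T l := forall d : R, 0 < d -> exists2 A, subset_list trace_basis A &
  forall J, subset_list trace_basis J -> {subset A <= J} ->
    cabs (\sum_(e <- J) hdot (T e) e - l) < d.

Lemma has_trace_linear a S T l m : has_trace S l -> has_trace T m ->
  has_trace (a *: S + T) (a * l + m).
Proof.
move=> Sl Tm d d0; have d20 : 0 < d / 2 by rewrite divr_gt0.
have a0 : 0 < cabs a + 1 by have := cabs_ge0 a; lra.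
have [A EA AP] := Sl _ (divr_gt0 d20 a0); have [B EB BP] := Tm _ d20.
exists (undup (A ++ B)); first exact: subset_listU.
move=> J EJ ABJ.
have h1 : cabs (\sum_(e <- J) hdot (S e) e - l) < d / 2 / (cabs a + 1).
  by apply: AP => // e eA; apply: ABJ; rewrite mem_undup mem_cat eA.
have h2 : cabs (\sum_(e <- J) hdot (T e) e - m) < d / 2.
  by apply: BP => // e eB; apply: ABJ; rewrite mem_undup mem_cat eB orbT.
have -> : \sum_(e <- J) hdot ((a *: S + T) e) e - (a * l + m) =
    a * (\sum_(e <- J) hdot (S e) e - l) + (\sum_(e <- J) hdot (T e) e - m).
  rewrite mulrBr mulr_sumr opprD addrACA -big_split /=; congr (_ + _).
  by apply: eq_bigr => e _; rewrite hdotDl hdotZl.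
apply: (le_lt_trans (cabsD _ _)); rewrite cabsM.
move: h1; rewrite ltr_pdivlMr// => h1.
have := cabs_ge0 (\sum_(e <- J) hdot (S e) e - l).
move: h1 h2; move: (cabs (_ - l)) (cabs (_ - m)) => x y; nra.
Qed.

Lemma has_trace0 : has_trace 0 0.
Proof.
move=> d d0; exists [::]; first by split.
by move=> J _ _; rewrite big1 ?subr0 ?cabs0// => e _; exact: hdot0l.
Qed.

Lemma has_trace_rank1 u v : has_trace (rank1 u v) (hdot u v).
Proof.
move=> d d0; have v1 : 0 < rnorm v + 1 by have := rnorm_ge0 v; lra.
have [A EA AP] := basis_complete u trace_basisP (divr_gt0 d0 v1).
exists A => // J EJ /(AP J EJ) h; rewrite cabsC.
have -> : hdot u v - \sum_(e <- J) hdot (rank1 u v e) e = hdot (u - proj id J u) v.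
  rewrite hdotBl hdot_suml; congr (_ - _); apply: eq_bigr => e _.
  by rewrite rank1E !hdotZl mulrC.
apply: (le_lt_trans (cauchy_schwarz _ _)); move: h; rewrite ltr_pdivlMr//.
have := rnorm_ge0 (u - proj id J u); nra.
Qed.

(** Smallness of T - S uniformly over all finite orthonormal lists carries the unordered limit from
    S to T. *)
Lemma has_trace_approx T l : (forall d : R, 0 < d -> exists S m, [/\ has_trace S m,
    cabs (m - l) <= d & forall J, orthonormal id J ->
    cabs (\sum_(e <- J) hdot ((T - S) e) e) <= d]) -> has_trace T l.
Proof.
move=> h d d0; have d40 : 0 < d / 4 by rewrite divr_gt0.
have [S [m [Sm ml TS]]] := h _ d40; have [A EA AP] := Sm _ d40; exists A => // J EJ AJ.
have h1 := AP J EJ AJ; have h2 := TS J (subset_list_orthonormal trace_basisP.1 EJ).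
have -> : \sum_(e <- J) hdot (T e) e - l = \sum_(e <- J) hdot ((T - S) e) e +
    ((\sum_(e <- J) hdot (S e) e - m) + (m - l)).
  rewrite [_ - m + _]addrA subrK addrA -big_split /=; congr (_ - _).
  by apply: eq_bigr => e _; rewrite hdotBl subrK.
apply: (le_lt_trans (cabsD _ _)); have := cabsD (\sum_(e <- J) hdot (S e) e - m) (m - l).
lra.
Qed.

Lemma op_traceE T l : has_trace T l -> op_trace T = l.
Proof.
move=> Tl; rewrite /op_trace /summability.sum -/trace_basis.
apply: (@cvg_lim R[i]^o); first exact: norm_hausdorff.
  exact: totally_filter.
move=> U /rnorm_nbhs[d d0 dU]; have [A EA AP] := Tl _ d0.
exists (seq_fset tt A) => // B AB; apply: dU.
rewrite /partial_sum -(big_seq_fsetE _ _ xpredT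
  (fun e => if e \in trace_basis then hdot (T e) e else 0)) /=.
rewrite -big_mkcond -big_filter.
rewrite -[rnorm _]/(cabs _) cabsC; apply: AP.
  split; first by rewrite filter_uniq// fset_uniq.
  by move=> e; rewrite mem_filter => /andP[/set_mem].
move=> e eA; rewrite mem_filter (mem_set (EA.2 e eA)) /=.
by apply: (fsubsetP AB); rewrite seq_fsetE.
Qed.

End Trace.

Section FiniteRank.
Context (R : realType) (H : hilbertType R).
Implicit Types (S T x y z : bop H) (u v w : H) (h : seq H).

Lemma bop_sumE (I : Type) (r : seq I) (P : pred I) (F : I -> bop H) v :
  (\sum_(i <- r | P i) F i) v = \sum_(i <- r | P i) F i v.
Proof. exact: (big_morph (fun T : bop H => T v)). Qed.

Definition projop (I : eqType) (e : I -> H) (r : seq I) (oe : orthonormal e r) : bop H :=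
  Bop (projP oe).

Lemma projopE (I : eqType) (e : I -> H) (r : seq I) (oe : orthonormal e r) v :
  projop oe v = proj e r v.
Proof. by []. Qed.

Lemma comp_projop x (I : eqType) (e : I -> H) (r : seq I) (oe : orthonormal e r) :
  bop_comp x (projop oe) = \sum_(i <- r) rank1 (x (e i)) (e i).
Proof.
apply: bopP => v; rewrite bop_sumE bop_compE projopE bop_sum.
by apply: eq_bigr => i _; rewrite bopZ.
Qed.

Lemma adjoint_projop (I : eqType) (e : I -> H) (r : seq I) (oe : orthonormal e r) :
  adjoint (projop oe) = projop oe.
Proof. by apply: adjoint_uniq => x y; rewrite !projopE hdot_projC. Qed.

Lemma projop_comp x (I : eqType) (e : I -> H) (r : seq I) (oe : orthonormal e r) :
  bop_comp (projop oe) x = \sum_(i <- r) rank1 (e i) (adjoint x (e i)).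
Proof.
apply: bopP => v; rewrite bop_sumE bop_compE projopE.
by apply: eq_bigr => i _; rewrite rank1E hdot_adjoint.
Qed.

Lemma bop_compBr x S T : bop_comp x (S - T) = bop_comp x S - bop_comp x T.
Proof. by apply: bopP => v; rewrite bop_subE !bop_compE bop_subE bopB. Qed.

Lemma bop_compBl x S T : bop_comp (S - T) x = bop_comp S x - bop_comp T x.
Proof. by apply: bopP => v; rewrite bop_subE !bop_compE bop_subE. Qed.

Lemma bop_comp_linr a x S T : bop_comp x (a *: S + T) = a *: bop_comp x S + bop_comp x T.
Proof.
apply: bopP => v.
by rewrite bop_addE bop_scaleE !bop_compE bop_addE bop_scaleE bopD bopZ.
Qed.

Lemma bop_compA x y z : bop_comp x (bop_comp y z) = bop_comp (bop_comp x y) z.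
Proof. exact: bopP. Qed.

End FiniteRank.

(** * Traces of products with trace-class operators *)

Section TraceClass.
Context (R : realType) (H : hilbertType R) (infH : infinite_dimensional H).
Implicit Types (S T A t x y z : bop H) (u v w : H) (f : nat -> H).
Local Notation sv := singular_values.

(** Split each e_i along the first K right singular vectors f_n of A. Those parts regroup into K
    terms <P A f_n, f_n>, with P the projection on the e_i, each at most s_n; every remainder costs
    at most s_K. *)
Lemma trace_bound A (I : eqType) (e : I -> H) (r : seq I) K : compact_operator A ->
  orthonormal e r ->
  cabs (\sum_(i <- r) hdot (A (e i)) (e i)) <= \sum_(n < K) sv A n + (size r)%:R * sv A K.
Proof.
move=> cA oe; have [f sA] := singular_valuesP infH cA; have [of_ _ _ _ tailA] := sA.
have of_K := onseq_iota K of_.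
have -> : \sum_(i <- r) hdot (A (e i)) (e i) =
    \sum_(n <- iota 0 K) hdot (proj e r (A (f n))) (f n) +
    \sum_(i <- r) hdot (A (e i - proj f (iota 0 K) (e i))) (e i).
  have -> : \sum_(n <- iota 0 K) hdot (proj e r (A (f n))) (f n) =
      \sum_(i <- r) hdot (A (proj f (iota 0 K) (e i))) (e i).
    under eq_bigr do rewrite hdot_suml.
    rewrite exchange_big /=; apply: eq_bigr => i _; rewrite bop_sum hdot_suml.
    by apply: eq_bigr => n _; rewrite bopZ !hdotZl mulrC.
  by rewrite -big_split /=; apply: eq_bigr => i _; rewrite -hdotDl -bopD addrC subrK.
apply: (le_trans (cabsD _ _)); apply: lerD.
  apply: (le_trans (cabs_sum _ _ _)); rewrite -[K in iota 0 K]subn0 big_mkord.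
  apply: ler_sum => n _; apply: (le_trans (cauchy_schwarz _ _)).
  by rewrite (onseq_norm n of_) mulr1 -(svd_norm sA) rnorm_proj.
apply: (le_trans (cabs_sum _ _ _)).
have -> : (size r)%:R * sv A K = \sum_(i <- r) sv A K.
  by rewrite big_const_seq count_predT iter_addr_0 mulr_natl.
rewrite big_seq [leRHS]big_seq; apply: ler_sum => i ir.
apply: (le_trans (cauchy_schwarz _ _)); rewrite (orthonormal_norm oe ir) mulr1.
have h : rnorm (A (e i - proj f (iota 0 K) (e i))) <=
    sv A K * rnorm (e i - proj f (iota 0 K) (e i)).
  by apply: tailA => j jK; apply: proj_perp; rewrite ?mem_iota.
apply: (le_trans h); rewrite ler_piMr ?sv_ge0//.
by apply: (le_trans (rnorm_proj_compl _ of_K)); rewrite (orthonormal_norm oe ir).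
Qed.

Lemma trace_bound_sum A (I : eqType) (e : I -> H) (r : seq I) (C : R) : compact_operator A ->
  (forall n, \sum_(k < n) sv A k <= C) -> orthonormal e r ->
  cabs (\sum_(i <- r) hdot (A (e i)) (e i)) <= C.
Proof.
move=> cA AC oe; apply/ler_addgt0Pr => d d0.
have r1 : 0 < (size r)%:R + 1 :> R by rewrite ltr_wpDl.
have [N NP] := sv_vanish infH cA (divr_gt0 d0 r1).
apply: (le_trans (trace_bound N cA oe)); apply: lerD => //.
have := NP N (leqnn N); rewrite ltr_pdivlMr// => h.
have := sv_ge0 infH N cA; move: h; move: (sv A N) ((size r)%:R) r1 => a b; nra.
Qed.

Lemma schatten1P t : schatten_ideal 1%:E t <-> compact_operator t /\
  exists C : R, forall n, \sum_(k < n) sv t k <= C.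
Proof.
have E n : compact_operator t -> \sum_(k < n) sv t k `^ 1 = \sum_(k < n) sv t k.
  by move=> ct; apply: eq_bigr => k _; rewrite powRr1// sv_ge0.
split=> [/schatten_idealP[ct [C C0 /(schatten_leP _ (lexx 1) C0) tC]]|[ct [C tC]]].
  by split=> //; exists C => n; rewrite -E//; have := tC n; rewrite powRr1.
have C0 : 0 <= C by have := tC 0%N; rewrite big_ord0.
apply/schatten_idealP; split=> //; exists C => //; apply/(schatten_leP _ (lexx 1) C0) => n.
by rewrite E// powRr1.
Qed.

(* The partial sums are made to converge in the complete space H, along a unit vector. *)
Lemma complex_series (a : nat -> R[i]) (b : nat -> R) (C : R) :
  (forall n, cabs (a n) <= b n) -> (forall n, \sum_(k < n) b k <= C) ->
  exists l : R[i], forall d : R, 0 < d ->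
    exists N, forall n, (N <= n)%N -> cabs (\sum_(k < n) a k - l) < d.
Proof.
move=> ab bC; have [v v1] := unit_vector_ex infH.
pose s n := \sum_(k < n) a k.
have b0 n : 0 <= b n by apply: le_trans (ab n).
have hb : {homo (fun n => \sum_(k < n) b k) : m n / (m <= n)%N >-> m <= n}.
  by apply: homo_leq => [//|k m n|n]; [exact: le_trans|rewrite big_ord_recr lerDl].
have [d d0|w wP] := rnorm_cauchy (u := fun n => s n *: v).
  have [N NP] := nondecreasing_bounded_tail hb bC d0; exists N.
  have key n m : (N <= m)%N -> (m <= n)%N -> rnorm (s n *: v - s m *: v) < d.
    move=> Nm mn; rewrite -scalerBl rnormZ v1 mulr1; apply: le_lt_trans (NP m n Nm mn).
    rewrite /s -(subnKC mn) !big_split_ord /= addrAC subrr add0r addrAC subrr add0r.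
    by apply: (le_trans (cabs_sum _ _ _)); apply: ler_sum.
  move=> n m Nn Nm; have [mn|nm] := leqP m n; first exact: key.
  by rewrite rnormC; apply: key => //; exact: ltnW.
exists (hdot w v) => d /wP[N NP]; exists N => n /NP h.
apply: le_lt_trans h; rewrite cabsC.
have -> : hdot w v - s n = hdot (w - s n *: v) v.
  by rewrite hdotBl hdotZl hdotxx v1 expr1n mulr1.
by apply: (le_trans (cauchy_schwarz _ _)); rewrite v1 mulr1.
Qed.

Lemma sv_compr S T n : compact_operator S -> sv (bop_comp S T) n <= sv S n * nop T.
Proof.
move=> cS; apply: (sv_le infH (@compact_compr _ _ _ T cS)).
by apply: approx_compr; [exact: sv_ge0|exact: sv_approx].
Qed.

Section Tail.
Context (t : bop H) (f : nat -> H) (ct : compact_operator t) (st : is_svd t f (sv t)).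
Context (N : nat) (of_ : orthonormal f (iota 0 N)).

(** If v is orthogonal to f_N, ..., f_(N+n-1), then v minus its projection on the first N vectors is
    orthogonal to the first N + n, and the tail clause of the decomposition applies. *)
Let tail_approx n : approx (t - bop_comp t (projop of_)) n (sv t (N + n)%N).
Proof.
have [fo _ _ _ tail] := st.
exists (map f (iota N n)); first by rewrite size_map size_iota.
move=> v vf; rewrite bop_subE bop_compE projopE -bopB.
apply: (@le_trans _ _ (sv t (N + n) * rnorm (v - proj f (iota 0 N) v))).
  apply: tail => j jn; have [jN|Nj] := ltnP j N.
    by apply: proj_perp; rewrite ?mem_iota.
  rewrite hdotBl vf ?sub0r; last by apply: map_f; rewrite mem_iota Nj.
  rewrite hdot_suml big_seq big1 ?oppr0// => i; rewrite mem_iota add0n => /andP[_ iN].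
  by rewrite hdotZl fo (ltn_eqF (leq_trans iN Nj)) mulr0.
by apply: ler_wpM2l; [exact: sv_ge0|exact: rnorm_proj_compl].
Qed.

Lemma compact_tail : compact_operator (t - bop_comp t (projop of_)).
Proof.
apply/compact_approx => d d0; have [K KP] := sv_vanish infH ct d0; exists K.
by apply: approxW (leqnn K) _ (tail_approx K); apply/ltW/KP/leq_addl.
Qed.

Lemma sv_tail n : sv (t - bop_comp t (projop of_)) n <= sv t (N + n)%N.
Proof. by apply: (sv_le infH compact_tail); exact: tail_approx. Qed.

End Tail.

Lemma has_trace_sum (I : Type) (r : seq I) (F : I -> bop H) (l : I -> R[i]) :
  (forall i, has_trace (F i) (l i)) -> has_trace (\sum_(i <- r) F i) (\sum_(i <- r) l i).
Proof.
move=> Fl; elim: r => [|i r IH]; first by rewrite !big_nil; exact: has_trace0.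
by rewrite !big_cons -[F i]scale1r -[l i]mul1r; exact: has_trace_linear.
Qed.

(** Truncating t to its first N singular vectors gives explicit traces, and the remainder is
    uniformly small by [trace_bound_sum]. The second conclusion expresses the trace of t x through x
    t. *)
Lemma has_trace_comp t x f : schatten_ideal 1%:E t -> is_svd t f (sv t) ->
  exists2 l, has_trace (bop_comp t x) l & forall d : R, 0 < d ->
    exists N, forall n, (N <= n)%N -> cabs (\sum_(k < n) hdot (x (t (f k))) (f k) - l) < d.
Proof.
move=> /schatten1P[ct [C tC]] st; have fo : onseq f by case: st.
pose a k := hdot (x (t (f k))) (f k).
have ab k : cabs (a k) <= nop x * sv t k.
  apply: (le_trans (cauchy_schwarz _ _)); rewrite onseq_norm// mulr1.
  by apply: (le_trans (rnorm_bop _ _)); rewrite (svd_norm st).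
have [|l lP] := @complex_series a _ (nop x * C) ab.
  by move=> n; rewrite -mulr_sumr; apply: ler_wpM2l; [exact: nop_ge0|].
exists l => //; apply: has_trace_approx => d d0.
have x1 : 0 < nop x + 1 by have := nop_ge0 x; lra.
have [||N1 N1P] := nondecreasing_bounded_tail (a := fun n => \sum_(k < n) sv t k) _ tC
  (e := d / (nop x + 1)) _.
- by apply: homo_leq => [//|k m n|n]; [exact: le_trans|rewrite big_ord_recr lerDl sv_ge0].
- exact: divr_gt0.
have [N2 N2P] := lP d d0; pose N := maxn N1 N2.
have of_ := onseq_iota N fo.
exists (bop_comp (bop_comp t (projop of_)) x), (\sum_(k <- iota 0 N) a k); split.
- have -> : bop_comp (bop_comp t (projop of_)) x =
      \sum_(k <- iota 0 N) rank1 (t (f k)) (adjoint x (f k)).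
    rewrite comp_projop; apply: bopP => v; rewrite bop_compE !bop_sumE.
    by apply: eq_bigr => k _; rewrite !rank1E hdot_adjoint.
  apply: has_trace_sum => k; rewrite /a hdot_adjoint; exact: has_trace_rank1.
- by rewrite -[N in iota 0 N]subn0 big_mkord; exact/ltW/N2P/leq_maxr.
move=> J oJ; rewrite -bop_compBl.
have cT : compact_operator (t - bop_comp t (projop of_)) by exact: (compact_tail ct st).
apply: (trace_bound_sum (@compact_compr _ _ _ x cT) _ oJ) => n.
apply: (@le_trans _ _ (\sum_(k < n) sv t (N + k)%N * nop x)).
  apply: ler_sum => k _; apply: (le_trans (sv_compr x k cT)).
  by apply: ler_wpM2r; [exact: nop_ge0|exact: (sv_tail ct st of_)].
rewrite -mulr_suml; have := N1P N (N + n)%N (leq_maxl _ _) (leq_addr _ _).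
rewrite big_split_ord /= [X in X - _]addrC addrK ltr_pdivlMr// => h.
have : 0 <= \sum_(i < n) sv t (N + i)%N by apply: sumr_ge0 => i _; exact: sv_ge0.
by move: h; move: (\sum_(i < n) _) => u; lra.
Qed.

Lemma op_trace_linear t a x y : schatten_ideal 1%:E t ->
  op_trace (bop_comp t (a *: x + y)) = a * op_trace (bop_comp t x) + op_trace (bop_comp t y).
Proof.
move=> t1; have [f st] := singular_valuesP infH t1.1.
have [l tx _] := has_trace_comp x t1 st; have [m ty _] := has_trace_comp y t1 st.
by rewrite bop_comp_linr (op_traceE tx) (op_traceE ty); apply/op_traceE/has_trace_linear.
Qed.

Lemma op_trace_rank1 t u v : op_trace (bop_comp t (rank1 u v)) = hdot (t u) v.
Proof. by rewrite comp_rank1; apply/op_traceE/has_trace_rank1. Qed.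

(** The bound is in terms of x t, the product occurring in left seminorms: along the right singular
    vectors of t, the trace of t x is a diagonal sum of x t. *)
Lemma op_trace_le t x (c : R) : schatten_ideal 1%:E t -> 0 <= c ->
  (schatten_norm 1%:E (bop_comp x t) <= c%:E)%E -> cabs (op_trace (bop_comp t x)) <= c.
Proof.
move=> t1 c0 xt; have [f st] := singular_valuesP infH t1.1.
have [l tx lP] := has_trace_comp x t1 st; rewrite (op_traceE tx).
have cxt : compact_operator (bop_comp x t) by exact: compact_compl t1.1.
have xtc n : \sum_(k < n) sv (bop_comp x t) k <= c.
  have := (schatten_leP (bop_comp x t) (lexx 1) c0).1 xt n; rewrite powRr1//.
  by under eq_bigr => k _ do rewrite powRr1 ?sv_ge0//.
apply/ler_addgt0Pr => d d0; have [N /(_ N (leqnn N)) h] := lP d d0.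
have fo : onseq f by case: st.
have := trace_bound_sum cxt xtc (onseq_iota N fo).
rewrite -[N in iota 0 N]subn0 big_mkord => h2.
have := cabsD (l - \sum_(k < N) hdot (x (t (f k))) (f k)) (\sum_(k < N) hdot (x (t (f k))) (f k)).
rewrite subrK (cabsC l); move: h h2; rewrite /=.
move: (cabs (\sum_(k < N) _ - l)) (cabs l) => A B.
move: (cabs _) => D; lra.
Qed.

Lemma weak_star_le_mu p : (1 <= p)%E -> @open (weak_star_top H) `<=` @open (mu_top H p).
Proof.
move=> p1; suff : @open (weak_star_top H) `<=` @open (mu_top H 1%:E).
  by move=> w1 U /w1; exact: (mu_top_le infH (lexx 1%:E) p1).
apply: (@dominated_open R (bop H) (@weak_star_seminorms R H) (left_seminorms 1%:E)).
move=> _ [t t1 <-] e e0; have e20 : 0 < e / 2 by rewrite divr_gt0.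
exists [set (fun x => schatten_norm 1%:E (bop_comp x t))].
  by split; [exact: finite_set1|move=> _ ->; exists t].
exists (e / 2) => // x /(_ _ (erefl _))/ltW h; rewrite lte_fin.
by apply: le_lt_trans (op_trace_le t1 (ltW e20) h) _; lra.
Qed.

End TraceClass.

Section Functionals.
Context (R : realType) (H : hilbertType R) (infH : infinite_dimensional H).
Implicit Types (S T A t x y z : bop H) (u v w : H) (D : bop H -> R[i]).
Local Notation sv := singular_values.

(** Continuity at 0 for mu^*_oo, spelled out with lists of compact multipliers. *)
Definition compactly_continuous D := forall e : R, 0 < e -> exists ys zs : seq (bop H),
  [/\ forall y, y \in ys -> compact_operator y, forall z, z \in zs -> compact_operator z &
    exists2 d : R, 0 < d & forall x, (forall y, y \in ys -> nop (bop_comp x y) < d) ->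
      (forall z, z \in zs -> nop (bop_comp z x) < d) -> cabs (D x) < e].

Definition bop_functional D := forall a x y, D (a *: x + y) = a * D x + D y.

Section LinearFunctional.
Context (D : bop H -> R[i]) (lD : bop_functional D).

Lemma functional0 : D 0 = 0.
Proof. by have := lD (-1) 0 0; rewrite scaler0 addr0 mulN1r addNr. Qed.

Lemma functionalD x y : D (x + y) = D x + D y.
Proof. by have := lD 1 x y; rewrite scale1r mul1r. Qed.

Lemma functionalZ a x : D (a *: x) = a * D x.
Proof. by have := lD a x 0; rewrite !addr0 functional0 addr0. Qed.

Lemma functionalB x y : D (x - y) = D x - D y.
Proof. by rewrite functionalD -scaleN1r functionalZ mulN1r. Qed.

Lemma functional_sum (I : Type) (r : seq I) (F : I -> bop H) :
  D (\sum_(i <- r) F i) = \sum_(i <- r) D (F i).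
Proof. by apply: (big_morph D) => [x y|]; rewrite ?functionalD ?functional0. Qed.

End LinearFunctional.

(* Finite-rank operators are dense: x is approximated by x P + Q x - Q x P with
   P, Q finite-rank projections. *)
Lemma functional_rank1_eq0 D : bop_functional D -> compactly_continuous D ->
  (forall u v, D (rank1 u v) = 0) -> forall x, D x = 0.
Proof.
move=> lD cD D1 x; apply: cabs_small => e e0.
have [ys [zs [cys czs [d d0 dD]]]] := cD e e0.
have x1 : 0 < nop x + 1 by have := nop_ge0 x; lra.
pose c := d / (nop x + 1) / 2; have c0 : 0 < c by rewrite !divr_gt0.
have small (l : seq (bop H)) : (forall z, z \in l -> compact_operator z) ->
    exists h, exists oh : orthonormal id h,
      forall z, z \in l -> nop (z - bop_comp z (projop oh)) <= c.
  move=> /(small_perp c0)[g gP]; have [h oh hg] := gram_schmidt g.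
  exists h, oh => z zl; apply: nop_le; first exact: ltW.
  move=> v; rewrite bop_subE bop_compE projopE -bopB.
  apply: (@le_trans _ _ (c * rnorm (v - proj id h v))).
    by apply: gP => //; apply: hg => w wh; exact: proj_perp.
  by apply: ler_wpM2l; [exact: ltW|exact: rnorm_proj_compl].
(* Since x2 = (1 - Q) x (1 - P), the left seminorms need (1 - P) y small, that is adjoint y composed
   with 1 - P; so P is adapted to the adjoints of ys and Q to zs. *)
have [|h [oh hP]] := small (map (@adjoint R H) ys).
  by move=> _ /mapP[y yys ->]; apply/compact_adjoint/cys.
have [k [ok kP]] := small zs czs.
pose P := projop oh; pose Q := projop ok.
pose x1' := x - bop_comp x P.
pose x2 := x1' - bop_comp Q x1'.
have Dx : D x = D x2.
  have DP : D (bop_comp x P) = 0.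
    by rewrite comp_projop (functional_sum lD) big1// => i _; exact: D1.
  have DQ : D (bop_comp Q x1') = 0.
    by rewrite projop_comp (functional_sum lD) big1// => i _; exact: D1.
  by rewrite /x2 (functionalB lD) DQ /x1' (functionalB lD) DP !subr0.
have nx1 : nop x1' <= nop x.
  apply: nop_le => [|v]; first exact: nop_ge0.
  rewrite /x1' bop_subE bop_compE projopE -bopB.
  apply: (le_trans (rnorm_bop _ _)); apply: ler_wpM2l; first exact: nop_ge0.
  exact: rnorm_proj_compl.
have xc : nop x * c < d.
  have : d / (nop x + 1) * nop x <= d by rewrite mulrAC ler_pdivrMr//; nra.
  by rewrite /c; move: (d / (nop x + 1)) => q; nra.
rewrite Dx; apply/ltW/dD => [y yys|z zzs].
  apply: le_lt_trans xc.
  have yP : nop (y - bop_comp P y) <= c.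
    rewrite -nop_adjoint adjointB adjoint_comp adjoint_projop.
    by apply: hP; exact: map_f.
  have -> : bop_comp x2 y = bop_comp (x - bop_comp Q x) (y - bop_comp P y).
    apply: bopP => v; rewrite /x2 /x1' !(bop_subE, bop_compE, bopB).
    by rewrite !opprB !addrA; congr (_ - _); rewrite addrAC.
  apply: (le_trans (nop_comp _ _)); apply: ler_pM; rewrite ?nop_ge0//.
  apply: nop_le => [|v]; first exact: nop_ge0.
  rewrite bop_subE bop_compE projopE; apply: (le_trans (rnorm_proj_compl _ ok)).
  exact: rnorm_bop.
apply: le_lt_trans xc.
have -> : bop_comp z x2 = bop_comp (z - bop_comp z Q) x1'.
  by rewrite /x2 bop_compBr bop_compBl bop_compA.
apply: (le_trans (nop_comp _ _)); rewrite mulrC; apply: ler_pM; rewrite ?nop_ge0//.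
exact: kP.
Qed.

Lemma compactly_continuous_bounded D : bop_functional D -> compactly_continuous D ->
  exists2 C : R, 0 <= C & forall x, cabs (D x) <= C * nop x.
Proof.
move=> lD cD; have [ys [zs [_ _ [d d0 dD]]]] := cD 1 ltr01.
have [B B0 BP] : exists2 B : R, 0 <= B & forall y, y \in ys ++ zs -> nop y <= B.
  elim: (ys ++ zs) => [|y l [B B0 BP]]; first by exists 0.
  exists (B + nop y); first by rewrite addr_ge0 ?nop_ge0.
  by move=> z; rewrite inE => /predU1P[->|/BP h]; rewrite ?lerDr// ler_wpDr ?nop_ge0.
have B1 : 0 < B + 1 by lra.
have key x : nop x * (B + 1) < d -> cabs (D x) < 1.
  move=> xd; apply: dD => y yys; apply: le_lt_trans (nop_comp _ _) _.
    apply: le_lt_trans xd; apply: ler_wpM2l; first exact: nop_ge0.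
    by rewrite (le_trans (BP y _)) ?mem_cat ?yys// lerDl.
  apply: le_lt_trans xd; rewrite mulrC; apply: ler_wpM2l; first exact: nop_ge0.
  by rewrite (le_trans (BP y _)) ?mem_cat ?yys ?orbT// lerDl.
exists ((B + 1) / d); first by rewrite divr_ge0 ?ltW.
move=> x; rewrite leNgt; apply/negP => h.
have X0 : 0 < cabs (D x) by apply: le_lt_trans h; rewrite mulr_ge0 ?nop_ge0 ?divr_ge0 ?ltW.
have : cabs (D ((cabs (D x))^-1%:C%C *: x)) < 1.
  apply: key; apply: (@le_lt_trans _ _ ((cabs (D x))^-1 * nop x * (B + 1))).
    apply: ler_wpM2r; first exact: ltW.
    by apply: (le_trans (nopZ _ _)); rewrite cabsR ger0_norm// invr_ge0 ltW.
  rewrite -mulrA mulrC ltr_pdivrMr//.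
  by move: h; rewrite mulrAC ltr_pdivrMr// mulrC [_ * d]mulrC.
by rewrite (functionalZ lD) cabsM cabsR ger0_norm ?invr_ge0 ?(ltW X0)// mulVf ?gt_eqF// ltxx.
Qed.

Lemma functional_operator D (C : R) : bop_functional D -> 0 <= C ->
  (forall x, cabs (D x) <= C * nop x) ->
  exists t, forall u v, D (rank1 u v) = hdot (t u) v.
Proof.
move=> lD C0 DC.
(* [rank1 u v] is conjugate-linear in v, so [riesz] is applied to the conjugate of D. *)
have /choice[g gP] : forall u, exists w, forall v, Num.conj (D (rank1 u v)) = hdot v w.
  move=> u; apply: riesz => [a v w|]; last first.
    by exists (C * rnorm u) => v; rewrite cabsJ (le_trans (DC _))// nop_rank1 mulrA.
  have -> : rank1 u (a *: v + w) = Num.conj a *: rank1 u v + rank1 u w.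
    by apply: bopP => s; rewrite bop_addE bop_scaleE !rank1E hdotDr hdotZr scalerDl scalerA.
  by rewrite lD rmorphD rmorphM /= conjCK.
have gE u v : D (rank1 u v) = hdot (g u) v.
  by rewrite hdot_conj -gP conjCK.
have lg : linear g.
  move=> a u w; apply/eqP; rewrite -subr_eq0; apply/eqP/hdotP => v.
  rewrite hdotBl hdotDl hdotZl -!gE.
  have -> : rank1 (a *: u + w) v = a *: rank1 u v + rank1 w v.
    by apply: bopP => s; rewrite bop_addE bop_scaleE !rank1E scalerDr !scalerA mulrC.
  by rewrite lD subrr.
have bg : exists M : R, forall u, rnorm (g u) <= M * rnorm u.
  exists C => u; apply: rnorm_le_hdot; first exact: mulr_ge0.
  by rewrite -gE (le_trans (DC _))// nop_rank1 mulrA.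
by exists (Bop (bounded_operatorI lg bg)) => u v; exact: gE.
Qed.

(* Test the functional on the partial isometry mapping t e_i / |t e_i| to e_i. *)
Lemma functional_orthogonal_sum D (C : R) t (e : nat -> H) N : bop_functional D ->
  (forall x, cabs (D x) <= C * nop x) -> (forall u v, D (rank1 u v) = hdot (t u) v) ->
  0 <= C -> onseq e -> (forall i j, i != j -> hdot (t (e i)) (t (e j)) = 0) ->
  \sum_(i < N) rnorm (t (e i)) <= C.
Proof.
move=> lD DC Dt C0 oe te.
pose r := [seq i <- iota 0 N | t (e i) != 0].
have ur : uniq r by rewrite filter_uniq// iota_uniq.
pose g i := (rnorm (t (e i)))^-1%:C%C *: t (e i).
have og : orthonormal g r.
  split=> // i j; rewrite !mem_filter => /andP[i0 _] /andP[j0 _].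
  case: (eqVneq i j) => [->|ij]; first by rewrite hdotxx rnorm_unit// expr1n.
  by rewrite hdotZl hdotZr te// !mulr0.
pose x := \sum_(i <- r) rank1 (e i) (g i).
have nx : nop x <= 1.
  apply: nop_le => // v; rewrite mul1r -(@ler_pXn2r _ 2) ?nnegrE//.
  rewrite bop_sumE (rnorm2_sum_orthonormal _ (onseq_orthonormal oe ur)).
  exact: bessel.
have Dx : D x = (\sum_(i < N) rnorm (t (e i)))%:C%C.
  rewrite (functional_sum lD) rmorph_sum -(big_mkord xpredT (fun i => (rnorm (t (e i)))%:C%C)) /=.
  rewrite /index_iota subn0 [RHS](bigID (fun i => t (e i) != 0)) /=.
  rewrite [X in _ + X]big1 ?addr0; last by move=> i /negPn/eqP ->; rewrite rnorm0.
  rewrite big_filter; apply: eq_bigr => i i0.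
  rewrite Dt hdotZr hdotxx conj_Creal ?complex_real// -rmorphM expr2 mulKf//.
  by rewrite rnorm_eq0.
have := DC x; rewrite Dx cabsR => h; apply: (le_trans (ler_norm _)); apply: (le_trans h).
by rewrite ler_piMr.
Qed.

(** The operator t representing D on rank-one operators is compact, since an orthonormal sequence
    with |t e_i| > c and orthogonal images would violate [functional_orthogonal_sum]; the same bound
    makes t trace-class. The difference of D and the trace functional vanishes on rank-one
    operators. *)
Lemma functional_trace_class D : bop_functional D -> compactly_continuous D ->
  exists2 t, schatten_ideal 1%:E t & forall x, D x = op_trace (bop_comp t x).
Proof.
move=> lD cD; have [C C0 DC] := compactly_continuous_bounded lD cD.
have [t Dt] := functional_operator lD C0 DC.
have sumC := fun e N => @functional_orthogonal_sum D C t e N lD DC Dt C0.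
have ct : compact_operator t.
  apply/compact_approx => c c0; apply: contrapT => nt.
  have [|e [oe te ct]] := @not_approx_onseq _ _ t c.
    by move=> n an; apply: nt; exists n.
  have key N : N%:R * c <= C.
    apply: le_trans (sumC e N oe te).
    rewrite mulr_natl -[N in _ *+ N]card_ord -sumr_const; apply: ler_sum => i _.
    exact/ltW/ct.
  have := key (Num.trunc (C / c)).+1; apply/negP; rewrite -ltNge -ltr_pdivrMr//.
  exact: truncnS_gt.
have t1 : schatten_ideal 1%:E t.
  apply/(schatten1P infH); split=> //; exists C => n; have [e st] := singular_valuesP infH ct.
  have oe : onseq e by case: st.
  under eq_bigr do rewrite -(svd_norm st).
  by apply: sumC => // i j /negbTE ij; rewrite (svd_hdot st) ij mulr0n.
exists t => // x; apply/eqP; rewrite -subr_eq0; apply/eqP.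
pose E x := D x - op_trace (bop_comp t x).
apply: (@functional_rank1_eq0 E) => [a y z|e e0|u v]; last 1 first.
- by rewrite /E Dt op_trace_rank1 subrr.
- by rewrite /E lD op_trace_linear//; ring.
have e20 : 0 < e / 2 by rewrite divr_gt0.
have e40 : 0 < e / 4 by rewrite divr_gt0.
have [ys [zs [cys czs [d d0 dD]]]] := cD _ e20.
(* The trace functional is controlled by the L^1 seminorm of t; domination with q = oo replaces t by
   a compact multiplier w. *)
have [w [cw _] [c c0 wP]] := left_dominated infH (lexx 1%:E) (leey _) t1 e40.
exists (w :: ys), zs; split=> //.
  by move=> y; rewrite inE => /predU1P[->//|/cys].
exists (Num.min d c); first by rewrite lt_min d0.
move=> y yys yzs.
have h1 : cabs (D y) < e / 2.
  apply: dD => z zl.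
    by have := yys z; rewrite inE zl orbT lt_min => /(_ isT)/andP[].
  by have := yzs z zl; rewrite lt_min => /andP[].
have h2 : cabs (op_trace (bop_comp t y)) <= e / 4.
  apply: (op_trace_le infH t1 (ltW e40)); apply/ltW/wP; rewrite schatten_pinfty lte_fin.
  by have := yys w (mem_head _ _); rewrite lt_min => /andP[].
apply: le_lt_trans (cabsD _ _) _; rewrite cabsN; lra.
Qed.

End Functionals.

Section ContinuousFunctionals.
Context (R : realType) (H : hilbertType R) (infH : infinite_dimensional H).
Implicit Types (f : {scalar bop H}) (p : \bar R) (P Q : set (bop H -> \bar R)).

Lemma continuous_seminormed_le P Q f : @open (seminormed P) `<=` @open (seminormed Q) ->
  continuous (f : seminormed P -> R[i]^o) -> continuous (f : seminormed Q -> R[i]^o).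
Proof. by move=> PQ /continuousP cf; apply/continuousP => A /cf/PQ. Qed.

Lemma continuous_small P f (e : R) : continuous (f : seminormed P -> R[i]^o) -> 0 < e ->
  exists2 F : set (bop H -> \bar R), finite_set F /\ F `<=` P & exists2 d : R, 0 < d &
    forall x, (forall g, F g -> (g x < d%:E)%E) -> cabs (f x) < e.
Proof.
move=> cf e0.
have : nbhs (f 0 : R[i]^o) [set z : R[i]^o | cabs z < e].
  apply/rnorm_nbhs; exists e => // z; rewrite raddf0 /rnorm sub0r normrN //.
move=> /(cf 0)/nbhs0_seminormed[F FP [d d0 Fd]].
by exists F => //; exists d => // x xF; exact: Fd.
Qed.

Lemma functional_scalar f : bop_functional (f : bop H -> R[i]).
Proof. by move=> a x y; rewrite linearP. Qed.

(** Every mu^*_p is contained in mu^*_oo, so one compactness condition covers all exponents. *)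
Lemma continuous_mu_star_compactly p f : (1 <= p)%E ->
  continuous (f : mu_star_top H p -> R[i]^o) -> compactly_continuous (f : bop H -> R[i]).
Proof.
move=> p1 cf e e0.
have {}cf := continuous_seminormed_le (mu_star_top_le infH p1 (leey p)) cf.
have [F [finF FP] [d d0 Fd]] := continuous_small cf e0.
have [ys [zs [ysP zsP Fyz]]] := finite_bilateral finF FP.
exists ys, zs; split=> [y /ysP[]//|z /zsP[]//|]; exists d => // x xy zx.
by apply: Fd => g /Fyz[[y /xy h ->]|[z /zx h ->]]; rewrite schatten_pinfty lte_fin.
Qed.

Lemma op_trace_weak_star_continuous f t : schatten_ideal 1%:E t ->
  (forall x, f x = op_trace (bop_comp t x)) -> continuous (f : weak_star_top H -> R[i]^o).
Proof.
move=> t1 ft; apply/continuousP => A oA; apply/seminormed_openP => x /= fxA.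
have /rnorm_nbhs[d d0 dA] : nbhs (f x : R[i]^o) A by exact: open_nbhs_nbhs.
exists [set (fun x => (complex.Re `|op_trace (bop_comp t x)|)%:E)].
  by split; [exact: finite_set1|move=> _ ->; exists t].
exists d => // y /(_ _ (erefl _)); rewrite lte_fin -ft raddfB => h.
by apply: dA; rewrite rnormC.
Qed.

Lemma continuous_functionalP p f : (1 <= p)%E ->
  (continuous (f : mu_top H p -> R[i]^o) <-> continuous (f : weak_star_top H -> R[i]^o)) /\
  (continuous (f : mu_star_top H p -> R[i]^o) <-> continuous (f : weak_star_top H -> R[i]^o)).
Proof.
move=> p1.
have mu_star : continuous (f : mu_top H p -> R[i]^o) -> continuous (f : mu_star_top H p -> R[i]^o).
  exact: (continuous_seminormed_le (@mu_top_le_star R H p)).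
have weak_mu : continuous (f : weak_star_top H -> R[i]^o) -> continuous (f : mu_top H p -> R[i]^o).
  exact: (continuous_seminormed_le (weak_star_le_mu infH p1)).
have star_weak : continuous (f : mu_star_top H p -> R[i]^o) ->
    continuous (f : weak_star_top H -> R[i]^o).
  move=> /(continuous_mu_star_compactly p1) cf.
  have [t t1 ft] := functional_trace_class infH (functional_scalar f) cf.
  exact: op_trace_weak_star_continuous t1 ft.
split; split.
- by move=> /mu_star/star_weak.
- exact: weak_mu.
- exact: star_weak.
- by move=> /weak_mu/mu_star.
Qed.

End ContinuousFunctionals.

Theorem theoremA (R : realType) (H : hilbertType R)
    (infdim : infinite_dimensional H) :
  (* (1) *)
  (forall p q : \bar R, (1 <= p)%E -> (p < q)%E ->
    [/\ @open (mu_top H p) `<` @open (mu_top H q),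
        @open (mu_star_top H p) `<` @open (mu_star_top H q) &
        ~ (@open (mu_top H q) `<=` @open (mu_star_top H p))]) /\
  (* (2) *)
  (forall (p q : \bar R) (S : set (bop H)), (1 <= p)%E -> (1 <= q)%E ->
    norm_bounded S ->
    @trace_topology (mu_top H p) S = @trace_topology (mu_top H q) S /\
    @trace_topology (mu_star_top H p) S =
      @trace_topology (mu_star_top H q) S) /\
  (* (3) *)
  (forall p : \bar R, (1 <= p)%E ->
    (forall S : set (bop H),
      (@tvs_bounded R (mu_top H p) S <-> norm_bounded S) /\
      (@tvs_bounded R (mu_star_top H p) S <-> norm_bounded S)) /\
    (forall f : {scalar bop H},
      (continuous (f : mu_top H p -> R[i]^o) <->
        continuous (f : weak_star_top H -> R[i]^o)) /\
      (continuous (f : mu_star_top H p -> R[i]^o) <->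
        continuous (f : weak_star_top H -> R[i]^o)))).
Proof.
split; [|split].
(* The failed inclusion of mu_q in mu^*_p yields both strictness claims, because mu_p lies in mu^*_p
   and mu_q in mu^*_q. *)
- move=> p q p1 pq; have not_le := mu_top_not_le_star infdim p1 pq.
  split=> //; split.
  + exact: (mu_top_le infdim p1 (ltW pq)).
  + by move=> qp; apply: not_le; apply: subset_trans qp (@mu_top_le_star R H p).
  + exact: (mu_star_top_le infdim p1 (ltW pq)).
  + by move=> qp; apply: not_le; exact: subset_trans (@mu_top_le_star R H q) qp.
- move=> p q S p1 q1 bS.
  by rewrite -!trace_mu_sot// -!trace_mu_star_sot_star.
- move=> p p1; split=> [S|f]; first exact: tvs_boundedP.
  exact: continuous_functionalP.
Qed.
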